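(* Let $G\subseteq \mathrm{GL}(n,\mathbb{C})$ be a finite small matrix group, let $X_0:=\mathbb{C}^n/G=\mathrm{Spec}\,\mathbb{C}[S_1,\ldots,S_n]^G$, let $[G,G]$ be the derived subgroup and $G':=G/[G,G]$ the abelianization. Then the following procedure correctly computes the Cox ring of $X_0$. (1) Compute generators $f_1,\ldots,f_s$ of the invariant ring $\mathbb{C}[S_1,\ldots,S_n]^{[G,G]}$. (2) Modify them to a system $g_1,\ldots,g_s$ of generators of $\mathbb{C}[S_1,\ldots,S_n]^{[G,G]}$ which are homogeneous (in the standard grading) and $G'$-homogeneous, by computing simultaneous eigenvectors of the induced action of $G'$ on the vector spaces $V_d$ of all degree-$d$ polynomials in $\mathbb{C}[S_1,\ldots,S_n]^{[G,G]}$, where $d\in\{\deg(f_1),\ldots,\deg(f_s)\}$. Let $\chi_i\in\mathbb{X}(G')$ be the character with $m\cdot g_i=\chi_i(m)g_i$ for all $m \in G'$. (3) In $\mathbb{C}[S_1,\ldots,S_n,T_1,\ldots,T_s]$ let $J:=\langle T_i-g_i;\ 1\le i\le s\rangle$ and compute $I_0:=J\cap\mathbb{C}[T_1,\ldots,T_s]$. (4) Let $Q_0\colon\mathbb{Z}^s\to\mathbb{X}(G')$ be the homomorphism $e_i\mapsto\chi_i$. That is, $\mathrm{Cl}(X_0)\cong\mathbb{X}(G')$, and the algebra $\mathbb{C}[T_1,\ldots,T_s]/I_0$ with the $\mathbb{X}(G')$-grading given by $\deg(T_i)=\chi_i$ (degree map $Q_0$) is isomorphic, as a $\mathrm{Cl}(X_0)$-graded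 algebra, to the Cox ring of $X_0$.
   Context: A matrix group $G\subseteq\mathrm{GL}(n,\mathbb{C})$ is small if it contains no pseudo-reflections, i.e. no elements $A$ of finite order whose fixed space $(\mathbb{C}^n)^A$ is a hyperplane. $\mathbb{X}(G')$ denotes the group of characters $G'\to\mathbb{C}^*$. The group $G'$ acts on $\mathbb{C}[S_1,\ldots,S_n]^{[G,G]}$ since $[G,G]$ is normal in $G$; a polynomial is called $G'$-homogeneous if it is a simultaneous eigenvector for this action. Cox ring: for a normal variety $X$ with $\Gamma(X,\mathcal{O}^* )=\mathbb{C}^*$ and finitely generated divisor class group $\mathrm{Cl}(X)$, the Cox ring is the $\mathrm{Cl}(X)$-graded algebra $\bigoplus_{[D]\in\mathrm{Cl}(X)}\Gamma(X,\mathcal{O}(D))$. In the presence of torsion this is made precise as follows: choose a finitely generated group $K$ of Weil divisors mapping onto $\mathrm{Cl}(X)$ with kernel $K^0$, and a homomorphism $\chi\colon K^0\to\mathbb{C}(X)^*$ with $\mathrm{div}(\chi(E))=E$; the Cox ring is the ring of global sections of the sheaf $\bigoplus_{D\in K}\mathcal{O}(D)$ modulo the ideal sheaf generated by all $1-\chi(E)$, $E\in K^0$, where $\chi(E)$ is regarded as an element of degree $-E$.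
   Formalization: That step (2) can be carried out is asserted only when f_1,…,f_s are nonzero and homogeneous, since for inhomogeneous generators it can fail (e.g. S_1+S_2^2, S_2+(S_1+S_2^2)^2 with G trivial); correctness is proved for every system g_1,…,g_s as in step (2). *)

(* Defs.v *)
From HB Require Import structures.
From mathcomp Require Import all_boot all_order all_algebra finmap.
From mathcomp Require Import all_fingroup all_solvable mxrepresentation.
From mathcomp Require Import ring_quotient.
From mathcomp Require Import mathcomp_extra boolp classical_sets functions.
From mathcomp Require Import reals complex.
From mathcomp.multinomials Require Import monalg.

Set Implicit Arguments.
Unset Strict Implicit.
Unset Printing Implicit Defensive.

Import Order.TTheory GRing.Theory Num.Theory.
Local Open Scope ring_scope.
Local Open Scope quotient_scope.

(* ------------------------------------------------------------------------ *)
(** * Group rings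

   [group_ring K F] is the commutative ring F[K] of finitely supported
   functions from an abelian group K, written additively, to F.  The ring
   structure that the library puts on [{malg F[K]}] is not available, since
   it requires 0 to be the only invertible element of K.  [gr_coeff D s] is the
   value of s at D, and [gr_single D a] takes the value a at D and 0 elsewhere. *)

Definition group_ring (K : zmodType) (F : comNzRingType) : Type := {malg F[K]}.

HB.instance Definition _ (K : zmodType) (F : comNzRingType) :=
  GRing.Zmodule.copy (group_ring K F) {malg F[K]}.

Section GroupRing.
Context (K : zmodType) (F : comNzRingType).
Local Notation GR := (group_ring K F).
Implicit Types (s t : GR) (k l : K).

Definition gr_one : GR := << 1 *g (0 : K) >>.

Definition gr_mul s t : GR :=
  \sum_(k <- msupp s) \sum_(l <- msupp t) << s@_k * t@_l *g k + l >>.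

Lemma gr_mulw (d e : {fset K}) s t :
  (msupp s `<=` d)%fset -> (msupp t `<=` e)%fset ->
  gr_mul s t = \sum_(k <- d) \sum_(l <- e) << s@_k * t@_l *g k + l >>.
Proof.
move=> sd te; rewrite /gr_mul (big_fset_incl _ sd) /=.
  apply: eq_bigr => k _; apply: big_fset_incl => // l _ /mcoeff_outdom ->.
  by rewrite mulr0 monalgU0.
move=> k _ /mcoeff_outdom sk0.
by rewrite big1 // => l _; rewrite sk0 mul0r monalgU0.
Qed.

Lemma gr_mulC : commutative gr_mul.
Proof.
move=> s t; rewrite /gr_mul exchange_big; apply: eq_bigr => l _.
by apply: eq_bigr => k _; rewrite mulrC addrC.
Qed.

Lemma gr_mulDl : left_distributive gr_mul +%R.
Proof.
move=> s1 s2 t.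
rewrite (@gr_mulw (msupp s1 `|` msupp s2)%fset (msupp t)) ?fsubset_refl ?msuppD_le //.
rewrite (@gr_mulw (msupp s1 `|` msupp s2)%fset (msupp t) s1) ?fsubset_refl ?fsubsetUl //.
rewrite (@gr_mulw (msupp s1 `|` msupp s2)%fset (msupp t) s2) ?fsubset_refl ?fsubsetUr //.
rewrite -big_split /=; apply: eq_bigr => k _.
rewrite -big_split /=; apply: eq_bigr => l _.
by rewrite mcoeffD mulrDl monalgUD.
Qed.

Lemma gr_mulDr : right_distributive gr_mul +%R.
Proof. by move=> s t1 t2; rewrite gr_mulC gr_mulDl ![gr_mul _ s]gr_mulC. Qed.

Lemma gr_mul0 t : gr_mul 0 t = 0.
Proof. by rewrite /gr_mul msupp0 big_seq_fset0. Qed.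

Lemma gr_mulUU a b k l :
  gr_mul << a *g k >> << b *g l >> = << a * b *g k + l >>.
Proof. by rewrite (gr_mulw msuppU_le msuppU_le) !big_seq_fset1 !mcoeffUU. Qed.

Lemma gr_mul_suml (I : Type) (r : seq I) (h : I -> GR) t :
  gr_mul (\sum_(i <- r) h i) t = \sum_(i <- r) gr_mul (h i) t.
Proof.
exact: (big_morph (gr_mul^~ t) (fun u v => gr_mulDl u v t) (gr_mul0 t)).
Qed.

Lemma gr_mul_sumr (I : Type) (r : seq I) (h : I -> GR) s :
  gr_mul s (\sum_(i <- r) h i) = \sum_(i <- r) gr_mul s (h i).
Proof. by rewrite gr_mulC gr_mul_suml; apply: eq_bigr => i _; rewrite gr_mulC. Qed.

Lemma gr_mulA : associative gr_mul.
Proof.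
have mulU := gr_mulUU; have suml := gr_mul_suml; have sumr := gr_mul_sumr.
move: gr_mul mulU suml sumr => mul mulU suml sumr s t u.
rewrite [s]monalgE !suml; apply: eq_bigr => k _.
rewrite [t]monalgE suml !sumr suml; apply: eq_bigr => l _.
rewrite [u]monalgE !sumr; apply: eq_bigr => m _.
by rewrite !mulU mulrA addrA.
Qed.

Lemma gr_mul1 : left_id gr_one gr_mul.
Proof.
move=> s; rewrite {1}[s]monalgE gr_mul_sumr [RHS]monalgE; apply: eq_bigr => k _.
by rewrite gr_mulUU mul1r add0r.
Qed.

Lemma gr_one_neq0 : gr_one != 0 :> GR.
Proof. by rewrite monalgU_eq0 oner_eq0. Qed.

HB.instance Definition _ := GRing.Zmodule_isComNzRing.Build (group_ring K F)
  gr_mulA gr_mulC gr_mul1 gr_mulDl gr_one_neq0.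

Definition gr_coeff (D : K) (s : GR) : F := s@_D.
Definition gr_single (D : K) (a : F) : GR := << a *g D >>.

Lemma gr_coeff_is_zmod_morphism D : zmod_morphism (gr_coeff D).
Proof. exact: raddfB. Qed.
HB.instance Definition _ D :=
  GRing.isZmodMorphism.Build GR F (gr_coeff D) (gr_coeff_is_zmod_morphism D).

Lemma gr_single_is_zmod_morphism D : zmod_morphism (gr_single D).
Proof. exact: raddfB. Qed.
HB.instance Definition _ D :=
  GRing.isZmodMorphism.Build F GR (gr_single D) (gr_single_is_zmod_morphism D).

Lemma gr_coeffB D s t : gr_coeff D (s - t) = gr_coeff D s - gr_coeff D t.
Proof. exact: mcoeffB. Qed.

Lemma gr_coeff_single D E a :
  gr_coeff D (gr_single E a) = if E == D then a else 0.
Proof. by rewrite /gr_coeff mcoeffU; case: eqP; rewrite ?mulr1n ?mulr0n. Qed.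

Lemma gr_single1 : gr_single 0 1 = 1. Proof. by []. Qed.

Lemma gr_singleM D E a b :
  gr_single D a * gr_single E b = gr_single (D + E) (a * b).
Proof. exact: gr_mulUU. Qed.

Lemma gr_sum_single s : s = \sum_(D <- msupp s) gr_single D (gr_coeff D s).
Proof. exact: monalgE. Qed.

Lemma gr_coeffM_ind (Q : F -> Prop) s t D : Q 0 ->
  (forall a b, Q a -> Q b -> Q (a + b)) ->
  (forall k l, k + l = D -> Q (gr_coeff k s * gr_coeff l t)) ->
  Q (gr_coeff D (s * t)).
Proof.
move=> Q0 QD QM; rewrite [s]gr_sum_single [t]gr_sum_single.
rewrite mulr_suml raddf_sum; elim/big_ind: _ => // k _.
rewrite mulr_sumr raddf_sum; elim/big_ind: _ => // l _ /=.
by rewrite gr_singleM gr_coeff_single; case: eqP => // /QM.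
Qed.

(* The linear form sending D in the subset P to chi D, and the other elements
   of K to 0. *)
Section LinearForm.
Context (P : K -> Prop) (chi : K -> F).

Definition gr_form s : F :=
  \sum_(D <- msupp s) (if `[< P D >] then gr_coeff D s * chi D else 0).

Lemma gr_formw (d : {fset K}) s : (msupp s `<=` d)%fset ->
  gr_form s = \sum_(D <- d) (if `[< P D >] then gr_coeff D s * chi D else 0).
Proof.
move=> sd; rewrite /gr_form (big_fset_incl _ sd) //= => D _ /mcoeff_outdom sD0.
by rewrite /gr_coeff sD0 mul0r if_same.
Qed.

Lemma gr_formD s t : gr_form (s + t) = gr_form s + gr_form t.
Proof.
rewrite (@gr_formw (msupp s `|` msupp t)%fset) ?msuppD_le //.
rewrite (@gr_formw (msupp s `|` msupp t)%fset s) ?fsubsetUl //.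
rewrite (@gr_formw (msupp s `|` msupp t)%fset t) ?fsubsetUr //.
rewrite -big_split /=; apply: eq_bigr => D _.
by case: asboolP => _; rewrite ?addr0 // raddfD mulrDl.
Qed.

Lemma gr_form_single D a :
  gr_form (gr_single D a) = if `[< P D >] then a * chi D else 0.
Proof.
by rewrite (@gr_formw [fset D]%fset) ?msuppU_le // big_seq_fset1 gr_coeff_single eqxx.
Qed.

Lemma gr_form_sum (I : Type) (r : seq I) (h : I -> GR) :
  gr_form (\sum_(i <- r) h i) = \sum_(i <- r) gr_form (h i).
Proof.
by apply: (big_morph gr_form gr_formD); rewrite /gr_form msupp0 big_seq_fset0.
Qed.

Lemma gr_form1 : P 0 -> gr_form 1 = chi 0.
Proof. by move=> P0; rewrite -gr_single1 gr_form_single asboolT // mul1r. Qed.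

Hypothesis PB : forall D E, P D -> P E -> P (D - E).
Hypothesis chiD : forall D E, P D -> P E -> chi (D + E) = chi D * chi E.

Lemma gr_form_relation s E : P E ->
  gr_form (s * (1 - gr_single (- E) (chi E))) = 0.
Proof.
move=> PE; rewrite [s]gr_sum_single mulr_suml gr_form_sum big1 // => D _.
rewrite mulrBr mulr1 gr_singleM -raddfN gr_formD !gr_form_single.
case: (asboolP (P D)) => [PD|nPD].
  rewrite asboolT; last exact: PB.
  rewrite mulNr -mulrA -chiD ?subrr //; last exact: PB.
  by rewrite [E + _]addrC subrK subrr.
rewrite asboolF ?addr0 // => PDE; apply: nPD.
have P0 : P 0 by rewrite -(subrr E); exact: PB.
rewrite -[D](subrK E) -[E in _ + E]opprK; apply: PB => //.
by rewrite -sub0r; exact: PB.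
Qed.

End LinearForm.

End GroupRing.

(* ------------------------------------------------------------------------ *)
(** * Divisors on the affine variety X = Spec A, A an integral domain *)

Local Notation "x %:F" := (tofrac x).

Section Divisors.
Local Open Scope classical_set_scope.
Local Open Scope ring_scope.
Context (A : idomainType).
Local Notation F := {fraction A}.

Definition prime_ideal (P : set A) : Prop :=
  [/\ P 0, (forall a b, P a -> P b -> P (a + b)),
      (forall a b, P b -> P (a * b)), ~ P 1
    & forall a b, P (a * b) -> P a \/ P b].

Definition spec := {x : set A | `[< prime_ideal x >]}.

Lemma specP (x : spec) : prime_ideal (sval x).
Proof. by apply/asboolP; exact: (svalP x). Qed.

Lemma prime_ideal0 : prime_ideal [set 0].
Proof.
split=> //=.
- by move=> a b -> ->; rewrite addr0.
- by move=> a b ->; rewrite mulr0.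
- by move/eqP; rewrite oner_eq0.
- by move=> a b /eqP; rewrite mulf_eq0 => /orP[] /eqP; [left | right].
Qed.

Definition spec_generic : spec := exist _ [set 0] (asboolT prime_ideal0).

HB.instance Definition _ := Choice.on spec.
HB.instance Definition _ := isPointed.Build spec spec_generic.

Definition zariski_open (U : set spec) : Prop :=
  exists E : set A, U = [set x | exists2 a, E a & ~ sval x a].

Lemma zariski_openI U V :
  zariski_open U -> zariski_open V -> zariski_open (U `&` V).
Proof.
move=> [E ->] [E' ->].
exists [set c | exists a b, [/\ E a, E' b & c = a * b]].
apply/seteqP; split=> x /= [].
  move=> [a Ea xa] [b E'b xb]; exists (a * b); first by exists a, b.
  by case: (specP x) => _ _ _ _ pr /pr [].
move=> _ [a [b [Ea E'b ->]]] xab; case: (specP x) => _ _ idl _ _.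
split; [exists a => // xa | exists b => // xb]; apply: xab; last exact: idl.
by rewrite mulrC; exact: idl.
Qed.

Lemma zariski_openT : zariski_open setT.
Proof.
exists [set 1]; apply/seteqP; split=> // x _ /=; exists 1 => //.
by case: (specP x).
Qed.

(* Minimal among the nonzero primes: A being a domain, this says that the
   longest chain of primes ending at x has length 1. *)
Definition height_one (x : spec) : Prop :=
  (exists2 a, sval x a & a != 0) /\
  forall y : spec, (sval y `<=` sval x)%classic -> y = spec_generic \/ y = x.

(* A prime divisor of X, represented by its generic point. *)
Definition prime_divisor := {x : spec | `[< height_one x >]}.

(* The local ring of X at x, inside the function field. *)
Definition local_ring (x : spec) : set F :=
  [set f | exists a b, ~ sval x b /\ f = a%:F / b%:F].

(* Only the values at nonzero elements are meaningful. *)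
Definition discrete_valuation (v : F -> int) : Prop :=
  [/\ (forall f g, f != 0 -> g != 0 -> v (f * g) = v f + v g),
      (forall f g, f != 0 -> g != 0 -> f + g != 0 ->
         Order.min (v f) (v g) <= v (f + g))
    & forall m, exists2 f, f != 0 & v f = m].

Definition is_ord (P : prime_divisor) (v : F -> int) : Prop :=
  discrete_valuation v /\
  forall f, f != 0 -> (local_ring (val P) f <-> 0 <= v f).

(* The vanishing order along P.  When X is normal, the local ring at P is a
   discrete valuation ring, and its normalized valuation is the only v with
   [is_ord P v] (up to the irrelevant value at 0).  If there is no such v,
   [ord P] is 0. *)
Definition ord (P : prime_divisor) (f : F) : int :=
  xget (fun=> 0 : int) [set v | is_ord P v] f.

Implicit Types (P : prime_divisor) (f g : F) (D E : {malg prime_divisor}).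

Lemma ordM P f g : f != 0 -> g != 0 -> ord P (f * g) = ord P f + ord P g.
Proof.
by rewrite /ord; case: xgetP => [v _ [[vM _ _] _]|_ _ _]; [exact: vM | rewrite addr0].
Qed.

Lemma ord_min P f g : f != 0 -> g != 0 -> f + g != 0 ->
  Order.min (ord P f) (ord P g) <= ord P (f + g).
Proof.
by rewrite /ord; case: xgetP => [v _ [[_ vD _] _]|_ _ _]; [exact: vD | rewrite minxx].
Qed.

Lemma ord1 P : ord P 1 = 0.
Proof. by apply: (addrI (ord P 1)); rewrite -ordM ?oner_eq0 ?mulr1 ?addr0. Qed.

Lemma ordV P f : f != 0 -> ord P f^-1 = - ord P f.
Proof.
move=> f0; apply: (addrI (ord P f)).
by rewrite subrr -ordM ?invr_eq0 // divff // ord1.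
Qed.

Lemma ordN P f : ord P (- f) = ord P f.
Proof.
have [->|f0] := eqVneq f 0; first by rewrite oppr0.
have ordN1 : ord P (-1) = 0.
  have N10 : -1 != 0 :> F by rewrite oppr_eq0 oner_eq0.
  have := ordM P N10 N10; rewrite mulrNN mulr1 ord1.
  by move/esym/eqP; rewrite -mulr2n mulrn_eq0 => /eqP.
by rewrite -mulN1r ordM ?ordN1 ?add0r // oppr_eq0 oner_eq0.
Qed.

Lemma ord_ge0 P a : a != 0 -> 0 <= ord P a%:F.
Proof.
move=> a0; rewrite /ord; case: xgetP => [v _ [_ vP]|//].
apply/vP; first by rewrite tofrac_eq0.
by exists a, 1; rewrite rmorph1 divr1; split=> //; case: (specP (val P)).
Qed.

Definition weil_divisor := {malg prime_divisor}.
HB.instance Definition _ := GRing.Zmodule.on weil_divisor.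

Definition is_div (f : F) (D : weil_divisor) : Prop :=
  f != 0 /\ forall P, D@_P = ord P f.

Definition principal : {pred weil_divisor} :=
  fun D => `[< exists f, is_div f D >].

Lemma principal_zmod_closed : zmod_closed principal.
Proof.
split; first by apply/asboolP; exists 1; split=> [|P];
  rewrite ?oner_eq0 // mcoeff0 ord1.
move=> D E /asboolP [f [f0 Df]] /asboolP [g [g0 Eg]].
apply/asboolP; exists (f / g); split; first by rewrite mulf_neq0 ?invr_eq0.
by move=> P; rewrite mcoeffB Df Eg ordM ?invr_eq0 // ordV.
Qed.

HB.instance Definition _ :=
  GRing.isZmodClosed.Build weil_divisor principal principal_zmod_closed.

(* The divisor class group Cl(X). *)
Definition class_group := Quotient.quot principal.
HB.instance Definition _ := GRing.Zmodule.on class_group.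

Definition divisor_class (D : weil_divisor) : class_group :=
  \pi_(Quotient.quot principal) D.

Lemma divisor_class_is_zmod_morphism : zmod_morphism divisor_class.
Proof. exact: raddfB. Qed.

Lemma divisor_classB D E :
  divisor_class (D - E) = divisor_class D - divisor_class E.
Proof. exact: divisor_class_is_zmod_morphism. Qed.

HB.instance Definition _ := GRing.isZmodMorphism.Build weil_divisor class_group
  divisor_class divisor_class_is_zmod_morphism.

(* The sections of O(D) over U: the rational functions f with
   div(f) + D >= 0 on U. *)
Definition sheaf_O (D : weil_divisor) (U : set spec) : set F :=
  [set f | f != 0 -> forall P : prime_divisor, U (val P) -> 0 <= ord P f + D@_P].

Lemma sheaf_O0 D U : sheaf_O D U 0. Proof. by rewrite /sheaf_O /= eqxx. Qed.

Lemma sheaf_OD D U f g : sheaf_O D U f -> sheaf_O D U g -> sheaf_O D U (f + g).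
Proof.
move=> Uf Ug fg0 P UP.
have [f0|f0] := eqVneq f 0; first by move: fg0; rewrite f0 add0r => /Ug; exact.
have [g0|g0] := eqVneq g 0; first by rewrite g0 addr0; exact: Uf.
rewrite -lerBlDr; apply: le_trans (ord_min P f0 g0 fg0).
by rewrite le_min !lerBlDr Uf ?Ug.
Qed.

Lemma sheaf_ON D U f : sheaf_O D U f -> sheaf_O D U (- f).
Proof. by move=> Uf; rewrite /sheaf_O /= oppr_eq0 => f0 P UP; rewrite ordN Uf. Qed.

Lemma sheaf_OB D U f g : sheaf_O D U f -> sheaf_O D U g -> sheaf_O D U (f - g).
Proof. by move=> Uf /sheaf_ON; exact: sheaf_OD. Qed.

Lemma sheaf_OM D E U f g :
  sheaf_O D U f -> sheaf_O E U g -> sheaf_O (D + E) U (f * g).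
Proof.
move=> Uf Ug; rewrite /sheaf_O /= mulf_eq0 negb_or => /andP[f0 g0] P UP.
by rewrite ordM // mcoeffD addrACA addr_ge0 // ?Uf ?Ug.
Qed.

Lemma sheaf_OS D U V f : (V `<=` U)%classic -> sheaf_O D U f -> sheaf_O D V f.
Proof. by move=> VU Uf f0 P /VU; exact: Uf. Qed.

End Divisors.

Arguments divisor_class {A} D.

(* ------------------------------------------------------------------------ *)
(** * The Cox ring of X = Spec A *)

Lemma mulrBM (R : comNzRingType) (a b c d : R) :
  a * b - c * d = (b - d) * (a - c) + (d * (a - c) + c * (b - d)).
Proof. by rewrite addrA -mulrDl subrK !mulrBr mulrC [b * c]mulrC subrKA. Qed.

Lemma fctMDE (T : pointedType) (R : comNzRingType) (f g h : T -> R) x :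
  (f * g + h) x = f x * g x + h x.
Proof. by []. Qed.

Section CoxRing.
Context (A : idomainType).
Local Open Scope classical_set_scope.
Local Open Scope ring_scope.
Local Notation F := {fraction A}.
Local Notation WDiv := (weil_divisor A).
Local Notation GR := (group_ring WDiv F).

Definition zspan (gens : seq WDiv) : set WDiv :=
  [set D | exists a : 'I_(size gens) -> int, D = \sum_(i < size gens) gens`_i *~ a i].

Lemma zspan0 gens : zspan gens 0.
Proof. by exists (fun=> 0); rewrite big1. Qed.

Lemma zspanB gens D E : zspan gens D -> zspan gens E -> zspan gens (D - E).
Proof.
move=> [a ->] [b ->]; exists (fun i => a i - b i).
by rewrite -sumrB; apply: eq_bigr => i _; rewrite mulrzBr.
Qed.

Lemma zspanN gens D : zspan gens D -> zspan gens (- D).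
Proof. by move=> KD; rewrite -sub0r; apply: zspanB => //; exact: zspan0. Qed.

Lemma zspanD gens D E : zspan gens D -> zspan gens E -> zspan gens (D + E).
Proof. by move=> KD /zspanN KE; rewrite -[E]opprK; exact: zspanB. Qed.

(* The choices entering the construction: the finitely generated group
   [cox_K] of Weil divisors mapping onto Cl(X), and the character [cox_chi] on
   the kernel [cox_K0] of this map, a section of div.  The values of [cox_chi]
   outside of that kernel are irrelevant. *)
Record cox_datum := CoxDatum {
  cox_gens : seq WDiv;
  cox_chi : WDiv -> F;
  cox_K := zspan cox_gens;
  cox_K0 : set WDiv := cox_K `&` [set E | divisor_class E = 0];
  cox_onto : forall c : class_group A, exists2 D, cox_K D & divisor_class D = c;
  cox_chiD : forall E E', cox_K0 E -> cox_K0 E' ->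
    cox_chi (E + E') = cox_chi E * cox_chi E';
  cox_chi_div : forall E, cox_K0 E -> is_div (cox_chi E) E
}.

Context (cd : cox_datum).
Local Notation K := (cox_K cd).
Local Notation K0 := (cox_K0 cd).
Local Notation chi := (cox_chi cd).

(* The sections over U of the direct sum of the O(D), D in K, as elements of
   the group ring F[Div(X)]. *)
Definition graded_section (U : set (spec A)) : set GR :=
  [set s | forall D, gr_coeff D s != 0 -> K D /\ sheaf_O D U (gr_coeff D s)].

Definition cox_relation (E : WDiv) : GR := 1 - gr_single (- E) (chi E).

Definition relation_ideal (U : set (spec A)) : set GR :=
  [set t | exists2 l : seq (GR * WDiv),
      {in l, forall c, graded_section U c.1 /\ K0 c.2}
    & t = \sum_(c <- l) c.1 * cox_relation c.2].

(* Its stalk at x; the stalk of [graded_section] at x is likewise a subring of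
   the group ring, the restriction maps being inclusions. *)
Definition relation_ideal_stalk (x : spec A) : set GR :=
  [set t | exists U, [/\ zariski_open U, U x & relation_ideal U t]].

(* The global sections of the quotient of [graded_section] by the ideal sheaf
   generated by the relations: families of germs, here given by
   representatives [s x] of elements of the quotient of the two stalks at x,
   which are locally induced by a section [t] of [graded_section].  Two
   families define the same global section if they differ by an element of
   [null_section]. *)
Definition global_section : {pred spec A -> GR} := fun s =>
  `[< forall x, exists U, [/\ zariski_open U, U x
    & exists2 t, graded_section U t
               & forall y, U y -> relation_ideal_stalk y (s y - t)] >].

Lemma graded_sectionS U V s :
  V `<=` U -> graded_section U s -> graded_section V s.
Proof. by move=> VU Us D /Us[KD sD]; split=> //; exact: sheaf_OS sD. Qed.

Lemma graded_section0 U : graded_section U 0.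
Proof. by move=> D; rewrite raddf0 eqxx. Qed.

Lemma graded_section_single U D a : K D -> sheaf_O D U a ->
  graded_section U (gr_single D a).
Proof.
move=> KD Oa E; rewrite gr_coeff_single.
by case: (D =P E) => [<-|_]; rewrite ?eqxx.
Qed.

Lemma graded_section1 U : graded_section U 1.
Proof.
rewrite -gr_single1; apply: graded_section_single; first exact: zspan0.
by move=> _ P _; rewrite ord1 mcoeff0.
Qed.

Lemma graded_section_coeff U s D : graded_section U s ->
  sheaf_O D U (gr_coeff D s).
Proof.
by move=> Us; have [->|/Us[]//] := eqVneq (gr_coeff D s) 0; exact: sheaf_O0.
Qed.

Lemma graded_sectionB U s t :
  graded_section U s -> graded_section U t -> graded_section U (s - t).
Proof.
move=> Us Ut D; rewrite gr_coeffB => nz.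
split; last by apply: sheaf_OB; exact: graded_section_coeff.
have [s0|/Us[]//] := eqVneq (gr_coeff D s) 0.
have [t0|/Ut[]//] := eqVneq (gr_coeff D t) 0.
by rewrite s0 t0 subrr eqxx in nz.
Qed.

Lemma graded_sectionN U s : graded_section U s -> graded_section U (- s).
Proof.
by move=> Us; rewrite -sub0r; apply: graded_sectionB Us; exact: graded_section0.
Qed.

Lemma graded_sectionD U s t :
  graded_section U s -> graded_section U t -> graded_section U (s + t).
Proof.
move=> Us /graded_sectionN Ut; have := graded_sectionB Us Ut.
by rewrite opprK.
Qed.

Lemma graded_sectionM U s t :
  graded_section U s -> graded_section U t -> graded_section U (s * t).
Proof.
move=> Us Ut D.
have : gr_coeff D (s * t) != 0 -> K D.
  apply: (@gr_coeffM_ind _ _ (fun a => a != 0 -> K D)) => [|a b Ka Kb|k l <-].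
  - by rewrite eqxx.
  - have [->|/Ka//] := eqVneq a 0; first by rewrite add0r; exact: Kb.
  have [->|/Us[Kk _]] := eqVneq (gr_coeff k s) 0; first by rewrite mul0r eqxx.
  have [->|/Ut[Kl _] _] := eqVneq (gr_coeff l t) 0; first by rewrite mulr0 eqxx.
  exact: zspanD.
move=> KD /KD {}KD; split=> //; apply: gr_coeffM_ind.
- exact: sheaf_O0.
- exact: sheaf_OD.
- by move=> k l <-; apply: sheaf_OM; exact: graded_section_coeff.
Qed.

Lemma relation_ideal0 U : relation_ideal U 0.
Proof. by exists [::] => //; rewrite big_nil. Qed.

Lemma relation_idealD U s t :
  relation_ideal U s -> relation_ideal U t -> relation_ideal U (s + t).
Proof.
move=> [l Ul ->] [l' Ul' ->]; exists (l ++ l'); last by rewrite big_cat.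
by move=> c; rewrite mem_cat => /orP[/Ul|/Ul'].
Qed.

Lemma relation_idealM U s t :
  graded_section U s -> relation_ideal U t -> relation_ideal U (s * t).
Proof.
move=> Us [l Ul ->]; exists [seq (s * c.1, c.2) | c <- l].
  move=> _ /mapP[c /Ul[Uc KE] ->]; split; [exact: graded_sectionM|exact: KE].
by rewrite big_map mulr_sumr; apply: eq_bigr => c _; rewrite mulrA.
Qed.

Lemma relation_idealS U V t :
  V `<=` U -> relation_ideal U t -> relation_ideal V t.
Proof.
move=> VU [l Ul ->]; exists l => // c /Ul[Uc KE].
by split; [exact: graded_sectionS Uc | exact: KE].
Qed.

Lemma relation_ideal_stalk0 x : relation_ideal_stalk x 0.
Proof.
by exists setT; split=> //; [exact: zariski_openT | exact: relation_ideal0].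
Qed.

Lemma relation_ideal_stalkD x s t : relation_ideal_stalk x s ->
  relation_ideal_stalk x t -> relation_ideal_stalk x (s + t).
Proof.
move=> [U [oU Ux Us]] [V [oV Vx Vt]]; exists (U `&` V); split=> //.
  exact: zariski_openI.
by apply: relation_idealD; [apply: relation_idealS Us|apply: relation_idealS Vt];
  move=> y [].
Qed.

Lemma relation_ideal_stalkM U x s t : zariski_open U -> U x ->
  graded_section U s -> relation_ideal_stalk x t ->
  relation_ideal_stalk x (s * t).
Proof.
move=> oU Ux Us [V [oV Vx Vt]]; exists (U `&` V); split=> //.
  exact: zariski_openI.
apply: relation_idealM; last by apply: relation_idealS Vt => y [].
by apply: graded_sectionS Us => y [].
Qed.

Lemma relation_ideal_stalkN x t :
  relation_ideal_stalk x t -> relation_ideal_stalk x (- t).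
Proof.
move=> xt; rewrite -mulN1r; apply: (relation_ideal_stalkM (zariski_openT A)) => //.
by apply: graded_sectionN; exact: graded_section1.
Qed.

(* The stalk of [graded_section] at x contains the stalk of the ideal. *)
Lemma relation_ideal_stalk_section x t : relation_ideal_stalk x t ->
  exists U, [/\ zariski_open U, U x & graded_section U t].
Proof.
move=> [U [oU Ux [l Ul ->]]]; exists U; split; [exact: oU | exact: Ux |].
rewrite big_seq; elim/big_ind: _ => [|s s' Us Us'|c /Ul[Uc KE]].
- exact: graded_section0.
- exact: graded_sectionD.
apply: graded_sectionM; first exact: Uc.
apply: graded_sectionB; first exact: graded_section1.
apply: graded_section_single; first exact: zspanN KE.1.
have [_ divE] := cox_chi_div KE.
by move=> _ P _; rewrite mcoeffN -divE subrr.
Qed.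

Lemma global_section_subring_closed : subring_closed global_section.
Proof.
split.
- apply/asboolP => x; exists setT; split=> //; first exact: zariski_openT.
  exists 1; first exact: graded_section1.
  by move=> y _; rewrite subrr; exact: relation_ideal_stalk0.
- move=> s t /asboolP gs /asboolP gt; apply/asboolP => x.
  have [U [oU Ux [s' Us' ss']]] := gs x; have [V [oV Vx [t' Vt' tt']]] := gt x.
  exists (U `&` V); split=> //; first exact: zariski_openI.
  exists (s' - t').
    by apply: graded_sectionB;
      [apply: graded_sectionS Us'|apply: graded_sectionS Vt'] => y [].
  move=> y [Uy Vy].
  have -> : (s - t) y - (s' - t') = (s y - s') - (t y - t').
    by rewrite opprD addrACA -opprD.
  apply: relation_ideal_stalkD; first exact: ss'.
  by apply: relation_ideal_stalkN; exact: tt'.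
- move=> s t /asboolP gs /asboolP gt; apply/asboolP => x.
  have [U [oU Ux [s' Us' ss']]] := gs x; have [V [oV Vx [t' Vt' tt']]] := gt x.
  exists (U `&` V); split=> //; first exact: zariski_openI.
  exists (s' * t').
    by apply: graded_sectionM;
      [apply: graded_sectionS Us'|apply: graded_sectionS Vt'] => y [].
  move=> y [Uy Vy].
  rewrite -[(s * t) y]/(s y * t y) mulrBM.
  have [W [oW Wy Wt]] := relation_ideal_stalk_section (tt' y Vy).
  apply: relation_ideal_stalkD.
    by apply: (relation_ideal_stalkM oW) => //; exact: ss'.
  apply: relation_ideal_stalkD.
    by apply: (relation_ideal_stalkM oV) => //; exact: ss'.
  by apply: (relation_ideal_stalkM oU) => //; exact: tt'.
Qed.

HB.instance Definition _ := GRing.isSubringClosed.Build (spec A -> GR)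
  global_section global_section_subring_closed.

Definition global_sections := {s : spec A -> GR | s \in global_section}.
HB.instance Definition _ := SubChoice.on global_sections.
HB.instance Definition _ :=
  [SubChoice_isSubComNzRing of global_sections by <:].

Definition null_section : {pred global_sections} :=
  fun s => `[< forall x, relation_ideal_stalk x (val s x) >].

Lemma cox_K0B D E : K0 D -> K0 E -> K0 (D - E).
Proof.
move=> [KD cD] [KE cE]; split; first exact: zspanB.
by rewrite /= divisor_classB cD cE subrr.
Qed.

Lemma cox_K00 : K0 0.
Proof. by split; [exact: zspan0 | rewrite /= raddf0]. Qed.

Lemma null_section_idealr_closed : idealr_closed null_section.
Proof.
split.
- by apply/asboolP => x; exact: relation_ideal_stalk0.
- apply/negP => /asboolP /(_ (spec_generic A)) [U [_ _ [l Ul]]].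
  move/(congr1 (gr_form K0 chi)); rewrite gr_form_sum big_seq big1; last first.
    by move=> c /Ul[_ KE]; apply: gr_form_relation KE => D E;
      [exact: cox_K0B | exact: cox_chiD].
  move=> form1; have [] := cox_chi_div cox_K00.
  by rewrite -(gr_form1 chi cox_K00) form1 eqxx.
move=> s t u /asboolP nt /asboolP nu; apply/asboolP => x.
have -> : val (s * t + u) = val s * val t + val u by rewrite rmorphD rmorphM.
rewrite fctMDE.
have /asboolP /(_ x) [U [oU Ux [s' Us' ss']]] := valP s.
apply: relation_ideal_stalkD => //.
have [W [oW Wx Ws]] := relation_ideal_stalk_section (ss' x Ux).
rewrite -[val s x](subrK s') mulrDl; apply: relation_ideal_stalkD.
  exact: (relation_ideal_stalkM oW).
exact: (relation_ideal_stalkM oU).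
Qed.

HB.instance Definition _ := isIdealr.Build global_sections null_section
  null_section_idealr_closed.

Definition cox_ring := {ideal_quot null_section}.
HB.instance Definition _ := GRing.ComNzRing.on cox_ring.

Definition cox_class (s : global_sections) : cox_ring :=
  \pi_({ideal_quot null_section}) s.

Lemma cox_class_is_zmod_morphism : zmod_morphism cox_class.
Proof. exact: raddfB. Qed.

Lemma cox_class_is_monoid_morphism : monoid_morphism cox_class.
Proof. by split; [exact: rmorph1 | exact: rmorphM]. Qed.

HB.instance Definition _ := GRing.isZmodMorphism.Build global_sections cox_ring
  cox_class cox_class_is_zmod_morphism.
HB.instance Definition _ := GRing.isMonoidMorphism.Build global_sections cox_ring
  cox_class cox_class_is_monoid_morphism.

(* The component of degree c in Cl(X). *)
Definition cox_component (c : class_group A) : set cox_ring :=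
  [set t | exists s : global_sections, t = cox_class s /\
     forall x D, gr_coeff D (val s x) != 0 -> divisor_class D = c].

Lemma cox_scalar_subproof (a : A) :
  (fun=> gr_single 0 (tofrac a)) \in global_section.
Proof.
apply/asboolP => x; exists setT; split=> //; first exact: zariski_openT.
exists (gr_single 0 (tofrac a)).
  apply: graded_section_single => [|nz P _]; first exact: zspan0.
  by rewrite mcoeff0 addr0 ord_ge0 // -tofrac_eq0.
by move=> y _; rewrite subrr; exact: relation_ideal_stalk0.
Qed.

(* The structure morphism from A to the Cox ring. *)
Definition cox_scalar (a : A) : cox_ring :=
  cox_class (exist (fun s => s \in global_section) _ (cox_scalar_subproof a)).

End CoxRing.

(* ------------------------------------------------------------------------ *)
(** * Characters of a finite group *)

Section Characters.
Context (H : finGroupType) (C : fieldType).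

(* The values of a character are automatically nonzero. *)
Definition is_char (chi : {ffun H -> C}) : bool :=
  (chi 1%g == 1) && [forall x, forall y, chi (x * y)%g == chi x * chi y].

Definition char_group := {chi : {ffun H -> C} | is_char chi}.
HB.instance Definition _ := Choice.on char_group.

Implicit Types chi psi : char_group.

Lemma char_group1 chi : val chi 1%g = 1.
Proof. by have /andP[/eqP] := valP chi. Qed.

Lemma char_groupM chi x y : val chi (x * y)%g = val chi x * val chi y.
Proof. by have /andP[_ /forallP /(_ x) /forallP /(_ y) /eqP] := valP chi. Qed.

Lemma char_group_neq0 chi x : val chi x != 0.
Proof.
have : val chi x * val chi x^-1%g != 0.
  by rewrite -char_groupM mulgV char_group1 oner_eq0.
by rewrite mulf_eq0 negb_or => /andP[].
Qed.

Lemma is_charP (chi : {ffun H -> C}) : chi 1%g = 1 ->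
  (forall x y, chi (x * y)%g = chi x * chi y) -> is_char chi.
Proof.
move=> chi1 chiM; rewrite /is_char chi1 eqxx /=.
by apply/forallP => x; apply/forallP => y; rewrite chiM.
Qed.

Lemma char_zero_subproof : is_char [ffun=> 1].
Proof. by apply: is_charP => [|x y]; rewrite !ffunE ?mulr1. Qed.

Lemma char_add_subproof chi psi : is_char [ffun x => val chi x * val psi x].
Proof.
by apply: is_charP => [|x y]; rewrite !ffunE ?char_group1 ?mulr1 // !char_groupM mulrACA.
Qed.

Lemma char_opp_subproof chi : is_char [ffun x => (val chi x)^-1].
Proof.
by apply: is_charP => [|x y]; rewrite !ffunE ?char_group1 ?invr1 // char_groupM invfM.
Qed.

(* The group law is pointwise multiplication; it is written additively, as
   befits a group of degrees. *)
Definition char_zero : char_group := Sub _ char_zero_subproof.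
Definition char_add chi psi : char_group := Sub _ (char_add_subproof chi psi).
Definition char_opp chi : char_group := Sub _ (char_opp_subproof chi).

Lemma char_addA : associative char_add.
Proof. by move=> a b c; apply/val_inj/ffunP => x; rewrite !SubK !ffunE mulrA. Qed.

Lemma char_addC : commutative char_add.
Proof. by move=> a b; apply/val_inj/ffunP => x; rewrite !SubK !ffunE mulrC. Qed.

Lemma char_add0 : left_id char_zero char_add.
Proof. by move=> a; apply/val_inj/ffunP => x; rewrite !SubK !ffunE mul1r. Qed.

Lemma char_addN : left_inverse char_zero char_opp char_add.
Proof.
by move=> a; apply/val_inj/ffunP => x; rewrite !SubK !ffunE mulVf ?char_group_neq0.
Qed.

HB.instance Definition _ :=
  GRing.isZmodule.Build char_group char_addA char_addC char_add0 char_addN.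

End Characters.

(* ------------------------------------------------------------------------ *)
(** * Invariant rings of finite matrix groups

   A finite subgroup of GL(n,C) is given as the image of a faithful
   representation [rG] of a finite group gT; a matrix acts on C^n by
   multiplication of column vectors. *)

From mathcomp.multinomials Require Import mpoly.

(* monalg uses the same notation for another type. *)
Local Notation "{ 'mpoly' T [ n ] }" := (mpoly.mpoly n T) : type_scope.

Section Invariants.
Context (C : fieldType) (n : nat) (gT : finGroupType).
Context (rG : mx_representation C [set: gT] n).

(* The fixed space of A is the eigenspace of A for the eigenvalue 1; the
   transposition is due to [eigenspace] using row vectors. *)
Definition pseudo_reflection (A : 'M[C]_n) : Prop :=
  (exists2 k, (0 < k)%N & A ^+ k = 1) /\ (\rank (eigenspace A^T 1)).+1 = n.

Definition small : Prop := forall g, ~ pseudo_reflection (rG g).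

(* (g . p)(x) = p (g^-1 x) *)
Definition mx_act (g : gT) (p : {mpoly C[n]}) : {mpoly C[n]} :=
  p \mPo [tuple \sum_j rG g^-1%g i j *: 'X_j | i < n].

HB.instance Definition _ g := GRing.RMorphism.copy (mx_act g)
  (comp_mpoly [tuple \sum_j rG g^-1%g i j *: 'X_j | i < n]).

Definition invariants (H : {set gT}) : {pred {mpoly C[n]}} :=
  fun p => [forall h in H, mx_act h p == p].

Lemma invariantsP (H : {set gT}) p :
  reflect {in H, forall h, mx_act h p = p} (p \in invariants H).
Proof.
by apply: (iffP forall_inP) => Hp h hH; [apply/eqP; exact: Hp | rewrite Hp].
Qed.

Lemma mx_act1 g : mx_act g 1 = 1. Proof. exact: rmorph1. Qed.

Lemma mx_actB g p q : mx_act g (p - q) = mx_act g p - mx_act g q.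
Proof. exact: rmorphB. Qed.

Lemma mx_actM g p q : mx_act g (p * q) = mx_act g p * mx_act g q.
Proof. exact: rmorphM. Qed.

Lemma invariants_divring_closed H : divring_closed (invariants H).
Proof.
split.
- by apply/invariantsP => h _; rewrite mx_act1.
- by move=> p q /invariantsP Hp /invariantsP Hq; apply/invariantsP => h hH;
    rewrite mx_actB Hp ?Hq.
move=> p q /invariantsP Hp /invariantsP Hq; apply/invariantsP => h hH.
rewrite mx_actM Hp //; congr (_ * _).
have [Uq|nUq] := boolP (q \is a GRing.unit); last by rewrite invr_out ?Hq.
by apply: (mulrI Uq); rewrite -{1}(Hq h hH) -mx_actM divrr // mx_act1.
Qed.

HB.instance Definition _ H :=
  GRing.isDivringClosed.Build {mpoly C[n]} (invariants H)
    (invariants_divring_closed H).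

Definition invariant_ring (H : {set gT}) := {p | p \in invariants H}.
HB.instance Definition _ H := SubChoice.on (invariant_ring H).
HB.instance Definition _ H :=
  [SubChoice_isSubIntegralDomain of invariant_ring H by <:].

Lemma invariant_scalar_subproof H (c : C) : c%:MP \in invariants H.
Proof. by apply/invariantsP => h _; rewrite /mx_act comp_mpolyC. Qed.

Definition invariant_scalar H (c : C) : invariant_ring H :=
  exist (fun p => p \in invariants H) _ (invariant_scalar_subproof H c).

Definition generates_invariants (H : {set gT}) (s : nat)
    (f : s.-tuple {mpoly C[n]}) : Prop :=
  (forall i, tnth f i \in invariants H) /\
  (forall p, p \in invariants H -> exists q : {mpoly C[s]}, p = q \mPo f).

End Invariants.

Arguments small {C n gT} rG.

Notation derived_subgroup gT := [~: [set: gT], [set: gT]]%g.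
Notation abelianization gT := (coset_of (derived_subgroup gT)).

(* [g] is obtained from the system of generators [f] by the second step of the
   procedure: [g] consists of simultaneous eigenvectors, of weights [chi], in
   the spaces of homogeneous invariants of [G,G] of degrees deg(f_1), ...,
   deg(f_s), and generates.  The class of x in G/[G,G] acts on the invariants
   of [G,G] as x does. *)
Definition homogeneous_system (C : fieldType) (n : nat) (gT : finGroupType)
    (rG : mx_representation C [set: gT] n) (s : nat)
    (f g : s.-tuple {mpoly C[n]})
    (chi : 'I_s -> char_group (abelianization gT) C) : Prop :=
  [/\ generates_invariants rG (derived_subgroup gT) g,
      (forall i, exists j, tnth g i \is (msize (tnth f j)).-1.-homog),
      (forall i, tnth g i != 0)
    & forall i x, mx_act rG x (tnth g i) =
        val (chi i) (coset (derived_subgroup gT) x) *: tnth g i].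

(* ------------------------------------------------------------------------ *)
(** * The algebra C[T_1, ..., T_s] / I_0 *)

Section Elimination.
Context (C : fieldType) (n s : nat) (g : s.-tuple {mpoly C[n]}).

(* In C[S_1, ..., S_n, T_1, ..., T_s]: *)
Definition S_vars : n.-tuple {mpoly C[n + s]} := [tuple 'X_(lshift s i) | i < n].
Definition T_vars : s.-tuple {mpoly C[n + s]} := [tuple 'X_(rshift n j) | j < s].

Definition graph_ideal (p : {mpoly C[n + s]}) : Prop :=
  exists c : 'I_s -> {mpoly C[n + s]},
    p = \sum_j c j * (tnth T_vars j - (tnth g j \mPo S_vars)).

Definition elimination_ideal : {pred {mpoly C[s]}} :=
  fun q => `[< graph_ideal (q \mPo T_vars) >].

Lemma elimination_ideal_idealr_closed : idealr_closed elimination_ideal.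
Proof.
split.
- apply/asboolP; exists (fun=> 0).
  by rewrite rmorph0 big1 // => j _; rewrite mul0r.
- apply/negP => /asboolP [c]; rewrite rmorph1.
  pose v (i : 'I_(n + s)) := match fintype.split i with
              | inl _ => 0 | inr j => (tnth g j).@[fun=> 0] end.
  move/(congr1 (meval v)); rewrite rmorph1 rmorph_sum big1 => [/eqP|j _].
    by rewrite oner_eq0.
  have vT : (tnth T_vars j).@[v] = (tnth g j).@[fun=> 0].
    by rewrite tnth_mktuple mevalXU /v (unsplitK (inr j)).
  have vS : (tnth g j \mPo S_vars).@[v] = (tnth g j).@[fun=> 0].
    rewrite comp_mpoly_meval; apply: meval_eq => i.
    by rewrite tnth_mktuple mevalXU /v (unsplitK (inl i)).
  by rewrite /= mevalM mevalB vT vS subrr mulr0.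
move=> p q r /asboolP [c cq] /asboolP [d dr]; apply/asboolP.
exists (fun j => (p \mPo T_vars) * c j + d j).
rewrite comp_mpolyD rmorphM /= cq dr mulr_sumr -big_split /=.
by apply: eq_bigr => j _; rewrite mulrDl mulrA.
Qed.

HB.instance Definition _ := isIdealr.Build {mpoly C[s]} elimination_ideal
  elimination_ideal_idealr_closed.

Local Notation presented_algebra := {ideal_quot elimination_ideal}.

Definition presented_class (p : {mpoly C[s]}) : presented_algebra :=
  \pi_presented_algebra p.

Section Grading.
Context (W : zmodType) (w : 'I_s -> W).

(* The homomorphism Z^s -> W sending e_i to w i. *)
Definition degree_map (a : 'rV[int]_s) : W := \sum_i w i *~ a 0 i.

Definition monomial_degree (m : 'X_{1..s}) : W :=
  degree_map (\row_i Posz (m i)).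

Definition homogeneous_part (c : W) (p : {mpoly C[s]}) : {mpoly C[s]} :=
  \sum_(m <- msupp p | monomial_degree m == c) p@_m *: 'X_[m].

Definition presented_component (c : W) : set presented_algebra :=
  [set t | exists p, t = presented_class p /\
     forall m, m \in msupp p -> monomial_degree m = c]%classic.

(* The condition for the degrees of the variables to define a grading of the
   quotient. *)
Definition homogeneous_ideal : Prop :=
  forall c p, p \in elimination_ideal ->
    homogeneous_part c p \in elimination_ideal.

End Grading.
End Elimination.

Notation presented_algebra g := {ideal_quot (elimination_ideal g)}.

(* Main.v *)
(* Write S = C[S_1, ..., S_n], D = [G,G] and X = X(G/D).  The prime divisors of
   C^n/G are the G-orbits of primes h of the factorial ring S.  As G contains no
   pseudo-reflection, no h divides all the elements s - g s for a g <> 1.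
   Dedekind's independence of characters, modulo h, then gives for every chi in X
   a semi-invariant of weight chi which is not divisible by h.  Hence C^n -> C^n/G
   is unramified in codimension one: the order along the divisor below h is the
   multiplicity of h.  So a divisor E has an equation nu E in Frac S, unique up to
   a constant and therefore a semi-invariant of G; sending E to its character is
   an isomorphism Cl(C^n/G) -> X, since every character occurs.

   For the choices (K, chi) made in the Cox ring, chi(E) = c(E) nu(E) with c a
   homomorphism on K^0, which extends to K since C^* is divisible.  Then
   sum_E s_E |-> sum_E s_E nu(E) c(E) has as its kernel exactly the ideal of the
   relations, and identifies the Cox ring with S^D, graded by the semi-invariants.
   On the other side T_i |-> g_i identifies C[T]/I_0 with the same graded ring.

   In step (2), a generator f_j of degree d can be replaced by one of its own
   isotypic components: a degree-d invariant is a multiple of f_j modulo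
   polynomials in the other generators. *)

Require Import Defs.
From HB Require Import structures.
From mathcomp Require Import all_boot all_order all_algebra finmap.
From mathcomp Require Import all_fingroup all_solvable mxrepresentation.
From mathcomp Require Import all_field ring_quotient.
From mathcomp Require Import boolp classical_sets.
From mathcomp Require Import reals complex.
From mathcomp.multinomials Require Import monalg mpoly.
From mathcomp Require Import zify ring.

Set Implicit Arguments.
Unset Strict Implicit.
Unset Printing Implicit Defensive.

Import Order.TTheory GRing.Theory Num.Theory.
Local Open Scope ring_scope.
Local Open Scope quotient_scope.
Local Notation "{ 'mpoly' T [ n ] }" := (mpoly.mpoly n T) : type_scope.

(** * Factorial rings *)

(** Smallness enters only through the separation property of [small_quotient], asked for every h
    that generates a prime ideal. The case h = 0 is included on purpose: there Dedekind's lemma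
    produces nonzero semi-invariants of every weight. Instead of general facts on normal rings and
    integral extensions, norms play the part of lying-over. Semi-invariants prime to h, multiplied
    by [nu E] or divided by it, are the uniformizers and denominators which show that the local ring
    at a prime divisor is a valuation ring. The Cox ring consists of sections of a quotient sheaf,
    which need not lift a priori to global sections of the direct sum. But on every open set the
    ideal of relations is the kernel of the same evaluation [ev], and every nonempty open set
    contains the generic point. So a family of germs has a single value in Frac S, whose integrality
    can be tested at one prime divisor at a time. Both the Cox ring and C[T]/I_0 are thereby
    embedded in Frac S, and are compared there. *)

Section Divisibility.
Context (R : idomainType).
Implicit Types (a b c p q u : R) (l : seq R).

Definition divides a b : Prop := exists c, b = c * a.

(** Zero is allowed: in a domain it generates a prime ideal, and Dedekind's lemma is also applied
    modulo that ideal. *)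
Definition generates_prime p : Prop :=
  p \isn't a GRing.unit /\
  forall a b, divides p (a * b) -> divides p a \/ divides p b.

Definition prime_elt p : Prop := p != 0 /\ generates_prime p.

Definition factorization a u l : Prop :=
  [/\ u \is a GRing.unit, {in l, forall p, prime_elt p}
    & a = u * \prod_(p <- l) p].

(** The factors are asked to be prime rather than irreducible, which makes the uniqueness of
    factorizations automatic. *)
Definition factorial_ring : Prop :=
  forall a, a != 0 -> exists u l, factorization a u l.

Lemma divides_refl a : divides a a. Proof. by exists 1; rewrite mul1r. Qed.
Lemma divides0 a : divides a 0. Proof. by exists 0; rewrite mul0r. Qed.

Lemma divides_mull a b c : divides a b -> divides a (c * b).
Proof. by move=> [x ->]; exists (c * x); rewrite mulrA. Qed.

Lemma divides_mulr a b c : divides a b -> divides a (b * c).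
Proof. by rewrite mulrC; exact: divides_mull. Qed.

Lemma dividesD a b c : divides a b -> divides a c -> divides a (b + c).
Proof. by move=> [x ->] [y ->]; exists (x + y); rewrite mulrDl. Qed.

Lemma dividesN a b : divides a b -> divides a (- b).
Proof. by move=> [x ->]; exists (- x); rewrite mulNr. Qed.

Lemma dividesB a b c : divides a b -> divides a c -> divides a (b - c).
Proof. by move=> ab /dividesN; exact: dividesD. Qed.

Lemma divides_sum a (I : Type) (r : seq I) (P : pred I) (f : I -> R) :
  (forall i, P i -> divides a (f i)) -> divides a (\sum_(i <- r | P i) f i).
Proof.
move=> af; elim/big_ind: _ => //; [exact: divides0 | exact: dividesD].
Qed.

Lemma divides_unit a u : u \is a GRing.unit -> divides a u -> a \is a GRing.unit.
Proof. by move=> Uu [c uE]; move: Uu; rewrite uE unitrM => /andP[]. Qed.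

Lemma prime_nunit p : prime_elt p -> p \isn't a GRing.unit.
Proof. by move=> [_ []]. Qed.

Lemma prime_not_divides_unit p u :
  generates_prime p -> u \is a GRing.unit -> ~ divides p u.
Proof. by move=> [/negP np _] Uu /(divides_unit Uu). Qed.

Lemma prime_divides_unitM p u a : generates_prime p -> u \is a GRing.unit ->
  divides p (u * a) -> divides p a.
Proof.
by move=> pp Uu; case/pp.2 => // /(prime_not_divides_unit pp Uu).
Qed.

Lemma prime_divides_prod p (I : eqType) (r : seq I) (f : I -> R) :
  generates_prime p -> divides p (\prod_(i <- r) f i) ->
  exists2 i, i \in r & divides p (f i).
Proof.
move=> pp; elim: r => [|i r IH].
  by rewrite big_nil => /(prime_not_divides_unit pp (unitr1 _)).
rewrite big_cons => /pp.2 [pi|/IH[j jr pj]]; first by exists i; rewrite ?mem_head.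
by exists j; rewrite // inE jr orbT.
Qed.

Lemma divides_prod (I : eqType) (r : seq I) (f : I -> R) i :
  i \in r -> divides (f i) (\prod_(i <- r) f i).
Proof.
elim: r => //= j r IH; rewrite inE big_cons => /predU1P[->|/IH ir].
  by apply: divides_mulr; exact: divides_refl.
exact: divides_mull.
Qed.

Lemma prime_divides_prime p q : prime_elt q -> p \isn't a GRing.unit ->
  divides p q -> exists2 u, u \is a GRing.unit & q = u * p.
Proof.
move=> [q0 [_ qP]] nUp [u qE].
have: divides q (u * p) by rewrite -qE; exact: divides_refl.
case/qP => [[x ux]|[x px]].
  case/negP: nUp; have : q * 1 = q * (x * p) by rewrite mulr1 mulrCA mulrA -ux.
  by move/(mulfI q0) => xp; apply: (@divides_unit _ 1); [exact: unitr1 | exists x].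
exists u => //; apply: (@divides_unit _ 1); first exact: unitr1.
exists x; apply: (mulfI q0).
by rewrite mulr1 mulrC -mulrA [u * q]mulrC mulrA -px mulrC.
Qed.

End Divisibility.

(** * Polynomials over a factorial ring *)

Section PolyFactorial.
Context (R : idomainType) (Rfact : factorial_ring R).
Implicit Types (p c a : R) (f g h : {poly R}).

Lemma dividesCP p f : divides p%:P f <-> forall i, divides p f`_i.
Proof.
split=> [[g ->] i|pf]; first by rewrite coefMC; exists g`_i.
exists (\poly_(i < size f) sval (cid (pf i))).
apply/polyP => i; rewrite coefMC coef_poly.
case: ltnP => [_|si]; first by case: (cid (pf i)).
by rewrite mul0r nth_default.
Qed.

Lemma divides_lead_coef p f : divides p%:P f -> divides p (lead_coef f).
Proof. by move/dividesCP; exact. Qed.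

(** Induction on the total size. If p divides f g, it divides the product of the leading
    coefficients, hence one of them, and the corresponding leading term can be stripped. *)
Lemma generates_prime_polyC p : generates_prime p -> generates_prime p%:P.
Proof.
move=> pp; split.
  rewrite poly_unitE coefC eqxx size_polyC; apply/negP => /andP[_ Up].
  by case: pp => /negP.
move=> f g; have [n] := ubnP (size f + size g).
elim: n f g => // n IH f g le_n pfg.
have [->|f0] := eqVneq f 0; first by left; exact: divides0.
have [->|g0] := eqVneq g 0; first by right; exact: divides0.
pose red (h : {poly R}) := h - (lead_coef h)%:P * 'X^((size h).-1).
have size_red (h : {poly R}) : h != 0 -> (size (red h) < size h)%N.
  move=> h0; rewrite /red -[size h]prednK ?size_poly_gt0 //= ltnS.
  apply/leq_sizeP => i; rewrite leq_eqVlt coefB coefCM coefXn => /predU1P[<-|lt_i].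
    by rewrite eqxx mulr1 subrr.
  rewrite [i == _]gtn_eqF // mulr0 subr0 nth_default //.
  by rewrite -[size h]prednK ?size_poly_gt0.
have redP (h : {poly R}) : divides p (lead_coef h) ->
    divides p%:P ((lead_coef h)%:P * 'X^((size h).-1)).
  by move=> [c ->]; apply: divides_mulr; exists c%:P; rewrite rmorphM.
have: divides p (lead_coef f * lead_coef g).
  by rewrite -lead_coefM; exact: divides_lead_coef.
case/pp.2 => /redP pl.
- have /IH[|p_f|pg]: (size (red f) + size g < n)%N.
  + by rewrite -ltnS; apply: leq_trans le_n; rewrite ltnS ltn_add2r size_red.
  + by rewrite mulrBl; apply: dividesB pfg _; exact: divides_mulr.
  + by left; rewrite -[f](subrK ((lead_coef f)%:P * 'X^((size f).-1))); exact: dividesD.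
  + by right.
- have /IH[|p_f|pg]: (size f + size (red g) < n)%N.
  + by rewrite -ltnS; apply: leq_trans le_n; rewrite ltnS ltn_add2l size_red.
  + by rewrite mulrBr; apply: dividesB pfg _; exact: divides_mull.
  + by left.
  + by right; rewrite -[g](subrK ((lead_coef g)%:P * 'X^((size g).-1))); exact: dividesD.
Qed.

Lemma prime_polyC p : prime_elt p -> prime_elt p%:P.
Proof.
by move=> [p0 pp]; split; [rewrite polyC_eq0 | exact: generates_prime_polyC].
Qed.

(* Gauss's lemma. *)
Lemma gauss_clear c f g h : c != 0 -> c%:P * f = g * h ->
  exists g' h', [/\ f = g' * h', size g' = size g & size h' = size h].
Proof.
move=> /Rfact[u [l [Uu lP ->]]] {c}.
elim: l lP f g h => [|p l IH] lP f g h.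
  rewrite big_nil mulr1 => fE; exists ((u^-1)%:P * g), h; split=> //.
    by rewrite -mulrA -fE mulrA -rmorphM mulVr // mul1r.
  by rewrite mul_polyC size_scale // invr_neq0 //; apply: contraTneq Uu => ->; rewrite unitr0.
rewrite big_cons mulrCA rmorphM -mulrA => fE.
have pp : prime_elt p by apply: lP; rewrite mem_head.
have {}IH := IH (fun q ql => lP q (mem_behead (ql : q \in behead (p :: l)))).
have p0 : p%:P != 0 :> {poly R} by rewrite polyC_eq0; case: pp.
have: divides p%:P (g * h) by rewrite -fE; apply: divides_mulr; exact: divides_refl.
case/(generates_prime_polyC pp.2).2 => -[x xE].
- have [|g' [h' [-> sg sh]]] := IH f x h.
    by apply: (mulfI p0); rewrite fE xE mulrA [p%:P * x]mulrC.
  exists g', h'; split=> //; rewrite sg xE mulrC mul_polyC size_scale //.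
  by case: pp.
- have [|g' [h' [-> sg sh]]] := IH f g x.
    by apply: (mulfI p0); rewrite fE xE mulrA mulrC.
  exists g', h'; split=> //; rewrite sh xE mulrC mul_polyC size_scale //.
  by case: pp.
Qed.

Definition primitive_poly f : Prop := forall p, prime_elt p -> ~ divides p%:P f.

(** The prime factors of c are cancelled one at a time: each divides the cofactor of f, since it
    does not divide f. *)
Lemma primitive_divides c f g : primitive_poly f -> c != 0 ->
  divides f (c%:P * g) -> divides f g.
Proof.
move=> fprim /Rfact[u [l [Uu lP ->]]] {c}.
elim: l lP => [|p l IH] lP.
  rewrite big_nil mulr1 => -[x xE]; exists ((u^-1)%:P * x).
  by rewrite -mulrA -xE mulrA -rmorphM mulVr // mul1r.
have pp : prime_elt p by apply: lP; rewrite mem_head.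
rewrite big_cons mulrCA rmorphM -mulrA => -[x xE].
have: divides p%:P (x * f) by rewrite -xE; apply: divides_mulr; exact: divides_refl.
case/(generates_prime_polyC pp.2).2 => [[y yE]|/(fprim p pp)//].
apply: IH => [q ql|]; first by apply: lP; rewrite inE ql orbT.
have p0 : p%:P != 0 :> {poly R} by rewrite polyC_eq0; case: pp.
by exists y; apply: (mulfI p0); rewrite xE yE mulrA [p%:P * y]mulrC.
Qed.

(** [dvdp] is divisibility up to a nonzero constant, that is, over the fraction field; primitivity
    of f allows this constant to be removed. *)
Lemma dvdp_divides f g : primitive_poly f -> Pdiv.Idomain.dvdp f g -> divides f g.
Proof.
move=> fprim /Pdiv.Idomain.dvdpP [[c q] /= c0 E].
by apply: (@primitive_divides c) => //; exists q; rewrite mul_polyC.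
Qed.

(** The extraction of constants stops because every prime taken out of f uses up one prime factor of
    its leading coefficient. *)
Lemma primitive_part f : f != 0 -> exists (l : seq R) g,
  [/\ {in l, forall p, prime_elt p}, f = (\prod_(p <- l) p)%:P * g & primitive_poly g].
Proof.
move=> f0; have /Rfact[u [l [Uu lP]]] : lead_coef f != 0 by rewrite lead_coef_eq0.
have [n] := ubnP (size l); elim: n u l f f0 Uu lP => // n IH u l f f0 Uu lP le_n lcE.
have [fprim|/existsNP[p /not_implyP[pp /contrapT [g gE]]]] := pselect (primitive_poly f).
  by exists [::], f; rewrite big_nil mul1r.
have p0 : p != 0 by case: pp.
have g0 : g != 0 by apply: contra_neq f0 => g0; rewrite gE g0 mul0r.
have lcg : lead_coef f = lead_coef g * p by rewrite gE lead_coefM lead_coefC.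
have : divides p (u * \prod_(q <- l) q) by rewrite -lcE lcg; exists (lead_coef g).
case/(prime_divides_unitM pp.2 Uu)/(prime_divides_prod pp.2) => q ql /= pq.
have [v Uv qE] := prime_divides_prime (lP q ql) (prime_nunit pp) pq.
have [|||||l' [g' [lP' g'E g'P]]] := IH (u * v) (rem q l) g.
- exact: g0.
- by rewrite unitrM Uu.
- by move=> r /mem_rem; exact: lP.
- by rewrite size_rem // prednK //; rewrite lt0n; apply: contraTneq ql => /size0nil ->.
- apply: (mulIf p0); rewrite -lcg lcE (perm_big _ (perm_to_rem ql)) big_cons /= qE.
  by rewrite -!mulrA; congr (_ * (_ * _)); rewrite mulrC.
exists (p :: l'), g'; split=> //.
- by move=> r; rewrite inE => /predU1P[->|/lP'].
- by rewrite gE g'E mulrC big_cons rmorphM -mulrA.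
Qed.

(* A gcd of f with a in Frac(R)[X] is trivial or associated to f. *)
Lemma primitive_irreducible_prime f : primitive_poly f -> (1 < size f)%N ->
  (forall g h, f = g * h -> (size g <= 1)%N \/ (size h <= 1)%N) -> prime_elt f.
Proof.
move=> fprim szf irr; have f0 : f != 0 by rewrite -size_poly_gt0 ltnW.
split=> //; split.
  by rewrite poly_unitE (gtn_eqF szf).
move=> a b fab; pose d := Pdiv.Idomain.gcdp f a.
have := Pdiv.Idomain.dvdp_gcdl f a; case/Pdiv.Idomain.dvdpP => -[c q] /= c0.
rewrite -/d -mul_polyC => cfE.
have [q' [d' [fE szq szd]]] := gauss_clear c0 cfE.
case: (irr _ _ fE); rewrite ?szq ?szd => sz1.
- left; apply: dvdp_divides => //.
  apply: (Pdiv.Idomain.dvdp_trans _ (Pdiv.Idomain.dvdp_gcdr f a)).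
  have df := Pdiv.Idomain.dvdp_gcdl f a; rewrite -/d in df *.
  have /andP[] // : Pdiv.Idomain.eqp d f.
  rewrite -(Pdiv.Idomain.dvdp_size_eqp df) -(size_scale f c0) -mul_polyC cfE.
  have : q * d != 0 by rewrite -cfE mulf_neq0 // polyC_eq0.
  rewrite mulf_eq0 negb_or => /andP[q0 d0].
  by rewrite (size1_polyC sz1) mul_polyC size_scale // -polyC_eq0 -(size1_polyC sz1).
- right; apply: dvdp_divides => //.
  have cop : Pdiv.Idomain.coprimep f a.
    rewrite /Pdiv.Idomain.coprimep eqn_leq sz1 size_poly_gt0.
    by rewrite Pdiv.Idomain.gcdp_eq0 negb_and f0.
  rewrite -(Pdiv.Idomain.Gauss_dvdpr _ cop).
  by case: fab => x ->; rewrite Pdiv.Idomain.dvdp_mull.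
Qed.

(** Induction on the size. Once its constant factors are split off, f is a unit, or prime by
    [primitive_irreducible_prime], or a product of two polynomials of smaller positive degree. *)
Lemma factorial_poly : factorial_ring {poly R}.
Proof.
move=> f; have [n] := ubnP (size f); elim: n f => // n IH f le_n f0.
have [l [g [lP fE gprim]]] := primitive_part f0.
have g0 : g != 0 by apply: contra_neq f0 => g0; rewrite fE g0 mulr0.
suff [u [l' [Uu l'P gE]]] : exists u l', factorization g u l'.
  exists u, ([seq p%:P | p <- l] ++ l'); split=> //.
    by move=> p; rewrite mem_cat => /orP[/mapP[q /lP qP ->]|/l'P//]; exact: prime_polyC.
  by rewrite fE gE big_cat big_map /= rmorph_prod mulrCA.
have szg : size f = size g.
  rewrite fE mul_polyC size_scale // prodf_seq_neq0.
  by apply/allP => p /lP[].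
have [le1|gt1] := leqP (size g) 1.
  have gC := size1_polyC le1.
  have g00 : g`_0 != 0 by rewrite -polyC_eq0 -gC.
  have /Rfact[u [[|p l'] [Uu l'P g0E]]] := g00.
    exists g, [::]; split=> //; rewrite ?big_nil ?mulr1 //.
    by rewrite gC poly_unitE size_polyC g00 coefC eqxx g0E big_nil mulr1.
  have [] := gprim p (l'P p (mem_head _ _)); rewrite gC g0E big_cons.
  by exists (u * \prod_(j <- l') j)%:P; rewrite -rmorphM mulrCA mulrC.
have [irr|/existsNP[a /existsNP[b /not_implyP[gE /not_orP[/negP a1 /negP b1]]]]] :=
    pselect (forall a b : {poly R}, g = a * b -> (size a <= 1)%N \/ (size b <= 1)%N).
  exists 1, [:: g]; split=> [|p|]; rewrite ?unitr1 ?big_seq1 ?mul1r //.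
  by rewrite inE => /eqP->; exact: primitive_irreducible_prime.
move: a1 b1; rewrite -!ltnNge => a1 b1.
have a0 : a != 0 by rewrite -size_poly_gt0 ltnW.
have b0 : b != 0 by rewrite -size_poly_gt0 ltnW.
have szgE : size g = (size a + size b).-1 by rewrite gE size_mul.
have [||u [k [Uu kP aE]]] := IH a; rewrite //.
  by apply: leq_trans (_ : size g <= _)%N; [rewrite szgE; lia | rewrite -szg].
have [||v [m [Uv mP bE]]] := IH b; rewrite //.
  by apply: leq_trans (_ : size g <= _)%N; [rewrite szgE; lia | rewrite -szg].
exists (u * v), (k ++ m); split; first by rewrite unitrM Uu.
  by move=> p; rewrite mem_cat => /orP[/kP|/mP].
by rewrite gE aE bE big_cat mulrACA.
Qed.

End PolyFactorial.

Lemma factorial_transfer (R S : idomainType) (f : {rmorphism R -> S}) :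
  bijective f -> factorial_ring S -> factorial_ring R.
Proof.
move=> [g fK gK] Sfact a a0.
have g1 : g 1 = 1 by apply: (can_inj fK); rewrite gK rmorph1.
have gM x y : g (x * y) = g x * g y by apply: (can_inj fK); rewrite rmorphM !gK.
have gU x : x \is a GRing.unit -> g x \is a GRing.unit.
  move=> Ux; apply: (@divides_unit _ _ 1); first exact: unitr1.
  by exists (g x^-1); rewrite -gM mulVr // g1.
have fdiv x y : divides (f x) (f y) <-> divides x y.
  split=> [[c cE]|[c ->]]; last by exists (f c); rewrite rmorphM.
  by exists (g c); apply: (can_inj fK); rewrite cE rmorphM gK.
have : f a != 0 by rewrite -(rmorph0 f) (inj_eq (can_inj fK)).
move=> /Sfact[u [l [Uu lP faE]]].
exists (g u), [seq g p | p <- l]; split; first exact: gU.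
  move=> _ /mapP[p /lP[p0 [pU pP]] ->]; split; [|split].
  - by apply: contra_neq p0 => gp0; rewrite -[p]gK gp0 rmorph0.
  - apply: contra pU => /(rmorph_unit f); by rewrite gK.
  - by move=> x y; rewrite -!fdiv rmorphM gK; exact: pP.
apply: (can_inj fK); rewrite faE rmorphM gK; congr (_ * _).
by rewrite rmorph_prod big_map; apply: eq_bigr => p _; rewrite gK.
Qed.

(** * Polynomial rings in several variables are factorial *)

Section MPolyFactorial.
Context (C : fieldType).

Definition mnm_restrict n (m : 'X_{1..n.+1}) : 'X_{1..n} :=
  [multinom m (widen_ord (leqnSn _) i) | i < n].

Lemma muniX n (m : 'X_{1..n.+1}) :
  muni 'X_[C, m] = 'X_[mnm_restrict m] *: 'X^(m ord_max).
Proof. by rewrite muniE msuppX big_seq1 mcoeffX eqxx scale1r. Qed.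

Lemma mnm_restrict_inj n (m k : 'X_{1..n.+1}) :
  mnm_restrict m = mnm_restrict k -> m ord_max = k ord_max -> m = k.
Proof.
move=> /mnmP rE mE; apply/mnmP => i; case: (unliftP ord_max i) => [j ->|->] //.
have := rE j; rewrite !mnmE; suff -> : widen_ord (leqnSn _) j = lift ord_max j by [].
by apply: val_inj; rewrite /= /bump leqNgt ltn_ord.
Qed.

Lemma muni_coef n (p : {mpoly C[n.+1]}) m :
  (muni p)`_(m ord_max)@_(mnm_restrict m) = p@_m.
Proof.
elim/mpolyind: p => [|c k p _ _ IH]; first by rewrite muni0 coef0 !mcoeff0.
rewrite muniD muniZ muniX coefD !mcoeffD {}IH; congr (_ + _).
rewrite scalerA coefZ coefXn -mulrA mcoeffCM mcoeffZ mcoeffX; congr (_ * _).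
have [<-|nkm] := eqVneq k m; first by rewrite eqxx mulr1 mcoeffX eqxx.
case: eqP => [mE|_]; last by rewrite mulr0 mcoeff0.
rewrite mulr1 mcoeffX; case: eqP => [/mnm_restrict_inj km|_] //.
by rewrite km ?eqxx in nkm.
Qed.

Lemma muni_widen n (p : {mpoly C[n]}) : muni (mwiden p) = p%:P.
Proof.
elim/mpolyind: p => [|c k p _ _ IH]; first by rewrite mwiden0 muni0.
rewrite mwidenD muniD {}IH mwidenZ muniZ mwidenX muniX rmorphD; congr (_ + _).
rewrite mnmwiden_ordmax expr0 -mul_mpolyC rmorphM -mul_polyC; congr (_ * _).
rewrite alg_polyC; congr 'X_[_]%:P; apply/mnmP => i.
by rewrite mnmE mnmwiden_widen.
Qed.

(** [mmulti] is a right inverse by computation. It is also a left inverse because [muni] is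
    injective: by [muni_coef] every coefficient of p is visible in its image. *)
Lemma muni_bij n : bijective (@muni n C).
Proof.
have mK : cancel (@mmulti n C) (@muni n C).
  move=> p; rewrite /mmulti raddf_sum -[RHS]coefK poly_def.
  apply: eq_bigr => i _ /=; rewrite muniM muni_widen -mul_polyC; congr (_ * _).
  rewrite rmorphXn /=; congr (_ ^+ _); rewrite muniX mnm1E eqxx expr1.
  rewrite (_ : mnm_restrict _ = 0%MM) ?mpolyX0 ?scale1r //.
  by apply/mnmP => j; rewrite mnm0E mnmE mnm1E; case: eqP => // /(congr1 val) /= /eqP;
    rewrite gtn_eqF.
exists (@mmulti n C) => //; apply: (@inj_can_sym _ _ _ _ mK).
move=> p q pq; apply/mpolyP => m; rewrite -!muni_coef pq //.
Qed.

Lemma factorial_mpoly n : factorial_ring {mpoly C[n]}.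
Proof.
elim: n => [|n IH]; last exact: factorial_transfer (muni_bij n) (factorial_poly IH).
move=> p p0; exists p, [::]; split=> //; last by rewrite big_nil mulr1.
have pE : p = (p@_0)%:MP.
  apply/mpolyP => m; rewrite mcoeffC; suff -> : m = 0%MM by rewrite eqxx mulr1.
  by apply/mnmP => -[].
apply: (@divides_unit _ _ 1); first exact: unitr1.
exists (p@_0)^-1%:MP; rewrite {2}pE -mpolyCM mulVf ?mpolyC1 //.
by apply: contra_neq p0 => p00; rewrite pE p00 mpolyC0.
Qed.

End MPolyFactorial.
Local Notation "x %:F" := (tofrac x).

(** * Fractions and valuations *)

Section Fractions.
Context (R : idomainType).
Implicit Types (l : {fraction R}).

Definition numer l : R := \n_(generic_quotient.repr l).
Definition denom l : R := \d_(generic_quotient.repr l).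

Lemma denom_neq0 l : denom l != 0. Proof. exact: denom_ratioP. Qed.

Lemma fracE l : l = (numer l)%:F / (denom l)%:F.
Proof.
have d0 := denom_neq0 l; apply: (mulIf (_ : (denom l)%:F != 0)).
  by rewrite tofrac_eq0.
rewrite divfK ?tofrac_eq0 // /numer /denom; rewrite -{1}[l]reprK.
set x := generic_quotient.repr l; unlock tofrac; rewrite -[LHS]FracField.pi_mul.
apply/eqmodP => /=; rewrite FracField.equivfE /FracField.mulf.
rewrite !numden_Ratio ?mulf_neq0 ?oner_eq0 ?denom_ratioP //.
by rewrite !mulr1 mulrC.
Qed.

Lemma fracP l : exists a b, b != 0 /\ l = a%:F / b%:F.
Proof. by exists (numer l), (denom l); split; [exact: denom_neq0 | exact: fracE]. Qed.

Lemma eq_frac (a b c d : R) : b != 0 -> d != 0 ->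
  (a%:F / b%:F == c%:F / d%:F) = (a * d == c * b).
Proof.
by move=> b0 d0; rewrite eqr_div ?tofrac_eq0 // -!rmorphM tofrac_eq.
Qed.

End Fractions.

Section FracMap.
Context (R S : idomainType) (f : {rmorphism R -> S}) (f_inj : injective f).

(** Injectivity keeps the images of denominators nonzero. It is an argument so that the ring
    morphism structure can be attached to [frac_map f_inj]. *)
Definition frac_map (_ : injective f) (l : {fraction R}) : {fraction S} :=
  (f (numer l))%:F / (f (denom l))%:F.
Local Notation fm := (frac_map f_inj).

Let f_neq0 a : a != 0 -> f a != 0.
Proof. by rewrite -(rmorph0 f) (inj_eq f_inj). Qed.

Lemma frac_mapE a b : b != 0 -> fm (a%:F / b%:F) = (f a)%:F / (f b)%:F.
Proof.
move=> b0; apply/eqP; rewrite /frac_map eq_frac ?f_neq0 ?denom_neq0 //.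
rewrite -!rmorphM (inj_eq f_inj) -eq_frac ?denom_neq0 //.
by rewrite -fracE.
Qed.

Lemma frac_map_tofrac a : fm a%:F = (f a)%:F.
Proof. by rewrite -[a%:F]divr1 -tofrac1 frac_mapE ?oner_eq0 // !rmorph1 divr1. Qed.

Lemma frac_map_is_zmod_morphism : zmod_morphism fm.
Proof.
move=> x y; have [a [b [b0 ->]]] := fracP x; have [c [d [d0 ->]]] := fracP y.
have tf0 (T : idomainType) (z : T) : z != 0 -> z%:F != 0 by rewrite tofrac_eq0.
rewrite !frac_mapE // -!mulNr !addf_div ?tf0 ?f_neq0 // -!rmorphN -!rmorphM -!rmorphD.
by rewrite frac_mapE ?mulf_neq0 // !(rmorphM, rmorphN, rmorphD).
Qed.

Lemma frac_map_is_monoid_morphism : monoid_morphism fm.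
Proof.
split; first by rewrite -tofrac1 frac_map_tofrac rmorph1 tofrac1.
move=> x y; have [a [b [b0 ->]]] := fracP x; have [c [d [d0 ->]]] := fracP y.
rewrite !frac_mapE // !mulf_div -!rmorphM frac_mapE ?mulf_neq0 //.
Qed.

HB.instance Definition _ := GRing.isZmodMorphism.Build _ _ fm frac_map_is_zmod_morphism.
HB.instance Definition _ := GRing.isMonoidMorphism.Build _ _ fm frac_map_is_monoid_morphism.

End FracMap.

(** * Multiplicities and valuations at primes *)

Section Valuation.
Context (S : idomainType) (Sfact : factorial_ring S).
Implicit Types (a b p q u : S) (l : {fraction S}).

(** For p nonzero and a = 0 no k qualifies, since b would have to be 0, which p divides; the default
    0 is then returned. *)
Definition mult p a : nat :=
  xget 0%N [set k | exists2 b, a = p ^+ k * b & ~ divides p b]%classic.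

Lemma mult_unique p a k b : p != 0 -> a = p ^+ k * b -> ~ divides p b -> mult p a = k.
Proof.
move=> p0 aE pb; rewrite /mult; case: xgetP => [j _ [c aE' pc]|/(_ k)[]]; last by exists b.
case: (ltngtP j k) => // jk.
- case: pc; exists (p ^+ (k - j).-1 * b); apply: (mulfI (expf_neq0 j p0)).
  rewrite -aE' aE -(subnKC (ltnW jk)) addKn exprD -!mulrA; congr (_ * _).
  by rewrite [b * p]mulrC mulrA -exprSr prednK ?subn_gt0.
- case: pb; exists (p ^+ (j - k).-1 * c); apply: (mulfI (expf_neq0 k p0)).
  rewrite -aE aE' -(subnKC (ltnW jk)) addKn exprD -!mulrA; congr (_ * _).
  by rewrite [c * p]mulrC mulrA -exprSr prednK ?subn_gt0.
Qed.

(** The multiplicity is counted off a factorization of a: each prime factor is either an associate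
    of p or not divisible by p. *)
Lemma multP p a : prime_elt p -> a != 0 ->
  exists2 b, a = p ^+ mult p a * b & ~ divides p b.
Proof.
move=> pp a0; have [u [l [Uu lP aE]]] := Sfact a0.
suff [k [b [aE' pb]]] : exists k b, a = p ^+ k * b /\ ~ divides p b.
  by rewrite (mult_unique pp.1 aE' pb); exists b.
elim: l lP a {a0} aE => [|q l IH] lP a aE.
  exists 0%N, a; split; first by rewrite mul1r.
  by rewrite aE big_nil mulr1; exact: (prime_not_divides_unit pp.2).
have [|k [b [bE pb]]] := IH _ (u * \prod_(j <- l) j) erefl.
  by move=> r rl; apply: lP; rewrite inE rl orbT.
have qP : prime_elt q by apply: lP; rewrite mem_head.
move: aE; rewrite big_cons mulrCA bE.
have [pq|npq] := pselect (divides p q).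
  have [e Ue ->] := prime_divides_prime qP (prime_nunit pp) pq => ->.
  exists k.+1, (e * b); split; first by rewrite exprS; ring.
  by move/(prime_divides_unitM pp.2 Ue).
move=> ->; exists k, (q * b); split; first by ring.
by case/pp.2.2.
Qed.

Lemma multM p a b : prime_elt p -> a != 0 -> b != 0 ->
  mult p (a * b) = (mult p a + mult p b)%N.
Proof.
move=> pp a0 b0; have [c aE pc] := multP pp a0; have [d bE pd] := multP pp b0.
apply: (@mult_unique _ _ _ (c * d) pp.1); last by case/pp.2.2.
by rewrite {1}aE {1}bE exprD mulrACA.
Qed.

Lemma mult_ge p a k : prime_elt p -> a != 0 -> (k <= mult p a)%N <-> divides (p ^+ k) a.
Proof.
move=> pp a0; have [c aE pc] := multP pp a0; split=> [le_k|[d dE]].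
  exists (p ^+ (mult p a - k) * c).
  by rewrite {1}aE -{1}(subnK le_k) exprD -!mulrA [c * _]mulrC.
have d0 : d != 0 by apply: contra_neq a0 => d0; rewrite dE d0 mul0r.
have [b bE pb] := multP pp d0.
rewrite (@mult_unique p a (mult p d + k) b) ?leq_addl //; first by case: pp.
by rewrite dE {1}bE exprD mulrAC.
Qed.

Lemma mult_gt0 p a : prime_elt p -> a != 0 -> (0 < mult p a)%N <-> divides p a.
Proof. by move=> pp a0; rewrite mult_ge // expr1. Qed.

Lemma mult_eq0 p a : prime_elt p -> a != 0 -> ~ divides p a -> mult p a = 0%N.
Proof. by move=> pp a0 pa; apply/eqP; rewrite -leqn0 leqNgt; apply/negP => /(mult_gt0 pp a0). Qed.

Lemma mult_unit p u : prime_elt p -> u \is a GRing.unit -> mult p u = 0%N.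
Proof.
move=> pp Uu; apply: mult_eq0 => //; first by apply: contraTneq Uu => ->; rewrite unitr0.
exact: (prime_not_divides_unit pp.2).
Qed.

Lemma mult_self p : prime_elt p -> mult p p = 1%N.
Proof.
move=> pp; apply: (@mult_unique p p 1 1); [exact: pp.1|by rewrite mulr1 expr1|].
exact: (prime_not_divides_unit pp.2 (unitr1 _)).
Qed.

Lemma mult_prime p q : prime_elt p -> prime_elt q -> ~ divides p q -> mult p q = 0%N.
Proof. by move=> pp qp; apply: mult_eq0 => //; case: qp. Qed.

Lemma mult_min p a b : prime_elt p -> a != 0 -> b != 0 -> a + b != 0 ->
  (minn (mult p a) (mult p b) <= mult p (a + b))%N.
Proof.
move=> pp a0 b0 ab0; apply/mult_ge => //.
by apply: dividesD; apply/mult_ge; rewrite // ?geq_minl ?geq_minr.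
Qed.

Lemma mult_mulr_unit p u a : prime_elt p -> u \is a GRing.unit -> a != 0 ->
  mult (u * p) a = mult p a.
Proof.
move=> pp Uu a0; have [c aE pc] := multP pp a0.
apply: (@mult_unique _ _ _ ((u^-1) ^+ (mult p a) * c)).
- by rewrite mulf_neq0 ?pp.1 //; apply: contraTneq Uu => ->; rewrite unitr0.
- by rewrite {1}aE exprMn mulrACA -exprMn divrr // expr1n mul1r.
move=> [d dE]; case: pc; exists (u ^+ (mult p a) * (d * u)).
rewrite -!mulrA -dE mulrA -exprMn divrr // expr1n mul1r //.
Qed.

Lemma mult_rmorph (f : {rmorphism S -> S}) p a : bijective f ->
  prime_elt p -> a != 0 -> mult (f p) (f a) = mult p a.
Proof.
move=> [g fK gK] pp a0; have [c aE pc] := multP pp a0.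
apply: (@mult_unique _ _ _ (f c)).
- by rewrite -(rmorph0 f) (inj_eq (can_inj fK)); case: pp.
- by rewrite {1}aE rmorphM rmorphXn.
by move=> [d dE]; case: pc; exists (g d); apply: (can_inj fK); rewrite rmorphM gK.
Qed.

Lemma prime_rmorph (f : {rmorphism S -> S}) p : bijective f ->
  prime_elt p -> prime_elt (f p).
Proof.
move=> [g fK gK] [p0 [pU pP]]; split; [|split].
- by rewrite -(rmorph0 f) (inj_eq (can_inj fK)).
- apply: contra pU => Ufp; apply: (@divides_unit _ _ 1 (unitr1 _)).
  by exists (g (f p)^-1); apply: (can_inj fK); rewrite rmorphM gK mulVr // rmorph1.
have fdiv x y : divides (f x) (f y) <-> divides x y.
  split=> [[c cE]|[c ->]]; last by exists (f c); rewrite rmorphM.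
  by exists (g c); apply: (can_inj fK); rewrite cE rmorphM gK.
by move=> a b; rewrite -[a]gK -[b]gK -rmorphM !fdiv; exact: pP.
Qed.

(* The value at 0 is irrelevant. *)
Definition valuation p l : int := (mult p (numer l))%:Z - (mult p (denom l))%:Z.
Local Notation v := valuation.

Lemma valuationE p a b : prime_elt p -> a != 0 -> b != 0 ->
  v p (a%:F / b%:F) = (mult p a)%:Z - (mult p b)%:Z.
Proof.
move=> pp a0 b0; rewrite /valuation; set l := _ / _.
have l0 : l != 0 by rewrite mulf_neq0 ?invr_eq0 ?tofrac_eq0.
have d0 := denom_neq0 l.
have n0 : numer l != 0 by apply: contra_neq l0 => n0; rewrite [l]fracE n0 rmorph0 mul0r.
have /eqP := fracE l; rewrite {1}/l eq_frac // => /eqP/(congr1 (mult p)).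
by rewrite !multM // => E; lia.
Qed.

Lemma valuation_tofrac p a : prime_elt p -> a != 0 -> v p a%:F = mult p a.
Proof.
move=> pp a0; rewrite -[a%:F]divr1 -tofrac1 valuationE ?oner_eq0 //.
by rewrite [mult p 1]mult_unit ?unitr1 // subr0.
Qed.

Lemma fracP0 l : l != 0 -> exists a b, [/\ a != 0, b != 0 & l = a%:F / b%:F].
Proof.
move=> l0; have [a [b [b0 lE]]] := fracP l; exists a, b; split=> //.
by apply: contra_neq l0 => a0; rewrite lE a0 rmorph0 mul0r.
Qed.

Lemma valuationM p l m : prime_elt p -> l != 0 -> m != 0 -> v p (l * m) = v p l + v p m.
Proof.
move=> pp /fracP0[a [b [a0 b0 ->]]] /fracP0[c [d [c0 d0 ->]]].
rewrite mulf_div -!rmorphM !valuationE ?mulf_neq0 // !multM //; lia.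
Qed.

Lemma valuation1 p : prime_elt p -> v p 1 = 0.
Proof. by move=> pp; rewrite -tofrac1 valuation_tofrac ?oner_eq0 // mult_unit ?unitr1. Qed.

Lemma valuationV p l : prime_elt p -> l != 0 -> v p l^-1 = - v p l.
Proof.
move=> pp l0; apply: (addrI (v p l)).
by rewrite -valuationM ?invr_eq0 // divff // valuation1 // subrr.
Qed.

Lemma valuationXz p l (k : int) : prime_elt p -> l != 0 -> v p (l ^ k) = v p l * k.
Proof.
have vX m (n : nat) : prime_elt p -> m != 0 -> v p (m ^+ n) = v p m * n%:Z.
  move=> pp m0; elim: n => [|n IH]; first by rewrite expr0 valuation1 // mulr0.
  by rewrite exprS valuationM ?expf_neq0 // IH intS mulrDr mulr1.
move=> pp l0; case: k => n; first exact: vX.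
by rewrite NegzE -exprnN valuationV ?expf_neq0 // vX // mulrN.
Qed.

Lemma valuation_prod p (I : eqType) (r : seq I) (f : I -> {fraction S}) :
  prime_elt p -> {in r, forall i, f i != 0} ->
  v p (\prod_(i <- r) f i) = \sum_(i <- r) v p (f i).
Proof.
move=> pp; elim: r => [|i r IH] f0; first by rewrite !big_nil valuation1.
have f0' : {in r, forall i, f i != 0} by move=> j jr; apply: f0; rewrite inE jr orbT.
rewrite !big_cons valuationM ?IH //; first by rewrite f0 ?mem_head.
by rewrite prodf_seq_neq0; apply/allP => j /f0'.
Qed.

Lemma valuation_min p l m : prime_elt p -> l != 0 -> m != 0 -> l + m != 0 ->
  Order.min (v p l) (v p m) <= v p (l + m).
Proof.
move=> pp /fracP0[a [b [a0 b0 ->]]] /fracP0[c [d [c0 d0 ->]]].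
rewrite addf_div ?tofrac_eq0 // -!rmorphM -rmorphD => s0.
have ab0 : a * d + c * b != 0.
  by apply: contra_neq s0 => ->; rewrite rmorph0 mul0r.
rewrite !valuationE ?mulf_neq0 //.
have := mult_min pp (mulf_neq0 a0 d0) (mulf_neq0 c0 b0) ab0.
have le_minz (x y z : int) : x <= z \/ y <= z -> Order.min x y <= z.
  by case=> H; rewrite ge_min H ?orbT.
rewrite !multM // geq_min; move: (mult p (a * d + c * b)) => s /orP H.
apply: le_minz; case: H => H; [left|right]; lia.
Qed.

(** The prime factors q of the denominator are cancelled one at a time: a nonnegative valuation at q
    forces q to divide the numerator too. *)
Lemma valuation_ge0_integral l : l != 0 -> (forall p, prime_elt p -> 0 <= v p l) ->
  exists2 a, a != 0 & l = a%:F.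
Proof.
move=> /fracP0[a [b [a0 b0 ->]]].
have /Sfact[u [r [Uu rP bE]]] := b0.
elim: r rP a a0 b b0 bE => [|q r IH] rP a a0 b b0 bE vl.
  have Ub : b \is a GRing.unit by rewrite bE big_nil mulr1.
  exists (a / b); first by rewrite mulf_neq0 ?invr_neq0.
  by rewrite -{1}[a](divrK Ub) rmorphM mulfK // tofrac_eq0.
have qP : prime_elt q by apply: rP; rewrite mem_head.
move: bE; rewrite big_cons mulrCA => bE.
have c0 : u * \prod_(j <- r) j != 0.
  by apply: contra_neq b0 => c0; rewrite bE c0 mulr0.
have /(mult_gt0 qP a0)[d aE] : (0 < mult q a)%N.
  have := vl q qP; rewrite valuationE // bE multM ?mult_self //; last by case: qP.
  by lia.
have d0 : d != 0 by apply: contra_neq a0 => d0; rewrite aE d0 mul0r.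
have q0 := qP.1.
have abE : a%:F / b%:F = d%:F / (u * \prod_(j <- r) j)%:F.
  by apply/eqP; rewrite eq_frac // bE aE; apply/eqP; ring.
have [||m m0 mE] := IH _ d d0 _ c0 erefl; last by exists m; rewrite // abE mE.
- by move=> j jr; apply: rP; rewrite inE jr orbT.
- by move=> p pp; rewrite -abE; exact: vl.
Qed.

Lemma valuation_eq0_unit l : l != 0 -> (forall p, prime_elt p -> v p l = 0) ->
  exists2 u, u \is a GRing.unit & l = u%:F.
Proof.
move=> l0 vl; have [|a a0 aE] := valuation_ge0_integral l0.
  by move=> p /vl->.
exists a => //; have [||b b0 bE] := @valuation_ge0_integral l^-1.
- by rewrite invr_eq0.
- by move=> p pp; rewrite valuationV // vl // oppr0.
apply: (@divides_unit _ _ 1 (unitr1 _)); exists b; apply/eqP.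
by rewrite -tofrac_eq tofracM -aE -bE tofrac1 mulVf.
Qed.

Lemma valuation_mul_unit p u l : prime_elt p -> u \is a GRing.unit -> l != 0 ->
  v (u * p) l = v p l.
Proof.
move=> pp Uu /fracP0[a [b [a0 b0 ->]]].
have upP : prime_elt (u * p).
  have u0 : u != 0 by apply: contraTneq Uu => ->; rewrite unitr0.
  split; first by rewrite mulf_neq0 ?pp.1.
  split; first by rewrite unitrM negb_and; case: (pp) => _ [-> _]; rewrite orbT.
  have upd x : divides (u * p) x <-> divides p x.
    split=> -[c ->]; first by exists (c * u); rewrite mulrA.
    by exists (c / u); rewrite mulrA divrK.
  by move=> x y; rewrite !upd; exact: pp.2.2.
by rewrite !valuationE // !mult_mulr_unit.
Qed.

Lemma valuation_rmorph (f : {rmorphism S -> S}) (f_inj : injective f) p l :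
  bijective f -> prime_elt p -> l != 0 -> v (f p) (frac_map f_inj l) = v p l.
Proof.
move=> fb pp /fracP0[a [b [a0 b0 ->]]].
have f0 x : x != 0 -> f x != 0 by move=> x0; rewrite -(rmorph0 f) (inj_eq f_inj).
have pfp := prime_rmorph fb pp.
by rewrite frac_mapE // !valuationE ?f0 // !mult_rmorph.
Qed.

End Valuation.

(** * Characters and semi-invariants *)

Section AbelianizationCharacters.
Context (C : fieldType) (gT : finGroupType).
Local Notation D := (derived_subgroup gT).
Local Notation X := (char_group (abelianization gT) C).
Implicit Types (chi psi : X) (x y : gT).

Definition char_val chi x : C := val chi (coset D x).

Lemma derived_norm x : x \in ('N(D))%g.
Proof.
have := normal_norm (der_normal 1 [set: gT]); rewrite derg1 => /fintype.subsetP; apply.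
by rewrite finset.in_setT.
Qed.

Lemma char_val1 chi : char_val chi 1%g = 1.
Proof. by rewrite /char_val coset_id ?group1 // char_group1. Qed.

Lemma char_valM chi x y : char_val chi (x * y)%g = char_val chi x * char_val chi y.
Proof. by rewrite /char_val morphM ?derived_norm // char_groupM. Qed.

Lemma char_val_neq0 chi x : char_val chi x != 0.
Proof. exact: char_group_neq0. Qed.

Lemma char_val0 x : char_val 0 x = 1.
Proof. by rewrite /char_val ffunE. Qed.

Lemma char_valD chi psi x : char_val (chi + psi) x = char_val chi x * char_val psi x.
Proof. by rewrite /char_val ffunE. Qed.

Lemma char_valN chi x : char_val (- chi) x = (char_val chi x)^-1.
Proof. by rewrite /char_val ffunE. Qed.

Lemma char_val_derived chi x : x \in D -> char_val chi x = 1.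
Proof. by move=> xD; rewrite /char_val coset_id ?char_group1. Qed.

Lemma char_val_inj chi psi : char_val chi =1 char_val psi -> chi = psi.
Proof.
move=> eq_chi; apply/val_inj/ffunP => u.
by have [x _ ->] := @cosetP _ _ u; exact: eq_chi.
Qed.

Section Lift.
Context (lam : gT -> C) (lam1 : lam 1%g = 1).
Context (lamM : forall x y, lam (x * y)%g = lam x * lam y).

Let lam_derived x : x \in D -> lam x = 1.
Proof.
have lamV y : lam y^-1%g * lam y = 1 by rewrite -lamM mulVg.
pose K := [set y | lam y == 1]%SET.
have gK : group_set K.
  apply/group_setP; split=> [|y z]; rewrite !inE ?lam1 // lamM.
  by move=> /eqP-> /eqP->; rewrite mulr1.
have : (D \subset Group gK)%g.
  rewrite gen_subG; apply/fintype.subsetP => _ /imset2P[y z _ _ ->].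
  rewrite inE /commg /conjg !lamM; apply/eqP.
  transitivity ((lam y^-1%g * lam y) * (lam z^-1%g * lam z)); first by ring.
  by rewrite !lamV mulr1.
by move=> /fintype.subsetP /(_ x) KD /KD; rewrite inE => /eqP.
Qed.

Let lam_repr x : lam (repr (coset D x)) = lam x.
Proof.
have := mem_repr_coset (coset D x); rewrite val_coset ?derived_norm //.
by case/rcosetP => d dD ->; rewrite lamM lam_derived ?mul1r.
Qed.

Lemma char_lift_subproof : is_char [ffun u : abelianization gT => lam (repr u)].
Proof.
apply: is_charP => [|u v]; rewrite !ffunE.
  by rewrite -(coset_id (group1 [group of D])) lam_repr.
have [x _ ->] := @cosetP _ _ u; have [y _ ->] := @cosetP _ _ v.
by rewrite -morphM ?derived_norm // !lam_repr lamM.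
Qed.

Definition char_lift : X := Sub _ char_lift_subproof.

Lemma char_val_lift x : char_val char_lift x = lam x.
Proof. by rewrite /char_val /char_lift SubK ffunE lam_repr. Qed.

End Lift.
End AbelianizationCharacters.

(** The values of a character are roots of ['X^#|H| - 1], so all characters are found among the
    functions from H to a finite set. *)
Lemma char_group_finite (C : closedFieldType) (H : finGroupType) :
  exists s : seq (char_group H C), uniq s /\ forall chi, chi \in s.
Proof.
have [rs rsE] := closed_field_poly_normal ('X^#|H| - 1 : {poly C}).
have rsP (chi : char_group H C) x : val chi x \in rs.
  have X1 : val chi x ^+ #|H| = 1.
    have <- : val chi (x ^+ #|H|)%g = val chi x ^+ #|H|.
      elim: #|H| => [|k IH]; first by rewrite expg0 char_group1.
      by rewrite expgS char_groupM IH exprS.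
    by rewrite -cardsT expg_cardG ?finset.in_setT // char_group1.
  rewrite -root_prod_XsubC; have : root ('X^#|H| - 1 : {poly C}) (val chi x).
    by rewrite rootE !hornerE X1 subrr.
  rewrite rsE rootZ // lead_coef_eq0 -size_poly_eq0 size_XnsubC //.
  by apply/card_gt0P; exists 1%g.
pose s := pmap (fun f : {ffun H -> seq_sub rs} =>
    insub [ffun x => val (f x)] : option (char_group H C)) (enum {: {ffun H -> seq_sub rs}}).
exists (undup s); split=> [|chi]; first exact: undup_uniq.
rewrite mem_undup mem_pmap; apply/mapP.
exists [ffun x => SeqSub (rsP chi x)]; first by rewrite mem_enum.
rewrite (_ : [ffun _ => _] = val chi) ?valK //.
by apply/ffunP => x; rewrite !ffunE.
Qed.

(** Scalars come as a ring morphism and not as an algebra structure, so that the same notion serves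
    S and its fraction field. *)
Record scalar_action (C : fieldType) (gT : finGroupType) (T : comNzRingType) :=
  ScalarAction {
    scal : {rmorphism C -> T};
    act : gT -> {rmorphism T -> T};
    act1 : forall t, act 1%g t = t;
    actM : forall x y t, act (x * y)%g t = act x (act y t);
    act_scal : forall x c, act x (scal c) = scal c }.

Definition sum_of (T : nmodType) (P : T -> Prop) (t : T) : Prop :=
  exists2 ts : seq T, {in ts, forall u, P u} & t = \sum_(u <- ts) u.

Section SumOf.
Context (T : nmodType).
Implicit Types (P Q : T -> Prop) (t u : T).

Lemma sum_of1 P t : P t -> sum_of P t.
Proof. by exists [:: t]; [move=> u; rewrite inE => /eqP->|rewrite big_seq1]. Qed.

Lemma sum_of0 P : sum_of P 0.
Proof. by exists [::]; rewrite ?big_nil. Qed.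

Lemma sum_ofD P t u : sum_of P t -> sum_of P u -> sum_of P (t + u).
Proof.
move=> [ts tsP ->] [us usP ->]; exists (ts ++ us); last by rewrite big_cat.
by move=> w; rewrite mem_cat => /orP[/tsP|/usP].
Qed.

Lemma sum_of_sum P (I : eqType) (r : seq I) (f : I -> T) :
  {in r, forall i, sum_of P (f i)} -> sum_of P (\sum_(i <- r) f i).
Proof.
elim: r => [|i r IH] fP; first by rewrite big_nil; exact: sum_of0.
rewrite big_cons; apply: sum_ofD; first exact: fP (mem_head _ _).
by apply: IH => j jr; apply: fP; rewrite inE jr orbT.
Qed.

Lemma sum_of_trans P Q t : (forall u, P u -> sum_of Q u) -> sum_of P t -> sum_of Q t.
Proof. by move=> PQ [ts tsP ->]; apply: sum_of_sum => u /tsP /PQ. Qed.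

End SumOf.

(** * Isotypic decomposition of the invariants of the derived subgroup *)

Section SemiInvariants.
Context (C : numClosedFieldType) (gT : finGroupType) (T : comNzRingType).
Context (a : scalar_action C gT T).
Local Notation D := (derived_subgroup gT).
Local Notation X := (char_group (abelianization gT) C).
Implicit Types (chi psi : X) (x y : gT) (t u : T) (c : C).

Definition semi_invariant chi t : Prop :=
  forall x, act a x t = scal a (char_val chi x) * t.

Lemma scalK c t : c != 0 -> scal a c^-1 * (scal a c * t) = t.
Proof. by move=> c0; rewrite mulrA -rmorphM mulVf // rmorph1 mul1r. Qed.

Lemma semi_invariantM chi psi t u : semi_invariant chi t -> semi_invariant psi u ->
  semi_invariant (chi + psi) (t * u).
Proof. by move=> ct pu x; rewrite rmorphM ct pu char_valD rmorphM mulrACA. Qed.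

Lemma semi_invariant0 chi : semi_invariant chi 0.
Proof. by move=> x; rewrite rmorph0 mulr0. Qed.

Lemma semi_invariantD chi t u : semi_invariant chi t -> semi_invariant chi u ->
  semi_invariant chi (t + u).
Proof. by move=> ct cu x; rewrite rmorphD ct cu mulrDr. Qed.

Lemma semi_invariant_scal chi c t : semi_invariant chi t -> semi_invariant chi (scal a c * t).
Proof. by move=> ct x; rewrite rmorphM act_scal ct mulrCA. Qed.

Lemma semi_invariant_sum chi (I : Type) (r : seq I) (P : pred I) (f : I -> T) :
  (forall i, P i -> semi_invariant chi (f i)) ->
  semi_invariant chi (\sum_(i <- r | P i) f i).
Proof.
by move=> fP; elim/big_ind: _ => //; [exact: semi_invariant0 | exact: semi_invariantD].
Qed.

Lemma semi_invariant1 : semi_invariant 0 1.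
Proof. by move=> x; rewrite rmorph1 char_val0 rmorph1 mulr1. Qed.

Lemma semi_invariant_invariant t : semi_invariant 0 t <-> forall x, act a x t = t.
Proof.
by split=> ht x; move: (ht x); rewrite char_val0 rmorph1 mul1r.
Qed.

Lemma semi_invariant_derived chi t x : semi_invariant chi t -> x \in D -> act a x t = t.
Proof. by move=> ct xD; rewrite ct char_val_derived // rmorph1 mul1r. Qed.

Lemma char_sum0 chi : chi != 0 -> \sum_x char_val chi x = 0.
Proof.
move=> chi0; have [y chiy] : exists y, char_val chi y != 1.
  apply: contrapT => no; case/eqP: chi0; apply: char_val_inj => x.
  by rewrite char_val0; apply/eqP/negPn/negP => hx; apply: no; exists x.
have : char_val chi y * (\sum_x char_val chi x) = \sum_x char_val chi x.
  rewrite mulr_sumr [RHS](reindex_inj (mulgI y)).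
  by apply: eq_bigr => x _; rewrite char_valM.
move/eqP; rewrite -subr_eq0 -{2}[\sum_x _]mul1r -mulrBl mulf_eq0 subr_eq0 (negPf chiy).
by move/eqP.
Qed.

(** The averaging projector of character theory onto the isotypic component of weight chi. *)
Definition proj chi t : T :=
  scal a (#|gT|%:R^-1) * \sum_x scal a (char_val chi x)^-1 * act a x t.

Lemma card_neq0 : #|gT|%:R != 0 :> C.
Proof. by rewrite pnatr_eq0 -lt0n; apply/card_gt0P; exists 1%g. Qed.

Lemma semi_invariant_twisted_sum chi t :
  semi_invariant chi (\sum_x scal a (char_val chi x)^-1 * act a x t).
Proof.
move=> y; rewrite rmorph_sum mulr_sumr [RHS](reindex_inj (mulgI y)).
apply: eq_bigr => x _ /=; rewrite rmorphM act_scal -actM char_valM invfM.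
rewrite [RHS]mulrA -rmorphM; congr (scal a _ * _).
by rewrite mulrA mulfV ?char_val_neq0 // mul1r.
Qed.

Lemma semi_invariant_proj chi t : semi_invariant chi (proj chi t).
Proof. by apply: semi_invariant_scal; exact: semi_invariant_twisted_sum. Qed.

Lemma proj_is_additive chi : zmod_morphism (proj chi).
Proof.
move=> t u; rewrite /proj -mulrBr -sumrB; congr (_ * _).
by apply: eq_bigr => x _; rewrite rmorphB mulrBr.
Qed.
HB.instance Definition _ chi := GRing.isZmodMorphism.Build T T (proj chi) (proj_is_additive chi).

Lemma proj_semi_invariant chi psi t : semi_invariant psi t ->
  proj chi t = if chi == psi then t else 0.
Proof.
move=> pt; rewrite /proj; under eq_bigr => x _.
  rewrite pt mulrA -rmorphM -char_valN -char_valD; over.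
rewrite -mulr_suml -rmorph_sum; case: eqP => [->|/eqP ne].
  rewrite addrC subrr (eq_bigr (fun=> 1)); last by move=> x _; rewrite char_val0.
  by rewrite sumr_const scalK // card_neq0.
by rewrite char_sum0 ?rmorph0 ?mul0r ?mulr0 // addrC subr_eq0 eq_sym.
Qed.

(** The projector [proj psi] keeps the summands of weight psi and kills the others. *)
Lemma semi_invariant_indep (I : Type) (r : seq I) (chi : I -> X) (f : I -> T) psi :
  (forall i, semi_invariant (chi i) (f i)) -> \sum_(i <- r) f i = 0 ->
  \sum_(i <- r | chi i == psi) f i = 0.
Proof.
move=> fP /(congr1 (proj psi)); rewrite !raddf_sum raddf0 /= => E.
rewrite big_mkcond -[RHS]E.
by apply: eq_bigr => i _; rewrite (proj_semi_invariant _ (fP i)) eq_sym.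
Qed.

Section Span.
Implicit Types (lam : gT -> C) (gs : seq gT).

(** [lam] matters only on the list gs of group elements treated so far. Once gs exhausts the group,
    a nonzero t forces it to be a character. *)
Let eigen lam gs t : Prop := (forall x, x \in D -> act a x t = t) /\
  {in gs, forall x, act a x t = scal a (lam x) * t}.

Let eigenD lam gs t u : eigen lam gs t -> eigen lam gs u -> eigen lam gs (t + u).
Proof.
move=> [tD te] [uD ue]; split=> x xP; rewrite rmorphD; first by rewrite tD ?uD.
by rewrite te ?ue // mulrDr.
Qed.

Let eigen_scal lam gs c t : eigen lam gs t -> eigen lam gs (scal a c * t).
Proof.
by move=> [tD te]; split=> x xP; rewrite rmorphM act_scal; [rewrite tD|rewrite te // mulrCA].
Qed.

Let act_commute x y t : (forall z, z \in D -> act a z t = t) ->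
  act a x (act a y t) = act a y (act a x t).
Proof.
move=> tD; rewrite -!actM; have -> : (x * y = y * x * [~ x, y])%g.
  by rewrite commgC.
by rewrite actM tD // mem_commg ?finset.in_setT.
Qed.

Let eigen_act lam gs y t : eigen lam gs t -> eigen lam gs (act a y t).
Proof.
move=> [tD te]; split=> x xP; rewrite act_commute //; first by rewrite tD.
by rewrite te // rmorphM act_scal.
Qed.

Let operator y (l : seq C) t := foldr (fun c u => act a y u - scal a c * u) t l.

(** The factors y - c of [operator y l], with distinct c, are removed one at a time; this works in a
    T of infinite dimension. *)
Let eigen_split lam gs y (l : seq C) t : uniq l -> eigen lam gs t -> operator y l t = 0 ->
  exists2 us : seq (C * T),
    {in us, forall v, [/\ v.1 \in l, eigen lam gs v.2 & act a y v.2 = scal a v.1 * v.2]}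
    & t = \sum_(v <- us) v.2.
Proof.
have opC c u (m : seq C) : operator y m (act a y u - scal a c * u) =
    act a y (operator y m u) - scal a c * operator y m u.
  elim: m => //= d m ->; rewrite !(rmorphB, rmorphM) /= !act_scal !mulrBr.
  ring.
elim: l t => [|c l IH] t /=; first by move=> _ _ ->; exists [::]; rewrite ?big_nil.
move=> /andP[cl ul] et.
rewrite -opC => /IH[//||us usP usE].
  have := eigenD (eigen_act y et) (eigen_scal (- c) et).
  by rewrite rmorphN mulNr.
(* On each summand y - c acts as the nonzero scalar v.1 - c, which is inverted here. Hence (y - c) w
   = (y - c) t, and t - w is the eigenvector for c. *)
pose w := \sum_(v <- us) scal a (v.1 - c)^-1 * v.2.
have usc (v : C * T) : v \in us -> v.1 - c != 0.
  by move=> /usP[ul' _ _]; rewrite subr_eq0; apply: contraNneq cl => <-.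
have wE : act a y w - scal a c * w = act a y t - scal a c * t.
  rewrite usE /w rmorph_sum mulr_sumr -sumrB !big_seq; apply: eq_bigr => u uus /=.
  have [_ _ yu] := usP u uus; rewrite rmorphM act_scal yu.
  rewrite -[RHS](scalK _ (usc u uus)) [scal a (_ - c)]rmorphB; ring.
have ew : eigen lam gs w.
  rewrite /w; elim: (us) usP => [|u us' IHu] usP.
    by rewrite big_nil; split=> x _; rewrite rmorph0 ?mulr0.
  rewrite big_cons; apply: eigenD.
    by apply: eigen_scal; have [] := usP u (mem_head _ _).
  by apply: IHu => v vus; apply: usP; rewrite inE vus orbT.
exists ((c, t - w) :: [seq (v.1, scal a (v.1 - c)^-1 * v.2) | v <- us]); last first.
  by rewrite big_cons big_map /= -/w subrK.
move=> u; rewrite inE => /predU1P[->|/mapP[v /usP[vl ev yv] ->]] /=.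
  split; first exact: mem_head.
    have := eigenD et (eigen_scal (- 1) ew); by rewrite rmorphN1 mulN1r.
  rewrite rmorphB /=; apply/eqP; rewrite -subr_eq0; apply/eqP.
  transitivity ((act a y t - scal a c * t) - (act a y w - scal a c * w)); first by ring.
  by rewrite wE subrr.
split; first by rewrite inE vl orbT.
  exact: eigen_scal.
by rewrite rmorphM act_scal yv mulrCA.
Qed.

(** The bound k is kept free for the induction: multiplication by X needs the expansion up to k - 1,
    multiplication by a constant the one up to k. *)
Let operatorE y (l : seq C) t k : (size l <= k)%N -> operator y l t =
  \sum_(i < k.+1) scal a (\prod_(c <- l) ('X - c%:P))`_i * act a (y ^+ i)%g t.
Proof.
elim: l k => [|c l IH] k /= le_k.
  rewrite big_ord_recl big_nil big1 => [|i _].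
    by rewrite coef1 rmorph1 mul1r act1 addr0.
  by rewrite coef1 rmorph0 mul0r.
rewrite big_cons; set p := \prod_(j <- l) _ in IH *.
transitivity (\sum_(i < k.+1) scal a ('X * p)`_i * act a (y ^+ i)%g t -
    \sum_(i < k.+1) scal a (c%:P * p)`_i * act a (y ^+ i)%g t); last first.
  by rewrite -sumrB; apply: eq_bigr => i _; rewrite -mulrBl -rmorphB -coefB -mulrBl.
congr (_ - _); last first.
  rewrite (IH k) ?(ltnW le_k) // mulr_sumr; apply: eq_bigr => i _.
  by rewrite coefCM rmorphM mulrA.
case: k le_k => // k le_k.
rewrite big_ord_recl coefXM rmorph0 mul0r add0r (IH k) // rmorph_sum.
apply: eq_bigr => i _; rewrite rmorphM act_scal -actM coefXM /=.
by rewrite /bump add1n expgS.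
Qed.

Let operator_roots y (rs : seq C) t : 'X^#|gT| - 1 = \prod_(c <- rs) ('X - c%:P) ->
  operator y rs t = 0.
Proof.
have yN : (y ^+ #|gT|)%g = 1%g by rewrite -cardsT expg_cardG ?finset.in_setT.
have [N NE] : exists N, #|gT| = N.+1.
  by exists #|gT|.-1; rewrite prednK //; apply/card_gt0P; exists 1%g.
rewrite NE in yN * => rsE; rewrite (@operatorE y rs t (size rs)) // -rsE.
have <- : N.+1 = size rs.
  by apply: succn_inj; rewrite -(size_prod_XsubC rs idfun) -rsE size_XnsubC.
rewrite big_ord_recr /= big_ord_recl big1 => [|i _].
  rewrite !coefB !coefXn !coef1 eqxx /= yN.
  by rewrite expg0 !(act1 a) addr0 sub0r subr0 rmorphN !rmorph1 mulN1r mul1r addNr.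
rewrite coefB coefXn coef1 /= /bump add1n ltn_eqF ?subr0 ?rmorph0 ?mul0r //.
by have := ltn_ord i; lia.
Qed.

(** Commutators fix t, so the group acts on such vectors by commuting operators, each a root of
    ['X^#|gT| - 1], whose roots are distinct. Splitting along one group element after another yields
    simultaneous eigenvectors. *)
Lemma sum_of_semi_invariants t : (forall x, x \in D -> act a x t = t) ->
  sum_of (fun u => exists chi, semi_invariant chi u) t.
Proof.
move=> tD; have [rs rsE] := closed_field_poly_normal ('X^#|gT| - 1 : {poly C}).
have N0 : (0 < #|gT|)%N by apply/card_gt0P; exists 1%g.
rewrite (monicP (monicXnsubC _ N0)) scale1r in rsE.
have Urs : uniq rs.
  by rewrite -separable_prod_XsubC -rsE separable_Xn_sub_1 // card_neq0.
suff: sum_of (fun u => exists lam, eigen lam (enum gT) u) t.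
  apply: sum_of_trans => u [lam [uD ue]]; apply: sum_of1.
  have {}ue x : act a x u = scal a (lam x) * u by rewrite ue ?mem_enum.
  (* Only a nonzero u determines [lam]; the vector 0 is given the trivial weight. *)
  have [->|u0] := eqVneq u 0; first by exists 0; exact: semi_invariant0.
  have scal_eq c d : scal a c * u = scal a d * u -> c = d.
    move=> /eqP; rewrite -subr_eq0 -mulrBl -rmorphB => /eqP cdu.
    apply/eqP; rewrite -subr_eq0; apply: contraNT u0 => cd.
    by rewrite -(scalK u cd) cdu mulr0.
  have lam1 : lam 1%g = 1 by apply: scal_eq; rewrite -ue act1 rmorph1 mul1r.
  have lamM x y : lam (x * y)%g = lam x * lam y.
    apply: scal_eq; rewrite -ue actM ue rmorphM act_scal ue rmorphM; ring.
  by exists (char_lift lam1 lamM) => x; rewrite char_val_lift.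
(* Over the empty list the condition on [lam] is void, hence the arbitrary constant 1. Each step
   overwrites the value at y by the eigenvalue found for y. *)
elim: (enum gT) => [|y gs IH]; first by apply: sum_of1; exists (fun=> 1).
apply: sum_of_trans IH => u [lam ue].
have [us usP ->] := eigen_split Urs ue (operator_roots y u rsE).
apply: sum_of_sum => v /usP[_ [vD ve] vy]; apply: sum_of1.
exists (fun x => if x == y then v.1 else lam x); split=> // x.
by rewrite inE; case: eqP => [-> _|_ /= /ve].
Qed.

End Span.

Lemma sum_proj (chis : seq X) t : uniq chis -> (forall chi, chi \in chis) ->
  (forall x, x \in D -> act a x t = t) -> t = \sum_(chi <- chis) proj chi t.
Proof.
move=> Uchis chisP /sum_of_semi_invariants[us usP ->].
under [RHS]eq_bigr do rewrite raddf_sum.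
rewrite exchange_big /= !big_seq; apply: eq_bigr => u /usP[psi up].
rewrite (bigD1_seq psi) //= (proj_semi_invariant _ up) eqxx big1 ?addr0 //.
by move=> chi /negPf ne; rewrite (proj_semi_invariant _ up) ne.
Qed.

End SemiInvariants.

(** * Divisors on the quotient *)

(* [A] is the ring of invariants of [S].  The separation property of distinct
   elements of the group is what smallness of the action is used for; as the
   zero ideal is a prime ideal, it includes faithfulness. *)
Record small_quotient (C : numClosedFieldType) (gT : finGroupType) (S A : idomainType) :=
  SmallQuotient {
    sq_action :> scalar_action C gT S;
    sq_factorial : factorial_ring S;
    sq_units : forall u : S, u \is a GRing.unit -> exists c, u = scal sq_action c;
    sq_separated : forall (h : S) (x y : gT), generates_prime h -> x != y ->
      exists w, ~ divides h (act sq_action x w - act sq_action y w);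
    sq_inv : {rmorphism A -> S};
    sq_inv_inj : injective sq_inv;
    sq_inv_im : forall f : S,
      (forall x, act sq_action x f = f) <-> exists a, f = sq_inv a }.

Section Quotient.
Context (C : numClosedFieldType) (gT : finGroupType) (S A : idomainType).
Context (Q : small_quotient C gT S A).
Local Notation X := (char_group (abelianization gT) C).
Local Notation L := {fraction S}.
Local Notation F := {fraction A}.
Local Notation sc := (scal Q).
Local Notation inv := (sq_inv Q).
Local Notation Sfact := (sq_factorial Q).
Implicit Types (chi psi : X) (x y : gT) (h p q u m s t : S) (a b : A) (l : L) (c : C).

Lemma act_bij x : bijective (act Q x).
Proof.
by exists (act Q x^-1%g) => s; rewrite -actM ?mulVg ?mulgV (act1 Q).
Qed.

Lemma act_inj x : injective (act Q x).
Proof. exact: bij_inj (act_bij x). Qed.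

Definition frac_act x : {rmorphism L -> L} := frac_map (@act_inj x).
Definition frac_scal : {rmorphism C -> L} := @tofrac S \o sc.

Lemma frac_actE x s : frac_act x s%:F = (act Q x s)%:F.
Proof. by rewrite -(frac_map_tofrac (@act_inj x)). Qed.

Lemma frac_act_div x s t : frac_act x (s%:F / t%:F) = (act Q x s)%:F / (act Q x t)%:F.
Proof. by rewrite fmorph_div !frac_actE. Qed.

Lemma frac_act1 l : frac_act 1%g l = l.
Proof. by have [s [t [t0 ->]]] := fracP l; rewrite frac_act_div !(act1 Q). Qed.

Lemma frac_actM x y l : frac_act (x * y)%g l = frac_act x (frac_act y l).
Proof. by have [s [t [t0 ->]]] := fracP l; rewrite !frac_act_div !(actM Q). Qed.

Lemma frac_act_scal x c : frac_act x (frac_scal c) = frac_scal c.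
Proof. by rewrite frac_actE act_scal. Qed.

Definition frac_action : scalar_action C gT L :=
  ScalarAction frac_act1 frac_actM frac_act_scal.
Local Notation aL := frac_action.

Definition frac_inv : {rmorphism F -> L} := frac_map (@sq_inv_inj _ _ _ _ Q).
Local Notation iL := frac_inv.

Lemma frac_invE a : iL a%:F = (inv a)%:F.
Proof. by rewrite -(frac_map_tofrac (@sq_inv_inj _ _ _ _ Q)). Qed.

Lemma frac_inv_div a b : iL (a%:F / b%:F) = (inv a)%:F / (inv b)%:F.
Proof. by rewrite fmorph_div !frac_invE. Qed.

Lemma act_sq_inv x a : act Q x (inv a) = inv a.
Proof. by have [_] := sq_inv_im Q (inv a); apply; exists a. Qed.

Lemma semi_invariant_tofrac chi s : semi_invariant aL chi s%:F <-> semi_invariant Q chi s.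
Proof.
split=> ss x; last by rewrite [LHS]frac_actE ss tofracM.
by apply/eqP; rewrite -tofrac_eq -frac_actE tofracM; apply/eqP; exact: ss.
Qed.

Definition norm s : S := \prod_x act Q x s.

Lemma act_norm x s : act Q x (norm s) = norm s.
Proof.
rewrite rmorph_prod [RHS](reindex_inj (mulgI x)).
by apply: eq_bigr => y _; rewrite actM.
Qed.

Lemma norm_inv s : exists a, norm s = inv a.
Proof. by apply/sq_inv_im => x; exact: act_norm. Qed.

Lemma act_neq0 x s : s != 0 -> act Q x s != 0.
Proof. by move=> s0; rewrite -(rmorph0 (act Q x)) (inj_eq (@act_inj x)). Qed.

Lemma norm_neq0 s : s != 0 -> norm s != 0.
Proof. by move=> s0; rewrite prodf_seq_neq0; apply/allP => x _; rewrite act_neq0. Qed.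

Lemma norm_divisible s : divides s (norm s).
Proof.
have := @divides_prod _ _ (index_enum gT) (fun x => act Q x s) 1%g (mem_index_enum _).
by rewrite act1.
Qed.

Lemma normM s t : norm (s * t) = norm s * norm t.
Proof. by rewrite -big_split; apply: eq_bigr => x _; rewrite rmorphM. Qed.

Lemma norm_sq_inv a : norm (inv a) = inv (a ^+ #|gT|).
Proof.
rewrite /norm (eq_bigr (fun=> inv a)); last by move=> x _; rewrite act_sq_inv.
by rewrite prodr_const rmorphXn.
Qed.

Lemma sq_inv_neq0 a : a != 0 -> inv a != 0.
Proof. by move=> a0; rewrite -(rmorph0 inv) (inj_eq (@sq_inv_inj _ _ _ _ Q)). Qed.

(** Numerator and denominator are multiplied by the other conjugates of the denominator. It becomes
    a norm, hence invariant, and the numerator is then invariant along with l. *)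
Lemma frac_inv_im l : semi_invariant aL 0 l <-> exists f, l = iL f.
Proof.
rewrite semi_invariant_invariant; split=> [lG|[f ->] x]; last first.
  have [a [b [b0 ->]]] := fracP f; rewrite frac_inv_div.
  by rewrite [act _ _ _]frac_act_div !act_sq_inv.
have [s [t [t0 lE]]] := fracP l; have [b bE] := norm_inv t.
have nt0 := norm_neq0 t0.
have nE : l * (norm t)%:F = (s * \prod_(x | x != 1%g) act Q x t)%:F.
  rewrite lE /norm (bigD1 1%g) //= act1 !tofracM.
  by rewrite mulrA divfK // tofrac_eq0.
have [a aE] : exists a, s * \prod_(x | x != 1%g) act Q x t = inv a.
  apply/sq_inv_im => x; apply/eqP; rewrite -tofrac_eq -frac_actE -nE rmorphM.
  by rewrite [frac_act x l]lG frac_actE act_norm.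
exists (a%:F / b%:F); rewrite frac_inv_div -bE -aE -nE.
by rewrite mulfK // tofrac_eq0.
Qed.

Lemma integral_invariant s : semi_invariant aL 0 s%:F -> exists a, s = inv a.
Proof.
move=> /semi_invariant_tofrac/semi_invariant_invariant sG.
by apply/(sq_inv_im Q) => x.
Qed.

(* Dedekind's independence of characters, modulo the prime ideal (h). *)
Lemma dedekind h (xs : seq gT) (e : gT -> S) : generates_prime h -> uniq xs ->
  (forall s, divides h (\sum_(x <- xs) e x * act Q x s)) ->
  {in xs, forall x, divides h (e x)}.
Proof.
move=> hp; elim: xs e => [|y xs IH] e //= /andP[yxs Uxs] he.
have hxs : {in xs, forall x, divides h (e x)}.
  move=> x xxs; have xy : x != y by apply: contraNneq yxs => <-.
  have [w hw] := sq_separated Q hp xy.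
  suff : divides h (e x * (act Q x w - act Q y w)) by case/hp.2.
  apply: (IH (fun x => e x * (act Q x w - act Q y w))) => // s.
  have := dividesB (he (w * s)) (divides_mull (act Q y w) (he s)).
  rewrite mulr_sumr -sumrB big_cons rmorphM [X in X + _](_ : _ = 0) ?add0r; last by ring.
  by congr divides; apply: eq_bigr => z _; rewrite rmorphM; ring.
move=> x; rewrite inE => /predU1P[->|]; last exact: hxs.
have := he 1; rewrite big_cons rmorph1 mulr1.
rewrite big_seq_cond => hs; have := dividesB hs
  (@divides_sum _ h _ xs (fun x => (x \in xs) && true) (fun x => e x * act Q x 1) _).
rewrite addrK; apply=> z /andP[zxs _]; apply: divides_mulr; exact: hxs.
Qed.

(** If h divided all the twisted sums over the group, Dedekind's lemma would make it divide their
    coefficient at the identity, which is 1. *)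
Lemma semi_invariant_not_divisible h chi : generates_prime h ->
  exists2 m, semi_invariant Q chi m & ~ divides h m.
Proof.
move=> hp; apply: contrapT => no.
have := @dedekind h (index_enum gT) (fun x => sc (char_val chi x)^-1) hp (index_enum_uniq _).
move=> /(_ _ 1%g (mem_index_enum _)) [s|].
  apply: contrapT => hs; apply: no; exists (\sum_x sc (char_val chi x)^-1 * act Q x s) => //.
  exact: semi_invariant_twisted_sum.
move=> c /esym cE; case/negP: hp.1; apply: (@divides_unit _ _ 1 (unitr1 _)).
by exists c; rewrite cE char_val1 invr1 rmorph1.
Qed.

Local Notation v := valuation.
Local Notation vM := (valuationM Sfact).

Lemma prime_act x h : prime_elt h -> prime_elt (act Q x h).
Proof. exact: prime_rmorph (act_bij x). Qed.

Lemma valuation_act x h l : prime_elt h -> l != 0 ->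
  v (act Q x h) (frac_act x l) = v h l.
Proof. by move=> hp l0; exact: (valuation_rmorph Sfact _ (act_bij x)). Qed.

Lemma sc_unit c : c != 0 -> sc c \is a GRing.unit.
Proof. by move=> c0; rewrite rmorph_unit // unitfE. Qed.

Lemma valuation_scal h c : prime_elt h -> c != 0 -> v h (frac_scal c) = 0.
Proof.
move=> hp c0; rewrite /frac_scal /= (valuation_tofrac Sfact) //.
  by rewrite (mult_unit Sfact) // sc_unit.
by rewrite fmorph_eq0.
Qed.

Lemma frac_scal_neq0 c : (frac_scal c != 0) = (c != 0).
Proof. by rewrite fmorph_eq0. Qed.

(** The quotient of l by l' has valuation 0 at all primes, so it is a unit of S, and the units are
    scalars. *)
Lemma valuation_eq_scal l l' : l != 0 -> l' != 0 ->
  (forall h, prime_elt h -> v h l = v h l') -> exists2 c, c != 0 & l = frac_scal c * l'.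
Proof.
move=> l0 l'0 vl; have [|h hp|u Uu uE] := @valuation_eq0_unit _ Sfact (l / l').
- by rewrite mulf_neq0 ?invr_eq0.
- by rewrite vM ?invr_eq0 // (valuationV Sfact) // vl // subrr.
have [c cE] := sq_units Q Uu; exists c.
  by apply: contraTneq Uu => c0; rewrite cE c0 rmorph0 unitr0.
by rewrite /frac_scal /= -cE -uE divfK.
Qed.

Lemma valuation_semi_invariant chi x h l : prime_elt h -> l != 0 ->
  semi_invariant aL chi l -> v (act Q x h) l = v h l.
Proof.
move=> hp l0 lP; rewrite -[RHS](valuation_act x) // [frac_act x l]lP.
have c0 := char_val_neq0 chi x.
by rewrite vM ?frac_scal_neq0 ?valuation_scal ?add0r //; exact: prime_act.
Qed.

(** The valuation at h of the image of l under x is that of l at a conjugate of h. So l and its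
    image differ by a constant, which is multiplicative in x. *)
Lemma semi_invariant_valuation l : l != 0 ->
  (forall h x, prime_elt h -> v (act Q x h) l = v h l) ->
  exists chi, semi_invariant aL chi l.
Proof.
move=> l0 vl.
have lamP x : exists c, frac_act x l = frac_scal c * l.
  have [||h hp|c c0 ->] := @valuation_eq_scal (frac_act x l) l; last by exists c.
  - by rewrite fmorph_eq0.
  - exact: l0.
  have hE : h = act Q x (act Q x^-1%g h) by rewrite -(actM Q) mulgV (act1 Q).
  have hp' := prime_act x^-1%g hp.
  by rewrite {1}hE valuation_act // vl.
have [lam lamE] := choice lamP.
have lam_inj c c' : frac_scal c * l = frac_scal c' * l -> c = c'.
  by move=> /(mulIf l0) /eqP; rewrite (inj_eq (fmorph_inj _)) => /eqP.
have lam1 : lam 1%g = 1.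
  by apply: lam_inj; rewrite -lamE frac_act1 rmorph1 mul1r.
have lamM x y : lam (x * y)%g = lam x * lam y.
  apply: lam_inj; rewrite -lamE frac_actM (lamE y) [LHS]rmorphM [frac_act x l]lamE frac_act_scal.
  by rewrite [frac_scal (_ * _)]rmorphM mulrA [frac_scal (lam y) * _]mulrC.
by exists (char_lift lam1 lamM) => x; rewrite char_val_lift -lamE.
Qed.

Lemma valuation_ge0_invariant l : l != 0 -> semi_invariant aL 0 l ->
  (forall h, prime_elt h -> 0 <= v h l) -> exists2 a, a != 0 & l = (inv a)%:F.
Proof.
move=> l0 lG /(valuation_ge0_integral Sfact l0)[s s0 lE].
have [a sE] := integral_invariant (eq_ind _ (semi_invariant aL 0) lG _ lE).
by exists a; rewrite -?sE //; apply: contra_neq s0 => a0; rewrite sE a0 rmorph0.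
Qed.

(** * Primes of S above the prime divisors of the quotient *)

Section Primes.
Implicit Types (P : prime_divisor A).

Definition lies_over h P : Prop :=
  prime_elt h /\ forall a, sval (val P) a <-> divides h (inv a).

Lemma lies_over_inj h P P' : lies_over h P -> lies_over h P' -> P = P'.
Proof.
move=> [_ hP] [_ hP']; apply/val_inj/val_inj/funext => a; apply/propext.
exact: (iff_trans (hP a) (iff_sym (hP' a))).
Qed.

Lemma divides_act x h s : divides (act Q x h) (act Q x s) <-> divides h s.
Proof.
split=> [[c cE]|[c ->]]; last by exists (act Q x c); rewrite rmorphM.
exists (act Q x^-1%g c); apply: (@act_inj x).
by rewrite cE rmorphM -(actM Q) mulgV (act1 Q).
Qed.

Lemma lies_over_act x h P : lies_over h P -> lies_over (act Q x h) P.
Proof.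
move=> [hp hP]; split; first exact: prime_act.
by move=> a; rewrite hP -(divides_act x) act_sq_inv.
Qed.

Lemma divides_unit_mul u h s : u \is a GRing.unit -> divides (u * h) s <-> divides h s.
Proof.
move=> Uu; split=> -[c ->]; first by exists (c * u); rewrite mulrA.
by exists (c / u); rewrite mulrA divrK.
Qed.

Lemma lies_over_unit u h P : u \is a GRing.unit -> lies_over (u * h) P -> prime_elt h ->
  lies_over h P.
Proof.
by move=> Uu [uhp uhP] hp; split=> // a; rewrite uhP divides_unit_mul.
Qed.

Lemma divides_norm h s : generates_prime h -> divides h (norm s) ->
  exists x, divides h (act Q x s).
Proof. by move=> hp /(prime_divides_prod hp)[x _ hx]; exists x. Qed.

Lemma prime_ideal_power (I : spec A) a k : sval I (a ^+ k) -> sval I a.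
Proof.
have [_ _ _ I1 IM] := specP I.
by elim: k => // k IH; rewrite exprS => /IM[].
Qed.

(** For a nonzero a in I, [a ^+ #|gT|] is the product of the norms of the factors of [inv a], so I
    contains the norm of one of the primes h. If h divides [inv b], the same power of b is a
    multiple of this norm, hence lies in I. *)
Lemma nonzero_prime_contraction (I : spec A) : (exists2 a, sval I a & a != 0) ->
  exists2 h, prime_elt h & forall a, divides h (inv a) -> sval I a.
Proof.
move=> [a Ia a0]; have [I0 ID IM I1 Ipr] := specP I.
have [u [r [Uu rP aE]]] := Sfact (sq_inv_neq0 a0).
have [N NP] : exists N : S -> A, forall s, norm s = inv (N s).
  by have [N NP] := choice norm_inv; exists N.
have [h hr Ih] : exists2 h, h \in r & sval I (N h).
  have : sval I (N u * \prod_(h <- r) N h).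
    have -> : N u * \prod_(h <- r) N h = a ^+ #|gT|.
      apply: (@sq_inv_inj _ _ _ _ Q); rewrite rmorphM rmorph_prod /= -norm_sq_inv aE normM NP.
      congr (_ * _); rewrite (big_morph norm normM (_ : norm 1 = 1)).
        by apply: eq_bigr => h _; rewrite NP.
      by rewrite /norm big1 // => x _; rewrite rmorph1.
    have : (0 < #|gT|)%N by apply/card_gt0P; exists 1%g.
    by case: #|gT| => // k _; rewrite exprSr; exact: IM.
  have IU : ~ sval I (N u).
    move=> Iu; apply: I1; have [b bE] := norm_inv u^-1.
    rewrite -[1](_ : b * N u = 1); first exact: IM.
    apply: (@sq_inv_inj _ _ _ _ Q); rewrite rmorphM -NP -bE -normM mulVr // rmorph1.
    by rewrite /norm big1 // => x _; rewrite rmorph1.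
  case/Ipr => // {IU aE rP}.
  elim: r => [|h r IH]; first by rewrite big_nil.
  rewrite big_cons => /Ipr[Ih|/IH[p pr Ip]]; first by exists h; rewrite ?mem_head.
  by exists p; rewrite // inE pr orbT.
exists h; first exact: rP.
move=> b [s bE]; apply: (@prime_ideal_power _ _ #|gT|).
rewrite (_ : b ^+ _ = N s * N h); first exact: IM.
by apply: (@sq_inv_inj _ _ _ _ Q); rewrite rmorphM -!NP -normM -bE norm_sq_inv.
Qed.

Lemma contraction_prime h : generates_prime h -> prime_ideal (fun a => divides h (inv a)).
Proof.
move=> hp; split.
- by rewrite rmorph0; exact: divides0.
- by move=> a b ha hb; rewrite rmorphD; exact: dividesD.
- by move=> a b hb; rewrite rmorphM; exact: divides_mull.
- by rewrite rmorph1 => /(prime_not_divides_unit hp); apply; exact: unitr1.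
- by move=> a b; rewrite rmorphM; exact: hp.2.
Qed.

Definition contraction h (hp : generates_prime h) : spec A :=
  exist (fun x : set A => `[< prime_ideal x >]) _ (asboolT (contraction_prime hp)).

Lemma contraction_nonzero h : prime_elt h -> exists2 a, divides h (inv a) & a != 0.
Proof.
move=> [h0 _]; have [a aE] := norm_inv h.
exists a; first by rewrite -aE; exact: norm_divisible.
by apply: contra_neq (norm_neq0 h0) => a0; rewrite aE a0 rmorph0.
Qed.

(** Tested on the norm of h, the inclusion shows that p divides a conjugate of h, of which it is
    then an associate. *)
Lemma contraction_le h p : prime_elt h -> prime_elt p ->
  (forall a, divides h (inv a) -> divides p (inv a)) ->
  exists x, exists2 u, u \is a GRing.unit & act Q x h = u * p.
Proof.
move=> hp pp le_hp; have [a aE] := norm_inv h.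
have : divides p (norm h) by rewrite aE; apply: le_hp; rewrite -aE; exact: norm_divisible.
case/(divides_norm pp.2) => x px; exists x.
exact: prime_divides_prime (prime_act x hp) (prime_nunit pp) px.
Qed.

(** A nonzero prime ideal inside the contraction of h contains in turn the contraction of some p.
    Then p and h are conjugate, so both inclusions are equalities. *)
Lemma contraction_height_one h (hp : prime_elt h) : height_one (contraction hp.2).
Proof.
split; first exact: contraction_nonzero.
move=> I le_Ih; have [[a [Ia a0]]|no] := pselect (exists a, sval I a /\ a != 0).
  right; have [|p pp pI] := @nonzero_prime_contraction I; first by exists a.
  have [|x [u Uu xE]] := @contraction_le p h pp hp.
    by move=> b /pI /le_Ih.
  apply/val_inj/funext => b; apply/propext; split; first exact: le_Ih.
  move=> /= hb; apply: pI; apply/(divides_act x).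
  by rewrite xE act_sq_inv divides_unit_mul.
left; apply/val_inj/funext => b; apply/propext; split=> /= [Ib|->].
  by apply: contrapT => /eqP b0; apply: no; exists b.
by have [] := specP I.
Qed.

Lemma exists_divisor_below h : prime_elt h -> exists P, lies_over h P.
Proof.
move=> hp; exists (exist (fun x : spec A => `[< height_one x >]) _ (asboolT (contraction_height_one hp))).
by split.
Qed.

(** P contains the contraction of some h, which is a nonzero prime ideal; height one makes them
    equal. *)
Lemma exists_prime_above P : exists h, lies_over h P.
Proof.
have /asboolP [Pnz Pmin] := valP P.
have [h hp hP] := nonzero_prime_contraction Pnz.
exists h; split=> // a; split; last exact: hP.
case: (Pmin (contraction hp.2)) => [b /hP //|E|E]; last by rewrite -E.
have [b hb b0] := contraction_nonzero hp.
by have : sval (contraction hp.2) b by []; rewrite E => /= bE; rewrite bE eqxx in b0.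
Qed.

Lemma lies_over_conj h p P : lies_over h P -> lies_over p P ->
  exists x, exists2 u, u \is a GRing.unit & act Q x h = u * p.
Proof. by move=> [hp hP] [pp pP]; apply: contraction_le => // a; rewrite -hP -pP. Qed.

(** All primes above P are conjugate, and a semi-invariant has the same valuation at conjugate
    primes. *)
Lemma valuation_lies_over chi l h p P : lies_over h P -> lies_over p P ->
  l != 0 -> semi_invariant aL chi l -> v h l = v p l.
Proof.
move=> hP pP l0 lP; have [x [u Uu xE]] := lies_over_conj hP pP.
rewrite -(valuation_semi_invariant x hP.1 l0 lP) xE.
by rewrite (valuation_mul_unit Sfact pP.1).
Qed.

End Primes.

End Quotient.

(** * Equations of divisors and the class group *)

Section ClassGroup.
Context (C : numClosedFieldType) (gT : finGroupType) (S A : idomainType).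
Context (Q : small_quotient C gT S A).
Local Notation X := (char_group (abelianization gT) C).
Local Notation L := {fraction S}.
Local Notation F := {fraction A}.
Local Notation inv := (sq_inv Q).
Local Notation Sfact := (sq_factorial Q).
Local Notation aL := (frac_action Q).
Local Notation iL := (frac_inv Q).
Local Notation v := valuation.
Local Notation dsupp := monalg.msupp.
Local Notation dcoeff := monalg.mcoeff.
Local Notation vM := (valuationM Sfact).
Implicit Types (chi psi : X) (x y : gT) (h p q u m s t : S) (a b : A) (l : L) (c : C).
Implicit Types (P : prime_divisor A) (E : weil_divisor A).

Lemma semi_invariant_uniq chi psi l : l != 0 ->
  semi_invariant aL chi l -> semi_invariant aL psi l -> chi = psi.
Proof.
move=> l0 cl pl; apply: char_val_inj => x.
have : frac_scal Q (char_val chi x) * l = frac_scal Q (char_val psi x) * l.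
  by rewrite -[LHS](cl x) -[RHS](pl x).
by move/(mulIf l0)/fmorph_inj.
Qed.

Definition associates p q : bool := `[< exists2 u, u \is a GRing.unit & q = u * p >].

Lemma associates_refl p : associates p p.
Proof. by apply/asboolP; exists 1; rewrite ?unitr1 ?mul1r. Qed.

Lemma associates_sym p q : associates p q -> associates q p.
Proof.
move=> /asboolP[u Uu ->]; apply/asboolP; exists u^-1; rewrite ?unitrV //.
by rewrite mulKr.
Qed.

Lemma associates_trans p q s : associates p q -> associates q s -> associates p s.
Proof.
move=> /asboolP[u Uu ->] /asboolP[w Uw ->]; apply/asboolP.
by exists (w * u); rewrite ?mulrA // unitrM Uw.
Qed.

(** One representative per class modulo units, so that [undup] can remove repeated primes. *)
Definition canonical_associate p : S := choose (associates p) p.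

Lemma canonical_associateP p : associates p (canonical_associate p).
Proof. exact: chooseP (associates_refl p). Qed.

Lemma eq_canonical_associate p q :
  (canonical_associate p == canonical_associate q) = associates p q.
Proof.
apply/eqP/idP => [E|pq].
  apply: associates_trans (canonical_associateP p) _.
  by rewrite E; apply: associates_sym; exact: canonical_associateP.
have eqP : associates p =1 associates q.
  move=> s; apply/idP/idP; apply: associates_trans; [exact: associates_sym|exact: pq].
rewrite /canonical_associate (eq_choose eqP); apply: choose_id; last exact: associates_refl.
exact: associates_sym pq.
Qed.

Lemma prime_associates p q : prime_elt p -> associates p q -> prime_elt q.
Proof.
move=> [p0 [pU pP]] /asboolP[u Uu ->]; split.
  by rewrite mulf_neq0 //; apply: contraTneq Uu => ->; rewrite unitr0.
split; first by rewrite unitrM negb_and pU orbT.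
by move=> x y; rewrite !divides_unit_mul //; exact: pP.
Qed.

Lemma mult_associates h p : prime_elt h -> prime_elt p ->
  mult h p = associates h p.
Proof.
move=> hp pp; case: (boolP (associates h p)) => [/asboolP[u Uu pE]|/asboolPn nas].
  have u0 : u != 0 by apply: contraTneq Uu => ->; rewrite unitr0.
  by rewrite pE (multM Sfact) ?hp.1 // (mult_unit Sfact) // mult_self.
rewrite (mult_prime Sfact) // => hdp; apply: nas.
exact: prime_divides_prime pp (prime_nunit hp) hdp.
Qed.

(** The norm of p would count every prime above P once for each element of the stabilizer of its
    ideal. Keeping a single conjugate per class of associates makes all multiplicities 1. *)
Lemma exists_orbit_product P : exists N : S, N != 0 /\
  forall h, prime_elt h -> mult h N = `[< lies_over Q h P >].
Proof.
have [p pP] := exists_prime_above Q P; have pp := pP.1.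
pose r := undup [seq canonical_associate (act Q x p) | x <- enum gT].
have rP q : q \in r -> prime_elt q.
  rewrite mem_undup => /mapP[x _ ->].
  exact: prime_associates (prime_act Q x pp) (canonical_associateP _).
have prod_neq0 (r' : seq S) : {in r', forall q, prime_elt q} -> \prod_(q <- r') q != 0.
  by move=> r'P; rewrite prodf_seq_neq0; apply/allP => q /r'P[].
exists (\prod_(q <- r) q); split; first exact: prod_neq0.
move=> h hp; have -> : mult h (\prod_(q <- r) q) = (canonical_associate h \in r).
  have : uniq r by exact: undup_uniq.
  have : {in r, forall q, canonical_associate q = q}.
    move=> q; rewrite mem_undup => /mapP[x _ ->]; apply/eqP.
    by rewrite eq_canonical_associate associates_sym // canonical_associateP.
  elim: r rP => [|q r IH] rP rC.
    by rewrite big_nil (mult_unit Sfact) ?unitr1.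
  have rP' : {in r, forall q, prime_elt q} by move=> s sr; apply: rP; rewrite inE sr orbT.
  move=> /= /andP[qr Ur]; have qp : prime_elt q by apply: rP; rewrite mem_head.
  rewrite big_cons (multM Sfact) ?prod_neq0 //; last by case: qp.
  rewrite IH //; last by move=> s sr; apply: rC; rewrite inE sr orbT.
  rewrite mult_associates // inE -{2}(rC q (mem_head _ _)) eq_canonical_associate.
  case: (boolP (associates h q)) => // hq; rewrite [canonical_associate h](_ : _ = q).
    by rewrite (negPf qr).
  by rewrite -[RHS](rC q (mem_head _ _)); apply/eqP; rewrite eq_canonical_associate.
rewrite mem_undup; congr nat_of_bool; apply/mapP/asboolP => [[x _ xE]|hP].
  have : associates (act Q x p) h.
    by apply: associates_sym; rewrite -eq_canonical_associate xE.
  case/asboolP => u Uu hE; move: (hp); rewrite hE => uxp.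
  have [xp xP] := lies_over_act x pP.
  by split=> // a; rewrite divides_unit_mul.
have [x [u Uu xE]] := lies_over_conj pP hP.
exists x; first by rewrite mem_enum.
apply/eqP; rewrite eq_canonical_associate xE; apply/asboolP.
by exists u.
Qed.

Definition orbit_product P : S := sval (cid (exists_orbit_product P)).

Lemma orbit_product_neq0 P : orbit_product P != 0.
Proof. by have [] := svalP (cid (exists_orbit_product P)). Qed.

Lemma mult_orbit_product h P : prime_elt h ->
  mult h (orbit_product P) = `[< lies_over Q h P >].
Proof. by have [_] := svalP (cid (exists_orbit_product P)); exact. Qed.

Lemma frac_orbit_product_neq0 P : (orbit_product P)%:F != 0.
Proof. by rewrite tofrac_eq0 orbit_product_neq0. Qed.

Lemma valuation_orbit_product h P : prime_elt h ->
  v h (orbit_product P)%:F = Posz (`[< lies_over Q h P >]).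
Proof.
by move=> hp; rewrite (valuation_tofrac Sfact) ?orbit_product_neq0 // mult_orbit_product.
Qed.

(* The equation of E upstairs. *)
Definition nu E : L := \prod_(P <- dsupp E) (orbit_product P)%:F ^ (dcoeff P E).

Lemma nuw (d : {fset prime_divisor A}) E : (dsupp E `<=` d)%fset ->
  nu E = \prod_(P <- d) (orbit_product P)%:F ^ (dcoeff P E).
Proof.
by move=> Ed; rewrite /nu (big_fset_incl _ Ed) // => P _ /monalg.mcoeff_outdom ->.
Qed.

Lemma nuD E E' : nu (E + E') = nu E * nu E'.
Proof.
rewrite (@nuw (dsupp E `|` dsupp E')%fset) ?monalg.msuppD_le //.
rewrite (@nuw (dsupp E `|` dsupp E')%fset E) ?fsubsetUl //.
rewrite (@nuw (dsupp E `|` dsupp E')%fset E') ?fsubsetUr //.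
rewrite -big_split /=; apply: eq_bigr => P _.
by rewrite monalg.mcoeffD expfzDr // frac_orbit_product_neq0.
Qed.

Lemma nu0 : nu 0 = 1.
Proof. by rewrite /nu monalg.msupp0 big_seq_fset0. Qed.

Lemma nu_neq0 E : nu E != 0.
Proof.
by rewrite prodf_seq_neq0; apply/allP => P _; rewrite /= expfz_neq0 ?frac_orbit_product_neq0.
Qed.

Lemma nuN E : nu (- E) = (nu E)^-1.
Proof.
by apply: (mulfI (nu_neq0 E)); rewrite -nuD subrr nu0 mulfV ?nu_neq0.
Qed.

Lemma valuation_nu h P E : lies_over Q h P -> v h (nu E) = dcoeff P E.
Proof.
move=> hP; have hp := hP.1; rewrite (@nuw (P |` dsupp E)%fset) ?fsubsetUr //.
rewrite (valuation_prod Sfact) //; last first.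
  by move=> P' _; rewrite expfz_neq0 ?frac_orbit_product_neq0.
rewrite (bigD1_seq P) ?fset_uniq ?fset1U1 //= big1 ?addr0 => [|P' /eqP PP'].
  rewrite (valuationXz Sfact) ?frac_orbit_product_neq0 // valuation_orbit_product //.
  by rewrite asboolT // mul1r.
rewrite (valuationXz Sfact) ?frac_orbit_product_neq0 // valuation_orbit_product //.
by rewrite asboolF ?mul0r // => hP'; apply: PP'; exact: lies_over_inj hP' hP.
Qed.

Lemma exists_nu_character E : exists chi, semi_invariant aL chi (nu E).
Proof.
apply: semi_invariant_valuation (nu_neq0 E) _ => h x hp.
have [P hP] := exists_divisor_below Q hp.
by rewrite (valuation_nu _ hP) (valuation_nu _ (lies_over_act x hP)).
Qed.

Definition divisor_character E : X := sval (cid (exists_nu_character E)).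
Local Notation psi := divisor_character.

Lemma semi_invariant_nu E : semi_invariant aL (psi E) (nu E).
Proof. exact: svalP (cid (exists_nu_character E)). Qed.

Lemma divisor_character_is_zmod_morphism : zmod_morphism psi.
Proof.
move=> E E'; apply: (addIr (psi E')); rewrite subrK.
apply: (semi_invariant_uniq (nu_neq0 E)) (semi_invariant_nu E).
rewrite -{2}[E](subrK E') nuD.
by apply: semi_invariantM; exact: semi_invariant_nu.
Qed.
HB.instance Definition _ :=
  GRing.isZmodMorphism.Build (weil_divisor A) X psi divisor_character_is_zmod_morphism.

(** The equation [nu E] of E = P has valuation 1 but in general a nontrivial weight. A
    semi-invariant of opposite weight, prime to h, corrects the weight and leaves the valuation. *)
Lemma exists_uniformizer h P : lies_over Q h P ->
  exists2 f : F, f != 0 & v h (iL f) = 1.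
Proof.
move=> hP; have hp := hP.1; pose E : weil_divisor A := << 1 *g P >>%R.
have [m mP hm] := semi_invariant_not_divisible Q (- psi E) hp.2.
have m0 : m != 0 by apply/eqP => m0; apply: hm; rewrite m0; exact: divides0.
have [f fE] : exists f, nu E * m%:F = iL f.
  apply/frac_inv_im; rewrite -[0](subrr (psi E)).
  by apply: semi_invariantM; [exact: semi_invariant_nu | apply/semi_invariant_tofrac].
have f0 : iL f != 0 by rewrite -fE mulf_neq0 ?nu_neq0 ?tofrac_eq0.
exists f; first by rewrite -(fmorph_eq0 iL).
rewrite -fE vM ?nu_neq0 ?tofrac_eq0 // (valuation_nu _ hP) (valuation_tofrac Sfact) //.
by rewrite (mult_eq0 Sfact hp m0 hm) addr0 monalg.mcoeffUU.
Qed.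

(** For the converse a denominator outside P is needed. Numerator and denominator are multiplied by
    an invariant k whose only poles lie above P and which exactly cancels the zero of b there. *)
Lemma local_ring_valuation h P (f : F) : lies_over Q h P -> f != 0 ->
  local_ring (val P) f <-> 0 <= v h (iL f).
Proof.
move=> hP; have hp := hP.1; move: f => f f0; split=> [[a [b [Pb fE]]]|].
  have a0 : a != 0 by apply: contra_neq f0 => a0; rewrite fE a0 rmorph0 mul0r.
  have b0 : b != 0.
    by apply/eqP => b0; apply: Pb; rewrite b0; have [] := specP (val P).
  rewrite fE frac_inv_div (valuationE Sfact) ?sq_inv_neq0 //.
  rewrite [mult h (inv b)](mult_eq0 Sfact) ?sq_inv_neq0 ?subr0 // => hb.
  by apply: Pb; apply/hP.2.
have [a [b [a0 b0 fE]]] := fracP0 f0.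
have ia0 := sq_inv_neq0 Q a0; have ib0 := sq_inv_neq0 Q b0.
rewrite fE frac_inv_div (valuationE Sfact) // subr_ge0 => le_ba.
(* [nu E] has the order of b above P; m has the weight of [nu E] and no zero at h, so k, the
   quotient of m by [nu E], is invariant. *)
pose E : weil_divisor A := << (mult h (inv b))%:Z *g P >>%R.
have [m mP hm] := semi_invariant_not_divisible Q (psi E) hp.2.
have m0 : m != 0 by apply/eqP => m0; apply: hm; rewrite m0; exact: divides0.
pose k := m%:F / nu E.
have k0 : k != 0 by rewrite mulf_neq0 ?invr_eq0 ?nu_neq0 ?tofrac_eq0.
have kG : semi_invariant aL 0 k.
  rewrite /k -nuN -[0](subrr (psi E)) -raddfN.
  by apply: semi_invariantM; [apply/semi_invariant_tofrac | exact: semi_invariant_nu].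
have inv_semi d : semi_invariant aL 0 (inv d)%:F.
  by apply/semi_invariant_tofrac/semi_invariant_invariant => x; exact: act_sq_inv.
have kd d : d != 0 -> (mult h (inv b) <= mult h (inv d))%N ->
    exists2 e, e != 0 & k * (inv d)%:F = (inv e)%:F.
  move=> d0 le_bd; have id0 := sq_inv_neq0 Q d0.
  have kd0 : k * (inv d)%:F != 0 by rewrite mulf_neq0 ?tofrac_eq0.
  have kdG : semi_invariant aL 0 (k * (inv d)%:F).
    by rewrite -[0]addr0; apply: semi_invariantM.
  apply: valuation_ge0_invariant => // p pp.
  have [P' pP'] := exists_divisor_below Q pp.
  rewrite !vM ?invr_eq0 ?nu_neq0 ?tofrac_eq0 // (valuationV Sfact) ?nu_neq0 //.
  rewrite (valuation_nu _ pP') monalg.mcoeffU !(valuation_tofrac Sfact) //.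
  case: eqP => [PP'|_]; last by rewrite mulr0n; lia.
  have : v p (inv d)%:F = v h (inv d)%:F.
    by apply: (valuation_lies_over (P := P) _ hP _ (inv_semi d)); rewrite ?PP' ?tofrac_eq0.
  by rewrite !(valuation_tofrac Sfact) //= mulr1n; lia.
have [|a' a'0 a'E] := kd a a0; first by rewrite -lez_nat.
have [b' b'0 b'E] := kd b b0 (leqnn _).
exists a', b'; split; last first.
  apply: (fmorph_inj iL); rewrite !frac_inv_div -a'E -b'E.
  by rewrite -mulf_div divff // mul1r.
move/hP.2/(mult_gt0 Sfact hp (sq_inv_neq0 Q b'0)).
suff -> : mult h (inv b') = 0%N by [].
have := congr1 (v h) b'E; rewrite (valuation_tofrac Sfact) ?sq_inv_neq0 //.
rewrite !vM ?invr_eq0 ?nu_neq0 ?tofrac_eq0 // (valuationV Sfact) ?nu_neq0 //.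
rewrite (valuation_nu _ hP) monalg.mcoeffUU !(valuation_tofrac Sfact) //.
by rewrite (mult_eq0 Sfact hp m0 hm) add0r addNr => -[].
Qed.

Lemma is_ord_valuation h P : lies_over Q h P -> is_ord P (fun f => v h (iL f)).
Proof.
move=> hP; have hp := hP.1; split; last by move=> f; exact: local_ring_valuation.
split=> [f g f0 g0|f g f0 g0 fg0|k].
- by rewrite rmorphM vM ?fmorph_eq0.
- by rewrite rmorphD (valuation_min Sfact) ?fmorph_eq0 // -rmorphD fmorph_eq0.
have [f f0 f1] := exists_uniformizer hP; exists (f ^ k).
  by rewrite expfz_neq0.
by rewrite fmorphXz (valuationXz Sfact) ?fmorph_eq0 // f1 mul1r.
Qed.

(** The local ring only tells the sign of the value. So elements of value 0 are the same for both,
    and w' is a multiple of w, with factor [w' t] for a t of value 1 under w. This factor is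
    nonnegative, and 1 since w' is onto. *)
Lemma is_ord_uniq P (w w' : F -> int) (f : F) : is_ord P w -> is_ord P w' -> f != 0 ->
  w f = w' f.
Proof.
have wX (z : F -> int) (g : F) (k : int) : discrete_valuation z -> g != 0 ->
    z (g ^ k) = z g * k.
  move=> [zM _ _] g0.
  have z1 : z 1 = 0.
    by apply: (addrI (z 1)); rewrite -zM ?oner_eq0 // mulr1 addr0.
  have zV e : e != 0 -> z e^-1 = - z e.
    by move=> e0; apply: (addrI (z e)); rewrite -zM ?invr_eq0 // divff // z1 subrr.
  have zn (n : nat) : z (g ^+ n) = z g * n%:Z.
    elim: n => [|n IH]; first by rewrite expr0 z1 mulr0.
    by rewrite exprS zM ?expf_neq0 // IH intS mulrDr mulr1.
  case: k => n; first exact: zn.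
  by rewrite NegzE -exprnN zV ?expf_neq0 // zn mulrN.
move=> [wd wP] [wd' wP'] f0.
have ge0E g : g != 0 -> (0 <= w g) = (0 <= w' g).
  by move=> g0; apply/idP/idP; [move/(wP _ g0)/(wP' _ g0)|move/(wP' _ g0)/(wP _ g0)].
have eq0 g : g != 0 -> w g = 0 -> w' g = 0.
  move=> g0 wg0; apply/eqP; rewrite eq_le -ge0E // wg0 lexx andbT.
  have := wX w' g (-1) wd' g0; rewrite mulrN1 => E.
  by rewrite -oppr_ge0 -E -ge0E ?expfz_neq0 // wX // wg0 mul0r.
have [_ _ /(_ 1)[t t0 t1]] := wd; have [_ _ /(_ 1)[t' t'0 t'1]] := wd'.
have wE g : g != 0 -> w' g = w' t * w g.
  move=> g0; have tg0 : t ^ (- w g) != 0 by rewrite expfz_neq0.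
  have /eqP : w' (g * t ^ (- w g)) = 0.
    apply: eq0; first by rewrite mulf_neq0.
    by have [wM _ _] := wd; rewrite wM // wX // t1 mul1r subrr.
  by have [wM _ _] := wd'; rewrite wM // wX // mulrN subr_eq0 => /eqP.
have w't : w' t = 1.
  have := wE t' t'0; rewrite t'1 => /esym E.
  have : 0 <= w' t by rewrite -ge0E // t1.
  move: E; case: (w' t) => // n /(congr1 absz); rewrite abszM /= => /eqP.
  by rewrite muln_eq1 => /andP[/eqP->].
by rewrite wE // w't mul1r.
Qed.

Lemma ord_valuation h P (f : F) : lies_over Q h P -> f != 0 -> ord P f = v h (iL f).
Proof.
move=> hP f0; have wP := is_ord_valuation hP.
rewrite /ord; case: xgetP => [w _ w'P|/(_ _ wP)//].
exact: (is_ord_uniq w'P wP f0).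
Qed.

Lemma is_div_valuation E (f : F) : f != 0 ->
  (forall h P, lies_over Q h P -> v h (iL f) = dcoeff P E) -> is_div f E.
Proof.
move=> f0 fE; split=> // P; have [h hP] := exists_prime_above Q P.
by rewrite (ord_valuation hP f0) (fE h P hP).
Qed.

Lemma valuation_is_div h P E f : is_div f E -> lies_over Q h P -> v h (iL f) = dcoeff P E.
Proof. by move=> [f0 fE] hP; rewrite -(ord_valuation hP f0) fE. Qed.

Lemma is_div_nu E f : is_div f E -> exists2 c, c != 0 & iL f = frac_scal Q c * nu E.
Proof.
move=> fE; apply: valuation_eq_scal; rewrite ?nu_neq0 ?fmorph_eq0 //; first by case: fE.
move=> h hp; have [P hP] := exists_divisor_below Q hp.
by rewrite (valuation_is_div fE hP) (valuation_nu _ hP).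
Qed.

Lemma semi_invariant_frac_scal c : semi_invariant aL 0 (frac_scal Q c).
Proof. by apply/semi_invariant_invariant => x; exact: (act_scal aL). Qed.

(** Any equation of E in Frac A agrees with [nu E] up to a constant, of trivial weight; conversely
    an invariant [nu E] comes itself from Frac A. *)
Lemma principal_character E : E \in @principal A <-> psi E = 0.
Proof.
split=> [/asboolP[f fE]|E0].
  have [c c0 fnu] := is_div_nu fE.
  apply: (semi_invariant_uniq (nu_neq0 E)) (semi_invariant_nu E) _.
  have -> : nu E = frac_scal Q c^-1 * iL f.
    by rewrite fnu mulrA -rmorphM mulVf // rmorph1 mul1r.
  rewrite -[0]addr0; apply: semi_invariantM; first exact: semi_invariant_frac_scal.
  by apply/frac_inv_im; exists f.
have := semi_invariant_nu E; rewrite E0 => /frac_inv_im[f fE].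
apply/asboolP; exists f; apply: is_div_valuation.
  by rewrite -(fmorph_eq0 iL) -fE nu_neq0.
by move=> h P hP; rewrite -fE (valuation_nu _ hP).
Qed.

Lemma divisor_class_eq0 E : (divisor_class E = 0) <-> psi E = 0.
Proof.
rewrite -principal_character.
have -> : (E \in @principal A) = (divisor_class E == divisor_class 0).
  by rewrite -{1}[E]subr0 Quotient.idealrBE.
by rewrite raddf0; split=> [->|/eqP].
Qed.

Lemma divisor_character_surjective chi : exists E, psi E = chi.
Proof.
(* Not divisible by 0 means nonzero: modulo the zero ideal one gets a nonzero semi-invariant m of
   weight chi, whose divisor descends to the E sought. *)
have z0 : generates_prime (0 : S).
  split; first by rewrite unitr0.
  move=> s t [u]; rewrite mulr0 => /eqP; rewrite mulf_eq0.
  by case/orP => /eqP ->; [left|right]; exact: divides0.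
have [m mP m0] := semi_invariant_not_divisible Q chi z0.
have {}m0 : m != 0 by apply/eqP => m0'; apply: m0; rewrite m0'; exact: divides0.
have mL0 : m%:F != 0 by rewrite tofrac_eq0.
have mLP : semi_invariant aL chi m%:F by apply/semi_invariant_tofrac.
have [above aboveP] := choice (exists_prime_above Q).
have [u [r [Uu rP mE]]] := Sfact m0.
have [ds dsP] : exists ds : seq (prime_divisor A),
    {in r, forall h, exists2 P, P \in ds & lies_over Q h P}.
  elim: r rP {mE} => [|h r IH] rP; first by exists [::].
  have [|ds dsP] := IH; first by move=> p pr; apply: rP; rewrite inE pr orbT.
  have [P hP] := exists_divisor_below Q (rP h (mem_head _ _)).
  exists (P :: ds) => p; rewrite inE => /predU1P[->|/dsP[P' P'ds pP']].
    by exists P; rewrite ?mem_head.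
  by exists P'; rewrite // inE P'ds orbT.
(* The choice of [above P] does not matter, as m has the same valuation at all primes above P;
   [undup] makes each P count once. *)
pose E : weil_divisor A :=
  \sum_(P <- undup ds) << v (above P) m%:F *g P >>%R.
have EE P : dcoeff P E = if P \in ds then v (above P) m%:F else 0.
  have -> : dcoeff P E = \sum_(P' <- undup ds | P' == P) v (above P) m%:F.
    rewrite /E raddf_sum [RHS]big_mkcond; apply: eq_bigr => P' _ /=.
    by rewrite monalg.mcoeffU; case: eqP => [->|_]; rewrite ?mulr1n ?mulr0n.
  rewrite -mem_undup; case: ifPn => [Pds|Pds].
    by rewrite -big_filter filter_pred1_uniq ?undup_uniq // big_seq1.
  rewrite big_seq_cond big_pred0 // => P'; apply: contraNF Pds.
  by case/andP => P'ds /eqP<-.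
exists E; have [c c0 nuE] : exists2 c, c != 0 & nu E = frac_scal Q c * m%:F.
  apply: valuation_eq_scal; rewrite ?nu_neq0 // => h hp.
  have [P hP] := exists_divisor_below Q hp.
  rewrite (valuation_nu _ hP) EE; case: ifPn => [_|Pds].
    exact: (valuation_lies_over (aboveP P) hP mL0 mLP).
  rewrite (valuation_tofrac Sfact) // (mult_eq0 Sfact) //.
  rewrite mE => /(prime_divides_unitM hp.2 Uu)/(prime_divides_prod hp.2)[q qr hq].
  have [P' P'ds qP'] := dsP q qr.
  have [w Uw qE] := prime_divides_prime (rP q qr) (prime_nunit hp) hq.
  have hP' : lies_over Q h P' by apply: (lies_over_unit Uw) => //; rewrite -qE.
  by move: Pds; rewrite (lies_over_inj hP hP') P'ds.
apply: (semi_invariant_uniq (nu_neq0 E) (semi_invariant_nu E)).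
rewrite nuE -[chi]add0r; apply: semi_invariantM => //.
exact: semi_invariant_frac_scal.
Qed.

Definition class_character (k : class_group A) : X :=
  psi (generic_quotient.repr k : weil_divisor A).

Lemma class_character_class E : class_character (divisor_class E) = psi E.
Proof.
apply/eqP; rewrite -subr_eq0 -raddfB; apply/eqP/divisor_class_eq0.
by rewrite raddfB /= /divisor_class reprK subrr.
Qed.

Lemma divisor_class_surjective (k : class_group A) : exists E, k = divisor_class E.
Proof. by exists (generic_quotient.repr k); rewrite /divisor_class reprK. Qed.

Lemma class_character_is_zmod_morphism : zmod_morphism class_character.
Proof.
move=> k k'; have [E ->] := divisor_class_surjective k.
have [E' ->] := divisor_class_surjective k'.
by rewrite -raddfB !class_character_class raddfB.
Qed.
HB.instance Definition _ :=
  GRing.isZmodMorphism.Build (class_group A) X class_character class_character_is_zmod_morphism.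

Lemma class_character_bij : bijective class_character.
Proof.
have inj : injective class_character.
  move=> k k'; have [E ->] := divisor_class_surjective k.
  have [E' ->] := divisor_class_surjective k'.
  rewrite !class_character_class => EE'; apply/eqP; rewrite -subr_eq0 -raddfB; apply/eqP.
  by apply/divisor_class_eq0; rewrite raddfB /= EE' subrr.
have [E EP] := choice divisor_character_surjective.
exists (fun chi => divisor_class (E chi)) => [k|chi]; last by rewrite class_character_class.
by apply: inj; rewrite class_character_class.
Qed.

End ClassGroup.

(** * The Cox ring as a ring of semi-invariants *)

Section HomExtension.
Context (C : numClosedFieldType) (M : zmodType).
Implicit Types (N : set M) (c : M -> C) (d z : M) (i j : int).

Definition subgroup N : Prop := N 0 /\ forall z z', N z -> N z' -> N (z - z').

Definition hom_on N c : Prop :=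
  (forall z, N z -> c z != 0) /\ (forall z z', N z -> N z' -> c (z + z') = c z * c z').

Lemma subgroupN N z : subgroup N -> N z -> N (- z).
Proof. by move=> [N0 NB] Nz; rewrite -sub0r; exact: NB. Qed.

Lemma subgroupD N z z' : subgroup N -> N z -> N z' -> N (z + z').
Proof. by move=> NS Nz /(subgroupN NS) Nz'; rewrite -[z']opprK; exact: NS.2. Qed.

Lemma subgroupMz N z j : subgroup N -> N z -> N (z *~ j).
Proof.
move=> NS Nz; have NM (n : nat) : N (z *+ n).
  by elim: n => [|n IH]; [exact: NS.1 | rewrite mulrS; exact: subgroupD].
by case: j => n; [exact: NM | apply: subgroupN NS _; exact: NM].
Qed.

Lemma hom_on0 N c : subgroup N -> hom_on N c -> c 0 = 1.
Proof.
move=> [N0 _] [c0 cM]; apply: (mulfI (c0 0 N0)).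
by rewrite -cM // addr0 mulr1.
Qed.

Lemma hom_onMz N c z j : subgroup N -> hom_on N c -> N z -> c (z *~ j) = c z ^ j.
Proof.
move=> NS ch Nz; have [c0 cM] := ch.
have cX (n : nat) : c (z *+ n) = c z ^+ n.
  elim: n => [|n IH]; first by rewrite mulr0n (hom_on0 NS ch).
  by rewrite mulrS cM ?IH ?exprS //; exact: (subgroupMz n NS Nz).
case: j => n; first exact: cX.
rewrite NegzE mulrNz -exprnN.
have Nzn : N (z *~ n.+1) by exact: subgroupMz.
apply: (mulfI (c0 _ Nzn)); rewrite -cM //; last exact: subgroupN.
by rewrite subrr (hom_on0 NS ch) -[z *~ _]/(z *+ _) cX divff // expf_neq0 // c0.
Qed.

(* This is where the divisibility of the multiplicative group of C enters. *)
Lemma hom_on_root N c d : subgroup N -> hom_on N c ->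
  exists2 w : C, w != 0 & forall j, N (d *~ j) -> c (d *~ j) = w ^ j.
Proof.
move=> NS ch.
(* If no positive multiple of d lies in N, only j = 0 has to be checked and w = 1 will do. *)
have [ex|no] := pselect (exists k : nat, `[< (0 < k)%N /\ N (d *+ k) >]); last first.
  exists 1; rewrite ?oner_eq0 // => j Nj; rewrite exp1rz.
  have [->|j0] := eqVneq j 0; first by rewrite mulr0z (hom_on0 NS ch).
  case: no; exists `|j|%N; apply/asboolP; split; first by rewrite absz_gt0.
  case: j Nj j0 => n // Nj _; rewrite NegzE mulrNz in Nj.
  by have := subgroupN NS Nj; rewrite opprK.
have [k /asboolP[k0 Nk] kmin] := ex_minnP ex.
have ck0 : c (d *+ k) != 0 by exact: ch.1.
(* By minimality of k and division with remainder, every j with [d *~ j] in N is a multiple of k. *)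
pose w := k.-root (c (d *+ k)); exists w; first by rewrite rootC_eq0.
move=> j Nj; have jE := divz_eq j k.
have Nq : N (d *~ ((j %/ k)%Z * k)).
  by rewrite mulrC mulrzA; exact: (subgroupMz _ NS Nk).
have Nr : N (d *~ (j %% k)%Z).
  have -> : (j %% k)%Z = j - (j %/ k)%Z * k by rewrite {2}jE addrC addKr.
  by rewrite mulrzBr; exact: NS.2.
have r0 : (j %% k)%Z = 0.
  have r_ge0 : 0 <= (j %% k)%Z by rewrite modz_ge0 // -lt0n.
  have r_lt : (j %% k)%Z < k by rewrite ltz_pmod.
  case: (j %% k)%Z r_ge0 r_lt Nr => // r _ r_lt Nr.
  have [->//|r0] := posnP r.
  have rP : `[< (0 < r)%N /\ N (d *+ r) >] by apply/asboolP.
  by have := kmin r rP; rewrite leqNgt -ltz_nat r_lt.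
have wk : w ^ k = c (d *~ k) by exact: rootCK.
by rewrite jE r0 addr0 mulrC mulrzA -exprz_exp wk (hom_onMz _ NS ch).
Qed.

(** The larger subgroup is N + Z d, and w is the value of the extension at d. [J] picks some
    multiple of d to subtract; the property of w makes the result independent of this choice. *)
Lemma hom_on_extend1 N c d : subgroup N -> hom_on N c ->
  exists N' c', [/\ subgroup N', hom_on N' c', N' d &
    forall z, N z -> N' z /\ c' z = c z].
Proof.
move=> NS ch; have [w w0 wE] := hom_on_root d NS ch.
pose N' : set M := fun z => exists j, N (z - d *~ j).
have NN' z : N z -> N (z - d *~ 0) by rewrite mulr0z subr0.
pose J z : int := xget 0 [set j | N (z - d *~ j)].
have JP z : N' z -> N (z - d *~ J z).
  by move=> [j Nj]; rewrite /J; case: xgetP => [i _ //|/(_ j)].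
pose c' z := c (z - d *~ J z) * w ^ J z.
have c'E z j : N (z - d *~ j) -> c' z = c (z - d *~ j) * w ^ j.
  move=> Nj; have NJ : N (z - d *~ J z) by apply: JP; exists j.
  have Nd : N (d *~ (j - J z)).
    rewrite mulrzBr (_ : _ - _ = (z - d *~ J z) - (z - d *~ j)); first exact: NS.2.
    by rewrite opprB [RHS]addrC subrKA.
  rewrite /c' (_ : z - d *~ J z = (z - d *~ j) + d *~ (j - J z)); last first.
    by rewrite mulrzBr subrKA.
  rewrite ch.2 // wE // -mulrA -expfzDr //.
  by rewrite subrK.
exists N', c'; split.
- split; first by exists 0; apply: NN'; exact: NS.1.
  move=> z z' [j Nj] [j' Nj']; exists (j - j').
  rewrite mulrzBr (_ : _ - _ = (z - d *~ j) - (z' - d *~ j')); first exact: NS.2.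
  by rewrite !opprB addrACA [RHS]addrACA; congr (_ + _); rewrite addrC.
- split=> [z Nz|z z' Nz Nz'].
    by rewrite /c' mulf_neq0 ?expfz_neq0 // ch.1 //; exact: JP.
  have NJ := JP z Nz; have NJ' := JP z' Nz'.
  have E : z + z' - d *~ (J z + J z') = (z - d *~ J z) + (z' - d *~ J z').
    by rewrite mulrzDr opprD addrACA.
  rewrite (@c'E _ (J z + J z')) E; last exact: subgroupD.
  by rewrite ch.2 // expfzDr // mulrACA.
- by exists 1; rewrite mulr1z subrr; exact: NS.1.
move=> z Nz; split; first by exists 0; exact: NN'.
by rewrite (c'E z 0 (NN' z Nz)) mulr0z subr0 expr0z mulr1.
Qed.

(** Adjoining the generators of K one by one is enough, K being finitely generated. *)
Lemma hom_on_extend N c (gens : seq M) : subgroup N -> hom_on N c ->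
  exists N' c', [/\ subgroup N', hom_on N' c', {in gens, forall d, N' d} &
    forall z, N z -> N' z /\ c' z = c z].
Proof.
move=> NS ch; elim: gens => [|d gens [N1 [c1 [NS1 ch1 gens1 E1]]]].
  by exists N, c; split.
have [N2 [c2 [NS2 ch2 d2 E2]]] := hom_on_extend1 d NS1 ch1.
exists N2, c2; split=> // [e|z Nz].
  by rewrite inE => /predU1P[->//|/gens1/E2[]].
by have [N1z <-] := E1 z Nz; exact: E2.
Qed.

End HomExtension.

(** * Evaluation of graded sections in the fraction field of S *)

Section CoxEvaluation.
Context (C : numClosedFieldType) (gT : finGroupType) (S A : idomainType).
Context (Q : small_quotient C gT S A).
Local Notation X := (char_group (abelianization gT) C).
Local Notation L := {fraction S}.
Local Notation F := {fraction A}.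
Local Notation WDiv := (weil_divisor A).
Local Notation GR := (Defs.group_ring WDiv F).
Local Notation Sfact := (sq_factorial Q).
Local Notation aL := (frac_action Q).
Local Notation iL := (frac_inv Q).
Local Notation v := valuation.
Local Notation vM := (valuationM Sfact).
Local Notation dcoeff := monalg.mcoeff.
Local Notation gsupp := monalg.msupp.
Local Notation psi := (divisor_character Q).
Implicit Types (chi : X) (x y : spec A) (h : S) (l : L) (c : C).
Implicit Types (P : prime_divisor A) (E : WDiv) (f : F) (U : set (spec A)).

Lemma zspan_mem (gens : seq WDiv) E : E \in gens -> zspan gens E.
Proof.
move=> Egens; pose i : 'I_(size gens) := Ordinal (etrans (index_mem _ _) Egens).
exists (fun j => (j == i)%:R); rewrite (bigD1 i) //= eqxx mulr1z nth_index // big1 ?addr0 //.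
by move=> j /negPf->; rewrite mulr0z.
Qed.

Lemma zspan_sub (gens : seq WDiv) N : subgroup N -> {in gens, forall E, N E} ->
  (zspan gens `<=` N)%classic.
Proof.
move=> NS gensN E [a ->]; elim/big_ind: _ => [|z z'|i _]; first by case: NS.
  exact: subgroupD.
by apply: subgroupMz => //; apply: gensN; exact: mem_nth.
Qed.

(** One divisor for each of the finitely many characters spans a group mapping onto the class group.
    For principal E the equation [nu E] descends to Frac A, and being multiplicative in E it
    provides the character on the kernel. *)
Lemma cox_datum_exists : inhabited (cox_datum A).
Proof.
have [chis [_ chisP]] := char_group_finite C (abelianization gT).
have [E EP] := choice (divisor_character_surjective Q).
have /choice[f fP] : forall E, exists f, divisor_class E = 0 -> iL f = nu Q E.
  move=> E'.
  have [/(divisor_class_eq0 Q) E0|nE] := pselect (divisor_class E' = 0).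
    have := semi_invariant_nu Q E'; rewrite E0 => /frac_inv_im[f ->].
    by exists f.
  by exists 0 => /nE.
constructor; apply: (@CoxDatum A [seq E chi | chi <- chis] f).
- move=> k; have [E' ->] := divisor_class_surjective k.
  exists (E (psi E')); first by apply/zspan_mem/map_f.
  by apply/eqP; rewrite -subr_eq0 -raddfB; apply/eqP/(divisor_class_eq0 Q); rewrite raddfB /= EP subrr.
- move=> E1 E2 [_ E10] [_ E20]; apply: (fmorph_inj iL).
  have E120 : divisor_class (E1 + E2) = 0 by rewrite raddfD /= [divisor_class E1]E10 [divisor_class E2]E20 addr0.
  by rewrite rmorphM !fP ?nuD.
- move=> E1 [_ E10]; have fE := fP E1 E10.
  have f0 : f E1 != 0 by rewrite -(fmorph_eq0 iL) fE nu_neq0.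
  by apply: (is_div_valuation (Q := Q)) => // h P hP; rewrite fE (valuation_nu _ hP).
Qed.

Context (cd : cox_datum A).
Local Notation K := (cox_K cd).
Local Notation K0 := (cox_K0 cd).

Lemma exists_twist : exists kappa : WDiv -> L,
  [/\ forall E E', K E -> K E' -> kappa (E + E') = kappa E * kappa E',
      forall E, K0 E -> kappa E = iL (cox_chi cd E)
    & forall E, K E -> exists2 c, c != 0 & kappa E = frac_scal Q c * nu Q E].
Proof.
have /choice[c cE] : forall E, exists c, K0 E ->
    c != 0 /\ iL (cox_chi cd E) = frac_scal Q c * nu Q E.
  move=> E.
  have [K0E|nK0E] := pselect (K0 E); last by exists 0 => /nK0E.
  by have [c c0 cE] := is_div_nu Q (cox_chi_div K0E); exists c.
have K0S : subgroup K0 by split; [exact: cox_K00 | move=> E E'; exact: cox_K0B].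
have ch : hom_on K0 c.
  split=> [E /cE[]//|E E' KE KE'].
  have KEE' : K0 (E + E') by exact: subgroupD.
  apply: (fmorph_inj (frac_scal Q)); apply: (mulIf (nu_neq0 Q (E + E'))).
  rewrite -(cE _ KEE').2 cox_chiD // rmorphM (cE _ KE).2 (cE _ KE').2 nuD.
  by rewrite [frac_scal Q (_ * _)]rmorphM mulrACA.
have [N' [c' [NS' ch' gens' E']]] := hom_on_extend (cox_gens cd) K0S ch.
have KN' : (K `<=` N')%classic by exact: zspan_sub.
exists (fun E => frac_scal Q (c' E) * nu Q E); split.
- move=> E1 E2 /KN' N1 /KN' N2; rewrite ch'.2 // rmorphM nuD.
  by rewrite mulrACA.
- by move=> E KE; rewrite (cE E KE).2 (E' E KE).2.
- by move=> E /KN' NE; exists (c' E); rewrite // ch'.1.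
Qed.

Definition twist : WDiv -> L := sval (cid exists_twist).

Lemma twistP : [/\ forall E E', K E -> K E' -> twist (E + E') = twist E * twist E',
      forall E, K0 E -> twist E = iL (cox_chi cd E)
    & forall E, K E -> exists2 c, c != 0 & twist E = frac_scal Q c * nu Q E].
Proof. exact: svalP (cid exists_twist). Qed.

Lemma twistD E E' : K E -> K E' -> twist (E + E') = twist E * twist E'.
Proof. by have [twD _ _] := twistP; exact: twD. Qed.

Lemma twist_chi E : K0 E -> twist E = iL (cox_chi cd E).
Proof. by have [_ twE _] := twistP; exact: twE. Qed.

Lemma twist_neq0 E : K E -> twist E != 0.
Proof.
have [_ _ twE] := twistP; move=> /twE[c c0 ->].
by rewrite mulf_neq0 ?nu_neq0 // frac_scal_neq0.
Qed.

Lemma twist0 : twist 0 = 1.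
Proof.
have K0 : K 0 by exact: zspan0.
by apply: (mulfI (twist_neq0 K0)); rewrite -twistD // addr0 mulr1.
Qed.

Lemma twistN E : K E -> twist (- E) = (twist E)^-1.
Proof.
move=> KE; apply: (mulfI (twist_neq0 KE)).
by rewrite -twistD ?subrr ?twist0 ?mulfV ?twist_neq0 //; exact: zspanN.
Qed.

Lemma semi_invariant_twist E : K E -> semi_invariant aL (psi E) (twist E).
Proof.
have [_ _ twE] := twistP; move=> /twE[c _ ->]; rewrite -[psi E]add0r.
by apply: semi_invariantM; [exact: semi_invariant_frac_scal | exact: semi_invariant_nu].
Qed.

Lemma valuation_twist h P E : lies_over Q h P -> K E -> v h (twist E) = dcoeff P E.
Proof.
move=> hP; have hp := hP.1; have [_ _ twE] := twistP; move=> /twE[c c0 ->].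
by rewrite vM ?nu_neq0 ?frac_scal_neq0 // valuation_scal // add0r (valuation_nu _ hP).
Qed.

Implicit Types (s t : GR).

Definition ev s : L := \sum_(E <- gsupp s) iL (gr_coeff E s) * twist E.

Lemma evE s : ev s = \sum_(E <- gsupp s) iL (gr_coeff E s) * twist E.
Proof. by []. Qed.

Lemma evw (d : {fset WDiv}) s : (gsupp s `<=` d)%fset ->
  ev s = \sum_(E <- d) iL (gr_coeff E s) * twist E.
Proof.
move=> sd; rewrite /ev (big_fset_incl _ sd) //= => E _ /monalg.mcoeff_outdom sE0.
by rewrite /gr_coeff sE0 rmorph0 mul0r.
Qed.

Lemma ev_is_zmod_morphism : zmod_morphism ev.
Proof.
move=> s t; pose d := (gsupp s `|` gsupp t `|` gsupp (s - t))%fset.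
rewrite (@evw d s) ?(@evw d t) ?(@evw d (s - t)) ?fsubsetUr //; last first.
- by rewrite /d -fsetUA fsubsetUl.
- by rewrite /d [X in (X `|` _)%fset]fsetUC -fsetUA fsubsetUl.
by rewrite -sumrB; apply: eq_bigr => E _; rewrite gr_coeffB rmorphB mulrBl.
Qed.
HB.instance Definition _ := GRing.isZmodMorphism.Build GR L ev ev_is_zmod_morphism.

Lemma evB s t : ev (s - t) = ev s - ev t.
Proof. exact: ev_is_zmod_morphism. Qed.

Lemma ev_sum (I : Type) (r : seq I) (g : I -> GR) :
  ev (\sum_(i <- r) g i) = \sum_(i <- r) ev (g i).
Proof. exact: (raddf_sum ev). Qed.

Lemma ev_single E f : ev (gr_single E f) = iL f * twist E.
Proof.
by rewrite (@evw [fset E]%fset) ?monalg.msuppU_le // big_seq_fset1 gr_coeff_single eqxx.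
Qed.

Lemma ev1 : ev 1 = 1.
Proof. by rewrite -gr_single1 ev_single twist0 rmorph1 mulr1. Qed.

(** [twist] is known to be multiplicative on K, so products are evaluated on elements supported
    there. *)
Definition K_supported s : Prop := forall E, gr_coeff E s != 0 -> K E.

Lemma mem_gsupp E s : (E \in gsupp s) = (gr_coeff E s != 0).
Proof. by rewrite -monalg.mcoeff_neq0. Qed.

Lemma evM s t : K_supported s -> K_supported t -> ev (s * t) = ev s * ev t.
Proof.
move=> Ks Kt; rewrite {1}[s]gr_sum_single {1}[t]gr_sum_single mulr_suml raddf_sum.
rewrite {2}/ev mulr_suml; apply: eq_big_seq => E; rewrite mem_gsupp => /Ks KE /=.
rewrite mulr_sumr raddf_sum mulr_sumr; apply: eq_big_seq => E'.
rewrite mem_gsupp => /Kt KE' /=.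
by rewrite gr_singleM ev_single rmorphM twistD // mulrACA.
Qed.

Lemma graded_section_K U s : graded_section cd U s -> K_supported s.
Proof. by move=> Us E /Us[]. Qed.

Lemma cox_relation_K E : K E -> K_supported (cox_relation cd E).
Proof.
(* Over the empty set the conditions on orders are void, and only the support in K remains. *)
move=> KE; apply: (@graded_section_K set0); apply: graded_sectionB.
  exact: graded_section1.
by apply: graded_section_single; [exact: zspanN | move=> _ P []].
Qed.

Lemma ev_relation E : K0 E -> ev (cox_relation cd E) = 0.
Proof.
move=> K0E; have KE : K E := K0E.1.
rewrite /cox_relation evB [X in X - _]ev1 [X in _ - X]ev_single -(twist_chi K0E) (twistN KE).
by rewrite (mulfV (twist_neq0 KE)) subrr.
Qed.

Lemma ev_relation_ideal U t : relation_ideal cd U t -> ev t = 0.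
Proof.
move=> [r rP ->]; rewrite ev_sum big_seq.
apply: big1 => k /rP[Uk K0k].
have Kk := graded_section_K Uk; have Kr := cox_relation_K K0k.1.
by rewrite (evM Kk Kr) (ev_relation K0k) mulr0.
Qed.

(** Moves a homogeneous element from degree E to degree E - E' at the cost of a multiple of the
    relation of E'. *)
Lemma single_move E E' f : gr_single E f =
  gr_single E f * cox_relation cd E' + gr_single (E - E') (f * cox_chi cd E').
Proof.
by rewrite /cox_relation mulrBr [X in X - _ + _]mulr1 [X in _ - X + _]gr_singleM subrK.
Qed.

Lemma relation_ideal_section U t : relation_ideal cd U t -> graded_section cd U t.
Proof.
move=> [r rP ->]; rewrite big_seq; elim/big_ind: _ => [|s s' Us Us'|k /rP[Uk KE]].
- exact: graded_section0.
- exact: graded_sectionD.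
apply: graded_sectionM; first exact: Uk.
apply: graded_sectionB; first exact: graded_section1.
apply: graded_section_single; first exact: zspanN KE.1.
by have [_ divE] := cox_chi_div KE; move=> _ P _; rewrite monalg.mcoeffN -divE subrr.
Qed.

Lemma exists_class_repr : exists rep : X -> WDiv, forall chi, K (rep chi) /\ psi (rep chi) = chi.
Proof.
suff /choice[rep repP] : forall chi, exists E, K E /\ psi E = chi by exists rep.
move=> chi; have [E <-] := divisor_character_surjective Q chi.
have [E' KE' EE'] := cox_onto cd (divisor_class E); exists E'; split=> //.
by rewrite -!class_character_class EE'.
Qed.

(* Modulo the relations, every homogeneous component can be moved to the chosen
   representative of its class. *)
Lemma ev0_relation_ideal U t : graded_section cd U t -> ev t = 0 -> relation_ideal cd U t.
Proof.
move=> Ut evt0; have [rep repP] := exists_class_repr.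
pose d E := E - rep (psi E).
have K0d E : K E -> K0 (d E).
  move=> KE; split; first by apply: zspanB => //; have [] := repP (psi E).
  apply/(divisor_class_eq0 Q); rewrite raddfB /=; have [_ ->] := repP (psi E).
  exact: subrr.
pose a E : F := gr_coeff E t * cox_chi cd (d E).
pose r : GR := \sum_(E <- gsupp t) gr_single (rep (psi E)) (a E).
have tE : t = \sum_(E <- gsupp t) gr_single E (gr_coeff E t) * cox_relation cd (d E) + r.
  rewrite {1}[t]gr_sum_single -big_split /=; apply: eq_bigr => E _.
  rewrite {1}(single_move E (d E)) /d subKr //.
(* A coefficient of r, times the twist of its degree, is the part of [ev t] of one weight, because
   distinct representatives have distinct weights. These parts vanish with [ev t]. *)
have r0 : r = 0.
  apply/monalg.malgP => E'; rewrite monalg.mcoeff0 -/(gr_coeff E' r).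
  apply: (fmorph_inj iL); rewrite rmorph0 /r !raddf_sum /=.
  have twrep chi : twist (rep chi) != 0 by apply: twist_neq0; have [] := repP chi.
  have -> : \sum_(E <- gsupp t) iL (gr_coeff E' (gr_single (rep (psi E)) (a E))) =
      (\sum_(E <- gsupp t | rep (psi E) == E') iL (gr_coeff E t) * twist E) / twist E'.
    rewrite mulr_suml [RHS]big_mkcond; apply: eq_big_seq => E.
    rewrite mem_gsupp => /Ut[KE _]; rewrite gr_coeff_single.
    case: eqP => [E'E|_]; last by rewrite rmorph0.
    have [Krep _] := repP (psi E).
    rewrite /a rmorphM -twist_chi; last exact: K0d.
    have twE : twist E = twist (d E) * twist (rep (psi E)).
      rewrite -twistD //; first by rewrite /d subrK.
      exact: (K0d _ KE).1.
    by rewrite twE mulrA -E'E mulfK.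
  have [E'E|nE'] := eqVneq E' (rep (psi E')); last first.
    rewrite big_pred0 ?mul0r // => E; apply/eqP => EE'; case/eqP: nE'.
    by rewrite -EE'; have [_ ->] := repP (psi E).
  (* The terms are set to 0 outside K, since [semi_invariant_indep] asks for a semi-invariant at
     every index. *)
  pose G E : L := if `[< K E >] then iL (gr_coeff E t) * twist E else 0.
  have GE (p : pred WDiv) : \sum_(E <- gsupp t | p E) iL (gr_coeff E t) * twist E =
      \sum_(E <- gsupp t | p E) G E.
    rewrite big_seq_cond [RHS]big_seq_cond; apply: eq_bigr => E /andP[].
    by rewrite mem_gsupp /G => /Ut[KE _] _; rewrite asboolT.
  rewrite GE (eq_bigl (fun E => psi E == psi E')) => [|E].
    rewrite (@semi_invariant_indep _ _ _ aL _ _ psi) ?mul0r //.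
      move=> E; rewrite /G; case: asboolP => [KE|_]; last exact: semi_invariant0.
      rewrite -[psi E]add0r; apply: semi_invariantM; last exact: semi_invariant_twist.
      by apply/frac_inv_im; exists (gr_coeff E t).
    by rewrite -(GE xpredT).
  apply/eqP/eqP => [EE'|->]; last by rewrite -E'E.
  by rewrite -EE'; have [_ ->] := repP (psi E).
exists [seq (gr_single E (gr_coeff E t), d E) | E <- gsupp t]; last first.
  by rewrite {1}tE r0 addr0 big_map.
move=> _ /mapP[E + ->]; rewrite mem_gsupp => /Ut[KE OE] /=; split; last exact: K0d.
exact: graded_section_single.
Qed.

(** As [ev] does not depend on U, membership in a stalk of the ideal sheaf can be tested by it. *)
Lemma relation_idealP U t : relation_ideal cd U t <-> graded_section cd U t /\ ev t = 0.
Proof.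
split=> [Ut|[Ut]]; last exact: ev0_relation_ideal.
by split; [exact: relation_ideal_section | exact: ev_relation_ideal Ut].
Qed.

End CoxEvaluation.

(** * From global sections to invariants of the derived subgroup *)

Section CoxIsomorphism.
Context (C : numClosedFieldType) (gT : finGroupType) (S A : idomainType).
Context (Q : small_quotient C gT S A) (cd : cox_datum A).
Local Notation D := (derived_subgroup gT).
Local Notation X := (char_group (abelianization gT) C).
Local Notation L := {fraction S}.
Local Notation F := {fraction A}.
Local Notation WDiv := (weil_divisor A).
Local Notation GR := (Defs.group_ring WDiv F).
Local Notation inv := (sq_inv Q).
Local Notation Sfact := (sq_factorial Q).
Local Notation aL := (frac_action Q).
Local Notation iL := (frac_inv Q).
Local Notation v := valuation.
Local Notation vM := (valuationM Sfact).
Local Notation psi := (divisor_character Q).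
Local Notation ev := (@ev C gT S A Q cd).
Local Notation twist := (twist Q cd).
Implicit Types (chi : X) (x y : spec A) (h : S) (l : L) (c : C).
Implicit Types (P : prime_divisor A) (E : WDiv) (f : F) (U : set (spec A)).
Implicit Types (t : GR) (s : global_sections cd).

Lemma generic_in_open U x : zariski_open U -> U x -> U (spec_generic A).
Proof.
move=> [B ->] [a Ba xa]; exists a => // /= a0; apply: xa; rewrite a0.
by have [] := specP x.
Qed.

Lemma global_section_germ s x : exists U t, [/\ zariski_open U, U x,
  graded_section cd U t & forall y, U y -> relation_ideal_stalk cd y (val s y - t)].
Proof.
by have /asboolP /(_ x) [U [oU Ux [t Ut st]]] := valP s; exists U, t.
Qed.

Lemma ev_stalk x t : relation_ideal_stalk cd x t -> ev t = 0.
Proof. by move=> [U [_ _ /(relation_idealP Q)[]]]. Qed.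

Definition section_value s : L := ev (val s (spec_generic A)).

(** Near x the family is a single section up to elements of the ideal, which [ev] kills, and every
    neighbourhood of x contains the generic point. *)
Lemma section_valueE s x : ev (val s x) = section_value s.
Proof.
have [U [t [oU Ux _ st]]] := global_section_germ s x.
have E y : U y -> ev (val s y) = ev t.
  by move=> /st/ev_stalk/eqP; rewrite raddfB subr_eq0 => /eqP.
by rewrite /section_value !E //; exact: generic_in_open oU Ux.
Qed.

(** The representative differs from a section by an element of the ideal, and such elements are
    themselves graded sections near x. *)
Lemma global_section_at s x : exists U, [/\ zariski_open U, U x & graded_section cd U (val s x)].
Proof.
have [U [t [oU Ux Ut st]]] := global_section_germ s x.
have [W [oW Wx Wst]] := relation_ideal_stalk_section (st x Ux).
exists (U `&` W)%classic; split=> //; first exact: zariski_openI.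
rewrite -[val s x](subrK t); apply: graded_sectionD.
  by apply: graded_sectionS Wst => y [].
by apply: graded_sectionS Ut => y [].
Qed.

Lemma global_section_K s x : K_supported cd (val s x).
Proof. by have [U [_ _ /graded_section_K]] := global_section_at s x. Qed.

Lemma section_value_is_zmod_morphism : zmod_morphism section_value.
Proof. by move=> s s'; rewrite /section_value -raddfB. Qed.

Lemma section_value_is_monoid_morphism : monoid_morphism section_value.
Proof.
split; first exact: ev1.
move=> s s'; rewrite /section_value [val (s * s')]rmorphM.
exact: (evM Q (@global_section_K s _) (@global_section_K s' _)).
Qed.

HB.instance Definition _ := GRing.isZmodMorphism.Build (global_sections cd) L
  section_value section_value_is_zmod_morphism.
HB.instance Definition _ := GRing.isMonoidMorphism.Build (global_sections cd) L
  section_value section_value_is_monoid_morphism.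

Lemma null_sectionE s : (s \in @null_section A cd) = (section_value s == 0).
Proof.
apply/asboolP/eqP => [/(_ (spec_generic A))/ev_stalk //|s0 x].
have [U [oU Ux Us]] := global_section_at s x.
exists U; split=> //; apply/(relation_idealP Q); split=> //.
by rewrite section_valueE.
Qed.

Definition cox_value (z : cox_ring cd) : L := section_value (generic_quotient.repr z).

Lemma cox_value_class s : cox_value (cox_class s) = section_value s.
Proof.
apply/eqP; rewrite /cox_value -subr_eq0 -raddfB -null_sectionE Quotient.idealrBE.
by rewrite /cox_class reprK.
Qed.

Lemma cox_class_surjective (z : cox_ring cd) : exists s, z = cox_class s.
Proof. by exists (generic_quotient.repr z); rewrite /cox_class reprK. Qed.

Lemma cox_value_is_zmod_morphism : zmod_morphism cox_value.
Proof.
move=> z w; have [s ->] := cox_class_surjective z; have [s' ->] := cox_class_surjective w.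
by rewrite -raddfB !cox_value_class raddfB.
Qed.

Lemma cox_value_is_monoid_morphism : monoid_morphism cox_value.
Proof.
split; first by rewrite -(rmorph1 (@cox_class A cd)) cox_value_class rmorph1.
move=> z w; have [s ->] := cox_class_surjective z; have [s' ->] := cox_class_surjective w.
by rewrite -rmorphM !cox_value_class rmorphM.
Qed.

HB.instance Definition _ := GRing.isZmodMorphism.Build (cox_ring cd) L
  cox_value cox_value_is_zmod_morphism.
HB.instance Definition _ := GRing.isMonoidMorphism.Build (cox_ring cd) L
  cox_value cox_value_is_monoid_morphism.

Lemma cox_value_inj : injective cox_value.
Proof.
move=> z w; have [s ->] := cox_class_surjective z; have [s' ->] := cox_class_surjective w.
rewrite !cox_value_class => /eqP; rewrite -subr_eq0 -raddfB -null_sectionE.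
by rewrite Quotient.idealrBE => /eqP.
Qed.

(** Every term of [ev t] is a semi-invariant of the whole group, hence fixed by its derived
    subgroup. *)
Lemma ev_coeff_invariant t (d : gT) : K_supported cd t -> d \in D ->
  act aL d (ev t) = ev t.
Proof.
move=> Kt dD; rewrite /ev rmorph_sum; apply: eq_big_seq => E; rewrite mem_gsupp => /Kt KE.
have cP : semi_invariant aL 0 (iL (gr_coeff E t)) by apply/frac_inv_im; exists (gr_coeff E t).
have := semi_invariantM cP (semi_invariant_twist Q KE).
by move/semi_invariant_derived; apply.
Qed.

Lemma valuation_sum_ge0 (I : eqType) (r : seq I) (g : I -> L) h : prime_elt h ->
  {in r, forall i, g i != 0 -> 0 <= v h (g i)} ->
  \sum_(i <- r) g i != 0 -> 0 <= v h (\sum_(i <- r) g i).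
Proof.
move=> hp; elim: r => [|i r IH] gP; first by rewrite big_nil eqxx.
have {}IH := IH (fun j jr => gP j (mem_behead (jr : j \in behead (i :: r)))).
rewrite big_cons; have [->|gi0] := eqVneq (g i) 0; first by rewrite add0r.
have [->|s0] := eqVneq (\sum_(j <- r) g j) 0.
  by rewrite addr0 => _; apply: gP; rewrite ?mem_head.
move=> sum0; apply: le_trans (valuation_min Sfact hp gi0 s0 sum0).
by rewrite le_min gP ?mem_head // IH.
Qed.

Lemma section_value_integral s : exists2 f : S,
  (forall d, d \in D -> act Q d f = f) & section_value s = f%:F.
Proof.
have sD d : d \in D -> act aL d (section_value s) = section_value s.
  by move=> dD; apply: ev_coeff_invariant => //; exact: global_section_K.
have [s0|s0] := eqVneq (section_value s) 0.
  by exists 0; rewrite ?rmorph0 // => d _; rewrite rmorph0.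
have [|f _ fE] := valuation_ge0_integral Sfact s0; last first.
  exists f => // d dD; apply/eqP; rewrite -tofrac_eq -frac_actE -fE; apply/eqP.
  exact: sD.
move=> h hp; have [P hP] := exists_divisor_below Q hp.
(* Poles along h are excluded by the germ at the generic point of P: its coefficients satisfy the
   order condition at P, which multiplication by the twist turns into nonnegative valuations at
   h. *)
have [U [oU UP Us]] := global_section_at s (val P).
rewrite -(section_valueE s (val P)) in s0 *.
apply: valuation_sum_ge0 => // E; rewrite mem_gsupp => /Us[KE OE] g0.
have cE0 : gr_coeff E (val s (val P)) != 0.
  by apply: contra_neq g0 => ->; rewrite rmorph0 mul0r.
rewrite vM ?fmorph_eq0 ?twist_neq0 // -(ord_valuation hP) //.
by rewrite (valuation_twist hP KE); exact: OE.
Qed.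

Lemma cox_value_integral z : exists2 f : S,
  (forall d, d \in D -> act Q d f = f) & cox_value z = f%:F.
Proof.
by have [s ->] := cox_class_surjective z; rewrite cox_value_class; exact: section_value_integral.
Qed.

Lemma cox_component_value (k : class_group A) z :
  cox_component k z -> semi_invariant aL (class_character Q k) (cox_value z).
Proof.
move=> [s [-> sk]]; rewrite cox_value_class /section_value.
rewrite evE big_seq; apply: semi_invariant_sum => E; rewrite mem_gsupp => sE.
have KE := global_section_K sE.
rewrite -(sk _ _ sE) class_character_class -[psi E]add0r.
apply: semi_invariantM; last exact: semi_invariant_twist.
by apply/frac_inv_im; exists (gr_coeff E (val s (spec_generic A))).
Qed.

Lemma constant_section t : graded_section cd setT t -> (fun=> t) \in @global_section A cd.
Proof.
move=> Tt; apply/asboolP => x; exists setT; split=> //; first exact: zariski_openT.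
by exists t => // y _; rewrite subrr; exact: relation_ideal_stalk0.
Qed.

(** Dividing f by the twist of a divisor E of class k gives an invariant function g. As f has no
    poles, g is a global section of O(E), and the constant family with g in degree E represents
    z. *)
Lemma semi_invariant_cox_value (k : class_group A) (f : S) :
  semi_invariant Q (class_character Q k) f ->
  exists2 z, cox_component k z & cox_value z = f%:F.
Proof.
move=> fP; have [E KE kE] := cox_onto cd k.
have psiE : psi E = class_character Q k by rewrite -kE class_character_class.
have [g gE] : exists g, f%:F / twist E = iL g.
  apply/frac_inv_im; rewrite -[0](subrr (psi E)) -twistN //.
  rewrite -[- psi E]raddfN; apply: semi_invariantM.
    by apply/semi_invariant_tofrac; rewrite psiE.
  by apply: semi_invariant_twist; exact: zspanN.
have tw0 := twist_neq0 Q KE.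
have Tg : graded_section cd setT (gr_single E g).
  apply: graded_section_single => // g0 P _.
  have [h hP] := exists_prime_above Q P; rewrite (ord_valuation hP g0).
  have f0 : f != 0.
    by apply: contra_neq g0 => f0; apply: (fmorph_inj iL); rewrite -gE f0 !rmorph0 mul0r.
  have hp := hP.1; rewrite -gE (vM hp) ?invr_eq0 ?tofrac_eq0 // (valuationV Sfact hp tw0).
  by rewrite (valuation_twist hP KE) subrK (valuation_tofrac Sfact).
pose s : global_sections cd := exist (fun r : spec A -> GR => r \in @global_section A cd) _ (constant_section Tg).
exists (cox_class s).
  exists s; split=> // x E' /=; rewrite gr_coeff_single.
  by case: (E =P E') => [<-|_]; rewrite ?eqxx.
by rewrite cox_value_class /section_value /= ev_single -gE divfK.
Qed.

Lemma cox_value_component (k : class_group A) z :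
  semi_invariant aL (class_character Q k) (cox_value z) -> cox_component k z.
Proof.
have [f _ fE] := cox_value_integral z; rewrite fE => /semi_invariant_tofrac fP.
have [w wk wE] := semi_invariant_cox_value fP.
by rewrite (_ : z = w) //; apply: cox_value_inj; rewrite fE.
Qed.

Lemma cox_value_surjective (f : S) : (forall d, d \in D -> act Q d f = f) ->
  exists z, cox_value z = f%:F.
Proof.
move=> /sum_of_semi_invariants[us usP ->].
elim: us usP => [|u us IH] usP; first by exists 0; rewrite big_nil !rmorph0.
have [|w wE] := IH; first by move=> u' u'us; apply: usP; rewrite inE u'us orbT.
have [chi uchi] := usP u (mem_head _ _).
have [clas clasK _] : exists2 g, cancel g (class_character Q) & True.
  by have [g _ gK] := class_character_bij Q; exists g.
rewrite -(clasK chi) in uchi.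
have [z _ zE] := semi_invariant_cox_value uchi.
exists (z + w); transitivity (cox_value z + cox_value w); first exact: rmorphD.
by rewrite zE wE big_cons tofracD.
Qed.

Lemma cox_value_scalar (a : A) : cox_value (cox_scalar cd a) = (inv a)%:F.
Proof.
by rewrite cox_value_class /section_value /= ev_single twist0 mulr1 frac_invE.
Qed.

End CoxIsomorphism.

(** * Small finite matrix groups *)

Lemma mpoly_rmorph_eq (C : comNzRingType) (n : nat) (T : nzRingType)
    (f g : {rmorphism {mpoly C[n]} -> T}) :
  (forall c, f c%:MP = g c%:MP) -> (forall i, f 'X_i = g 'X_i) -> f =1 g.
Proof.
move=> fgC fgX p; elim/mpolyind: p => [|c m p _ _ IH]; first by rewrite !rmorph0.
rewrite !rmorphD IH -mul_mpolyC !rmorphM fgC mpolyXE_id !rmorph_prod.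
congr (_ * _ + _); apply: eq_bigr => i _.
by rewrite !rmorphXn /= fgX.
Qed.

Section MatrixGroup.
Context (C : numClosedFieldType) (n : nat) (gT : finGroupType).
Context (rG : mx_representation C [set: gT] n).
Implicit Types (x y : gT) (p h w : {mpoly C[n]}) (i j : 'I_n).

Lemma mx_actX x i : mx_act rG x 'X_i = \sum_j rG x^-1%g i j *: 'X_j.
Proof.
by rewrite /mx_act comp_mpolyXU -tnth_nth tnth_mktuple.
Qed.

Lemma mx_actC x c : mx_act rG x c%:MP = c%:MP.
Proof. exact: comp_mpolyC. Qed.

Lemma mx_actZ x c p : mx_act rG x (c *: p) = c *: mx_act rG x p.
Proof. exact: comp_mpolyZ. Qed.

Lemma mx_act_id p : mx_act rG 1%g p = p.
Proof.
apply: (@mpoly_rmorph_eq _ _ _ (mx_act rG 1%g) idfun) => [c|i] /=.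
  exact: mx_actC.
rewrite mx_actX invg1 repr_mx1 (bigD1 i) //= big1 ?addr0 => [|j /negPf ji].
  by rewrite mxE eqxx scale1r.
by rewrite mxE eq_sym ji scale0r.
Qed.

Lemma mx_act_mul x y p : mx_act rG (x * y)%g p = mx_act rG x (mx_act rG y p).
Proof.
apply: (@mpoly_rmorph_eq _ _ _ (mx_act rG (x * y)%g) (mx_act rG x \o mx_act rG y)) => [c|i] /=.
  by rewrite !mx_actC.
rewrite !mx_actX rmorph_sum invMg repr_mxM ?finset.in_setT //=.
under [RHS]eq_bigr do rewrite mx_actZ mx_actX scaler_sumr.
rewrite exchange_big; apply: eq_bigr => j _; rewrite mxE scaler_suml.
by apply: eq_bigr => k _; rewrite scalerA.
Qed.

Definition mx_action : scalar_action C gT {mpoly C[n]} :=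
  @ScalarAction C gT {mpoly C[n]} (@mpolyC n C) (fun x => mx_act rG x)
    mx_act_id mx_act_mul mx_actC.

Lemma mpoly_unit_const p : p \is a GRing.unit -> exists c, p = c%:MP.
Proof. by move=> /andP[/eqP pE _]; exists p@_0. Qed.

Lemma mpoly_const_unit p : p != 0 -> (msize p <= 1)%N -> p \is a GRing.unit.
Proof.
move=> p0 /msize1_polyC pE; have c0 : p@_0 != 0.
  by apply: contra_neq p0 => c0; rewrite pE c0 mpolyC0.
apply: (@divides_unit _ _ 1 (unitr1 _)).
by exists (p@_0)^-1%:MP; rewrite {2}pE -mpolyCM mulVf ?mpolyC1.
Qed.

Context (rG_faithful : mx_faithful rG) (rG_small : small rG).

Lemma mx_pow_card x : rG x ^+ #|gT| = 1.
Proof.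
have -> m : rG x ^+ m = rG (x ^+ m)%g.
  elim: m => [|m IH]; first by rewrite expr0 expg0 repr_mx1.
  by rewrite exprS IH expgS repr_mxM ?finset.in_setT.
by rewrite -cardsT expg_cardG ?finset.in_setT // repr_mx1.
Qed.

(* Otherwise the linear forms k.X_i - X_i are all multiples of h; hence k - 1 has
   rank at most 1. *)
Lemma small_separated_id h k : generates_prime h -> k != 1%g ->
  exists w, ~ divides h (mx_act rG k w - w).
Proof.
move=> hp k1; apply: contrapT => no.
have {no} hk w : divides h (mx_act rG k w - w) by apply: contrapT => hw; apply: no; exists w.
(* The inverse comes from [mx_act]: row i of B holds the coefficients of the linear form k.X_i -
   X_i. *)
pose B := rG k^-1%g - 1%:M.
pose l i := \sum_j B i j *: 'X_j : {mpoly C[n]}.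
have lE i : l i = mx_act rG k 'X_i - 'X_i.
  rewrite mx_actX /l (bigD1 i) //= [in RHS](bigD1 i) //= !mxE eqxx.
  rewrite scalerBl scale1r addrAC; congr (_ + _ - _).
  by apply: eq_bigr => j /negPf ji; rewrite !mxE eq_sym ji subr0.
have coefl i j : (l i)@_U_(j) = B i j.
  rewrite /l raddf_sum (bigD1 j) //= mcoeffZ mcoeffX eqxx mulr1 big1 ?addr0 // => a /negPf ja.
  by rewrite mcoeffZ mcoeffX eq_mnm1 ja mulr0.
have size_l i : (msize (l i) <= 2)%N.
  apply: leq_trans (msize_sum _ _ _) _; apply/bigmax_leqP => j _.
  by apply: leq_trans (msizeZ_le _ _) _; rewrite msizeX mdeg1.
have B0 : B != 0.
  apply: contra_neq k1 => /eqP; rewrite subr_eq0 => /eqP B1.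
  apply: invg_inj; rewrite invg1; apply: (mx_faithful_inj rG_faithful); rewrite ?finset.in_setT //.
  by rewrite repr_mx1.
have h0 : h != 0.
  apply/eqP => h0; move: B0; apply/negP; rewrite negbK; apply/eqP/matrixP => i j.
  have := hk 'X_i; rewrite -lE h0 => -[c cE]; rewrite -coefl cE mulr0 mcoeff0 mxE //.
have size_h : (1 < msize h)%N.
  by rewrite ltnNge; apply/negP => /(mpoly_const_unit h0); exact/negP/hp.1.
(* [l i] has degree at most 1 and h is not constant, so the cofactor is a constant. Hence B is the
   column of these constants times the row of linear coefficients of h. *)
have /choice[c cE] : forall i, exists c, l i = c%:MP * h.
  move=> i; have := hk 'X_i; rewrite -lE => -[q qE]; rewrite qE.
  have [->|q0] := eqVneq q 0; first by exists 0; rewrite mpolyC0.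
  exists q@_0; rewrite -msize1_polyC //.
  have := size_l i; rewrite qE msizeM //; move: (msize q) (msize h) size_h => a b; lia.
have BE : B = (\col_i c i) *m (\row_j h@_U_(j)).
  by apply/matrixP => i j; rewrite -coefl cE mcoeffCM !mxE big_ord1 !mxE.
have rB : \rank B = 1%N.
  apply/eqP; rewrite eqn_leq lt0n mxrank_eq0 B0 andbT BE.
  by apply: leq_trans (mxrankM_maxl _ _) _; exact: rank_leq_col.
apply: (rG_small (g := k^-1%g)); split.
  by exists #|gT|; [apply/card_gt0P; exists 1%g | exact: mx_pow_card].
have BT : (rG k^-1%g)^T - 1%:M = B^T by rewrite linearB /= trmx1.
rewrite /eigenspace mxrank_ker BT mxrank_tr rB.
by have := rank_leq_row B; rewrite rB; lia.
Qed.

(** Applying the inverse of y turns the pair x, y modulo h into the pair [(y^-1 * x)%g], 1 modulo a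
    conjugate of h. *)
Lemma small_separated h x y : generates_prime h -> x != y ->
  exists w, ~ divides h (mx_act rG x w - mx_act rG y w).
Proof.
move=> hp xy; have k1 : (y^-1 * x)%g != 1%g.
  by apply: contra_neq xy => /eqP; rewrite -eq_mulVg1 => /eqP.
have yK z p : mx_act rG z (mx_act rG z^-1%g p) = p by rewrite -mx_act_mul mulgV mx_act_id.
have hp' : generates_prime (mx_act rG y^-1%g h).
  split; first by apply: contra hp.1 => /(rmorph_unit (mx_act rG y)) /=; rewrite yK.
  have div p q : divides (mx_act rG y^-1%g p) q <-> divides p (mx_act rG y q).
    split=> -[c cE].
      by exists (mx_act rG y c); rewrite cE mx_actM yK.
    exists (mx_act rG y^-1%g c); rewrite -mx_actM -cE.
    by rewrite -[y in mx_act rG y q]invgK yK.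
  by move=> p q; rewrite !div mx_actM; exact: hp.2.
have [w hw] := small_separated_id hp' k1; exists w => -[c cE]; apply: hw.
exists (mx_act rG y^-1%g c); rewrite -mx_actM -cE mx_actB -!mx_act_mul.
by rewrite mulVg mx_act_id.
Qed.

Local Notation A := (invariant_ring rG [set: gT]).

Lemma invariant_val_im p : (forall x, mx_act rG x p = p) <-> exists a : A, p = val a.
Proof.
split=> [px|[a ->] x].
  have pP : p \in invariants rG [set: gT] by apply/invariantsP => x _.
  by exists (exist (fun p => p \in invariants rG [set: gT]) p pP).
by have /invariantsP -> // := valP a; rewrite finset.in_setT.
Qed.

Definition matrix_quotient : small_quotient C gT {mpoly C[n]} A :=
  @SmallQuotient C gT {mpoly C[n]} A mx_action (@factorial_mpoly C n) mpoly_unit_const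
    small_separated (val : {rmorphism A -> {mpoly C[n]}}) val_inj invariant_val_im.

End MatrixGroup.

(** * The presented algebra *)

Section Presentation.
Context (C : fieldType) (n s : nat) (g : s.-tuple {mpoly C[n]}).
Implicit Types (p q : {mpoly C[s]}) (r : {mpoly C[n + s]}).

Lemma graph_idealD r r' : graph_ideal g r -> graph_ideal g r' -> graph_ideal g (r + r').
Proof.
move=> [c ->] [d ->]; exists (fun j => c j + d j).
by rewrite -big_split; apply: eq_bigr => j _; rewrite mulrDl.
Qed.

Lemma graph_idealM r r' : graph_ideal g r -> graph_ideal g (r' * r).
Proof.
move=> [c ->]; exists (fun j => r' * c j); rewrite mulr_sumr.
by apply: eq_bigr => j _; rewrite mulrA.
Qed.

Lemma graph_ideal0 : graph_ideal g 0.
Proof. by exists (fun=> 0); rewrite big1 // => j _; rewrite mul0r. Qed.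

Lemma graph_ideal_sum (I : Type) (l : seq I) (P : pred I) (f : I -> {mpoly C[n + s]}) :
  (forall i, P i -> graph_ideal g (f i)) -> graph_ideal g (\sum_(i <- l | P i) f i).
Proof. by move=> fP; elim/big_ind: _ => //; [exact: graph_ideal0 | exact: graph_idealD]. Qed.

Let congruent r r' := graph_ideal g (r - r').

Let congruentM r r' t t' : congruent r r' -> congruent t t' -> congruent (r * t) (r' * t').
Proof.
move=> rr' tt'; rewrite /congruent (_ : _ - _ = t * (r - r') + r' * (t - t')); last by ring.
by apply: graph_idealD; exact: graph_idealM.
Qed.

Let congruent_refl r : congruent r r.
Proof. by rewrite /congruent subrr; exact: graph_ideal0. Qed.

(** Modulo J each T_j can be replaced by g_j(S), first in powers, then in monomials, then in q. *)
Lemma graph_ideal_reduce q : graph_ideal g ((q \mPo T_vars C n s) - ((q \mPo g) \mPo S_vars C n s)).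
Proof.
rewrite -/(congruent _ _) (comp_mpolyEX q g) (comp_mpolyEX q (T_vars C n s)).
rewrite /congruent rmorph_sum /= -sumrB; apply: graph_ideal_sum => m _.
rewrite !comp_mpolyZ -scalerBr -mul_mpolyC; apply: graph_idealM.
rewrite !comp_mpolyX rmorph_prod -/(congruent _ _).
apply: (big_ind2 congruent) => [||j _]; [exact: congruent_refl|by move=> *; exact: congruentM|].
rewrite rmorphXn; elim: (m j) => [|k IH]; first by rewrite !expr0.
rewrite !exprS; apply: congruentM IH; exists (fun i => (i == j)%:R).
by rewrite (bigD1 j) //= eqxx mul1r big1 ?addr0 // => i /negPf->; rewrite mul0r.
Qed.

(** The substitution which fixes the S_a and sends T_b to g_b kills J and sends q(T) to q(g); the
    other direction is [graph_ideal_reduce]. *)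
Lemma elimination_idealE q : (q \in elimination_ideal g) = (q \mPo g == 0).
Proof.
apply/asboolP/eqP => [[c cE]|q0]; last first.
  by have := graph_ideal_reduce q; rewrite q0 rmorph0 subr0.
pose t : (n + s).-tuple {mpoly C[n]} :=
  [tuple match fintype.split i with inl a => 'X_a | inr b => tnth g b end | i < n + s].
have TE i : 'X_i \mPo T_vars C n s = 'X_(rshift n i).
  by rewrite comp_mpolyXU -tnth_nth tnth_mktuple.
have SE i : 'X_i \mPo S_vars C n s = 'X_(lshift s i).
  by rewrite comp_mpolyXU -tnth_nth tnth_mktuple.
have tT p : (p \mPo T_vars C n s) \mPo t = p \mPo g.
  apply: (@mpoly_rmorph_eq _ _ _ (comp_mpoly t \o comp_mpoly (T_vars C n s)) (comp_mpoly g)) => [d|i] /=.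
    by rewrite !comp_mpolyC.
  by rewrite !TE !comp_mpolyXU -!tnth_nth tnth_mktuple (unsplitK (inr i)).
have tS (p : {mpoly C[n]}) : (p \mPo S_vars C n s) \mPo t = p.
  apply: (@mpoly_rmorph_eq _ _ _ (comp_mpoly t \o comp_mpoly (S_vars C n s)) idfun) => [d|i] /=.
    by rewrite !comp_mpolyC.
  by rewrite SE comp_mpolyXU -tnth_nth tnth_mktuple (unsplitK (inl i)).
rewrite -tT cE rmorph_sum big1 // => j _ /=.
rewrite rmorphM rmorphB /= tS tnth_mktuple comp_mpolyXU -tnth_nth tnth_mktuple.
by rewrite (unsplitK (inr j)) subrr mulr0.
Qed.

Definition presented_value (z : presented_algebra g) : {mpoly C[n]} :=
  (generic_quotient.repr z) \mPo g.

Lemma presented_value_class q : presented_value (presented_class g q) = q \mPo g.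
Proof.
apply/eqP; rewrite /presented_value -subr_eq0 -comp_mpolyB -elimination_idealE.
by rewrite Quotient.idealrBE /presented_class reprK.
Qed.

Lemma presented_class_surjective (z : presented_algebra g) : exists q, z = presented_class g q.
Proof. by exists (generic_quotient.repr z); rewrite /presented_class reprK. Qed.

Lemma presented_value_is_zmod_morphism : zmod_morphism presented_value.
Proof.
move=> z w; have [p ->] := presented_class_surjective z.
have [q ->] := presented_class_surjective w.
by rewrite /presented_class -pi_is_zmod_morphism -!/(presented_class _ _)
  !presented_value_class comp_mpolyB.
Qed.

Lemma presented_value_is_monoid_morphism : monoid_morphism presented_value.
Proof.
split; first by rewrite -(rmorph1 (\pi_(presented_algebra g))) -/(presented_class g 1) presented_value_class comp_mpoly1.
move=> z w; have [p ->] := presented_class_surjective z.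
have [q ->] := presented_class_surjective w.
by rewrite /presented_class -rmorphM -!/(presented_class _ _) !presented_value_class rmorphM.
Qed.

HB.instance Definition _ := GRing.isZmodMorphism.Build (presented_algebra g) {mpoly C[n]}
  presented_value presented_value_is_zmod_morphism.
HB.instance Definition _ := GRing.isMonoidMorphism.Build (presented_algebra g) {mpoly C[n]}
  presented_value presented_value_is_monoid_morphism.

Lemma presented_value_inj : injective presented_value.
Proof.
move=> z w; have [p ->] := presented_class_surjective z.
have [q ->] := presented_class_surjective w.
rewrite !presented_value_class => /eqP; rewrite -subr_eq0 -comp_mpolyB -elimination_idealE.
by rewrite Quotient.idealrBE => /eqP.
Qed.

End Presentation.

(** U and V are identified with the same subring of W. It is applied with W = Frac S to the
    presented algebra and the Cox ring. *)
Lemma rmorphism_factor (U V W : nzRingType) (f : {rmorphism U -> W}) (g : {rmorphism V -> W}) :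
  injective f -> injective g -> (forall u, exists v, g v = f u) ->
  (forall v, exists u, f u = g v) ->
  exists2 phi : {rmorphism U -> V}, bijective phi & forall u, g (phi u) = f u.
Proof.
move=> f_inj g_inj /choice[h hE] /choice[k kE].
have hB : zmod_morphism h by move=> u u'; apply: g_inj; rewrite rmorphB !hE rmorphB.
have hM : monoid_morphism h.
  by split=> [|u u']; apply: g_inj; rewrite ?rmorph1 ?rmorphM !hE ?rmorph1 ?rmorphM.
pose phi : {rmorphism U -> V} := HB.pack h
  (GRing.isZmodMorphism.Build U V h hB) (GRing.isMonoidMorphism.Build U V h hM).
exists phi => //; exists k => [u|v]; first by apply: f_inj; rewrite kE hE.
by apply: g_inj; rewrite hE kE.
Qed.

(** * The grading of the presented algebra *)

Section PresentationGrading.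
Context (C : numClosedFieldType) (n : nat) (gT : finGroupType).
Context (rG : mx_representation C [set: gT] n).
Context (s : nat) (g : s.-tuple {mpoly C[n]}) (chi : 'I_s -> char_group (abelianization gT) C).
Local Notation D := (derived_subgroup gT).
Local Notation X := (char_group (abelianization gT) C).
Local Notation act := (mx_action rG).
Hypothesis g_gen : generates_invariants rG D g.
Hypothesis g_eigen : forall i x,
  mx_act rG x (tnth g i) = val (chi i) (coset D x) *: tnth g i.
Implicit Types (k : X) (m : 'X_{1..s}) (q : {mpoly C[s]}).

Lemma semi_invariant_generator i : semi_invariant act (chi i) (tnth g i).
Proof. by move=> x; rewrite /= g_eigen -mul_mpolyC. Qed.

Lemma monomial_degreeE m : monomial_degree chi m = \sum_i chi i *+ m i.
Proof. by apply: eq_bigr => i _; rewrite mxE. Qed.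

Lemma semi_invariant_monomial m : semi_invariant act (monomial_degree chi m) ('X_[m] \mPo g).
Proof.
rewrite monomial_degreeE comp_mpolyX.
apply: (big_ind2 (semi_invariant act)) => [|k t k' t'|i _].
- exact: semi_invariant1.
- exact: semi_invariantM.
elim: (m i) => [|e IH]; first by rewrite mulr0n expr0; exact: semi_invariant1.
by rewrite mulrS exprS; apply: semi_invariantM IH; exact: semi_invariant_generator.
Qed.

Lemma semi_invariantZ k (c : C) (p : {mpoly C[n]}) :
  semi_invariant act k p -> semi_invariant act k (c *: p).
Proof. by rewrite -mul_mpolyC; exact: (@semi_invariant_scal _ _ _ act). Qed.

(** A monomial in the g_i is a semi-invariant whose weight is the degree of the monomial, so the
    projector selects exactly the monomials of degree k. *)
Lemma homogeneous_part_value k q : homogeneous_part chi k q \mPo g = proj act k (q \mPo g).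
Proof.
rewrite (comp_mpolyEX q g) /homogeneous_part rmorph_sum raddf_sum big_mkcond /=.
apply: eq_bigr => m _; rewrite eq_sym.
rewrite (proj_semi_invariant _ (semi_invariantZ _ (semi_invariant_monomial m))).
by case: eqP; rewrite ?comp_mpolyZ.
Qed.

Lemma homogeneous_elimination_ideal : homogeneous_ideal g chi.
Proof.
move=> k q; rewrite !elimination_idealE homogeneous_part_value => /eqP->.
by rewrite raddf0.
Qed.

Lemma msupp_homogeneous_part k q m :
  m \in msupp (homogeneous_part chi k q) -> monomial_degree chi m = k.
Proof.
rewrite mcoeff_msupp raddf_sum /= => h; apply/eqP; apply: contraNT h => ne.
rewrite big1 // => m' m'k; rewrite mcoeffZ mcoeffX.
by case: eqP => [mm'|_]; rewrite ?mulr0 //; rewrite mm' (negPf ne) in m'k.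
Qed.

Lemma presented_componentE k (z : presented_algebra g) :
  presented_component chi k z <-> semi_invariant act k (presented_value z).
Proof.
split=> [[p [-> pk]]|zk].
  rewrite presented_value_class (comp_mpolyEX p g) big_seq.
  apply: semi_invariant_sum => m /pk <-.
  exact/semi_invariantZ/semi_invariant_monomial.
have [q zE] := presented_class_surjective z.
rewrite zE presented_value_class in zk.
exists (homogeneous_part chi k q); split; last exact: msupp_homogeneous_part.
rewrite zE; apply: presented_value_inj; rewrite !presented_value_class homogeneous_part_value.
by rewrite (proj_semi_invariant _ zk) eqxx.
Qed.

Lemma presented_value_invariant (z : presented_algebra g) x : x \in D ->
  mx_act rG x (presented_value z) = presented_value z.
Proof.
move=> xD; have [q ->] := presented_class_surjective z; rewrite presented_value_class.
apply: (@mpoly_rmorph_eq _ _ _ (mx_act rG x \o comp_mpoly g) (comp_mpoly g)) => [c|i] /=.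
  by rewrite comp_mpolyC mx_actC.
rewrite comp_mpolyXU -tnth_nth.
exact: (semi_invariant_derived (semi_invariant_generator i) xD).
Qed.

Lemma presented_value_surjective (p : {mpoly C[n]}) :
  (forall x, x \in D -> mx_act rG x p = p) -> exists z : presented_algebra g, presented_value z = p.
Proof.
move=> pD; have [|q ->] := g_gen.2 p; first exact/invariantsP.
by exists (presented_class g q); rewrite presented_value_class.
Qed.

End PresentationGrading.

(** * Existence of homogeneous systems of generators *)

Section HomogeneousSystem.
Context (C : numClosedFieldType) (n : nat) (gT : finGroupType).
Context (rG : mx_representation C [set: gT] n).
Local Notation D := (derived_subgroup gT).
Local Notation X := (char_group (abelianization gT) C).
Local Notation act := (mx_action rG).
Implicit Types (p q r : {mpoly C[n]}) (d : nat) (x : gT).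

Lemma dhomog_bigprod (I : Type) (l : seq I) (f : I -> {mpoly C[n]}) (e : I -> nat) :
  (forall i, f i \is (e i).-homog) -> \prod_(i <- l) f i \is (\sum_(i <- l) e i)%N.-homog.
Proof.
move=> fe; elim: l => [|i l IH]; first by rewrite !big_nil dhomog1.
by rewrite !big_cons; exact: dhomogM.
Qed.

Lemma dhomog_mx_act x p d : p \is d.-homog -> mx_act rG x p \is d.-homog.
Proof.
move=> pd; rewrite /mx_act comp_mpolyEX big_seq; apply: rpred_sum => m mp.
apply: dhomogZ; rewrite comp_mpolyX.
have <- : (\sum_(i < n) (1 * m i) = d)%N.
  have <- : mdeg m = d by exact: dhomog_mf pd m mp.
  by rewrite mdegE; apply: eq_bigr => i _; exact: mul1n.
apply: dhomog_bigprod => i; apply: dhomogMn; rewrite tnth_mktuple.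
by apply: rpred_sum => j _; apply: dhomogZ; rewrite dhomogX /= mdeg1.
Qed.

Lemma dhomog_proj k p d : p \is d.-homog -> proj act k p \is d.-homog.
Proof.
move=> pd; rewrite /proj mul_mpolyC; apply: dhomogZ; apply: rpred_sum => x _.
by rewrite mul_mpolyC; apply: dhomogZ; exact: dhomog_mx_act.
Qed.

Lemma dhomog0_const p : p \is 0.-homog -> p = (p@_0)%:MP.
Proof.
move=> p0; apply/mpolyP => m; rewrite mcoeffC.
have [->|m0] := eqVneq m 0%MM; first by rewrite mulr1.
by rewrite mulr0 (dhomog_nemf_coeff p0) //= mdeg_eq0.
Qed.

Definition tuple_set (T : Type) (s : nat) (g : s.-tuple T) (j : 'I_s) (u : T) : s.-tuple T :=
  [tuple if i == j then u else tnth g i | i < s].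

Section Exchange.
Context (s : nat) (g : s.-tuple {mpoly C[n]}) (e : 'I_s -> nat) (j : 'I_s).
Hypothesis g_gen : generates_invariants rG D g.
Hypothesis g_neq0 : forall i, tnth g i != 0.
Hypothesis g_homog : forall i, tnth g i \is (e i).-homog.

(** That p is a polynomial in the generators other than g_j is expressed by one q whose value is p
    whatever stands in position j. *)
Definition from_others p : Prop :=
  exists q : {mpoly C[s]}, forall u, p = q \mPo tuple_set g j u.

Lemma from_othersD p p' : from_others p -> from_others p' -> from_others (p + p').
Proof.
by move=> [q qE] [q' q'E]; exists (q + q') => u; rewrite comp_mpolyD -qE -q'E.
Qed.

Lemma from_othersM p p' : from_others p -> from_others p' -> from_others (p * p').
Proof.
by move=> [q qE] [q' q'E]; exists (q * q') => u; rewrite rmorphM /= -qE -q'E.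
Qed.

Lemma from_othersC (c : C) : from_others c%:MP.
Proof. by exists c%:MP => u; rewrite comp_mpolyC. Qed.

Lemma from_others0 : from_others 0. Proof. by rewrite -mpolyC0; exact: from_othersC. Qed.

Lemma from_othersZ c p : from_others p -> from_others (c *: p).
Proof. by rewrite -mul_mpolyC; apply: from_othersM; exact: from_othersC. Qed.

Lemma from_others_generator i : i != j -> from_others (tnth g i).
Proof.
move=> ij; exists 'X_i => u; rewrite comp_mpolyXU -tnth_nth tnth_mktuple.
by rewrite (negPf ij).
Qed.

Lemma from_others_prod (l : seq 'I_s) (f : 'I_s -> {mpoly C[n]}) :
  (forall i, from_others (f i)) -> from_others (\prod_(i <- l) f i).
Proof.
move=> fP; elim/big_ind: _ => // [|p p']; last exact: from_othersM.
by rewrite -mpolyC1; exact: from_othersC.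
Qed.

Lemma from_others_monomial (m : 'X_{1..s}) : m j = 0%N -> from_others ('X_[m] \mPo g).
Proof.
move=> mj0; rewrite comp_mpolyX; apply: from_others_prod => i.
have [->|ij] := eqVneq i j; first by rewrite mj0 expr0 -mpolyC1; exact: from_othersC.
elim: (m i) => [|k IH]; first by rewrite expr0 -mpolyC1; exact: from_othersC.
by rewrite exprS; apply: from_othersM IH; exact: from_others_generator.
Qed.

Lemma dhomog_monomial (m : 'X_{1..s}) :
  'X_[m] \mPo g \is (\sum_(i < s) e i * m i)%N.-homog.
Proof. by rewrite comp_mpolyX; apply: dhomog_bigprod => i; exact: dhomogMn. Qed.

(* In a monomial of the degree of g_j which involves g_j, the cofactor of g_j
   has degree 0. *)
Lemma homogeneous_modulo_others p : p \in invariants rG D -> p \is (e j).-homog ->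
  exists c : C, from_others (p - c *: tnth g j).
Proof.
move=> pD pe; have [q pE] := g_gen.2 p pD.
(* As p is homogeneous of degree e_j, it is enough to treat the monomials of q, each cut down to its
   part of that degree. *)
have mono (m : 'X_{1..s}) : exists c : C,
    from_others (pihomog mdeg (e j) ('X_[m] \mPo g) - c *: tnth g j).
  have mh := dhomog_monomial m.
  have [de|nde] := eqVneq (\sum_(i < s) e i * m i)%N (e j); last first.
    exists 0; rewrite (pihomog_ne0 nde mh) scale0r subr0; exact: from_others0.
  rewrite de in mh; rewrite (pihomog_dE mh).
  have [mj|mj] := posnP (m j); first by exists 0; rewrite scale0r subr0; exact: from_others_monomial.
  pose m' := (m - U_(j))%MM.
  have mE : m = (U_(j) + m')%MM by rewrite addmC submK // lep1mP -lt0n.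
  have gm : 'X_[m] \mPo g = tnth g j * ('X_[m'] \mPo g).
    by rewrite {1}mE mpolyXD rmorphM /= comp_mpolyXU -tnth_nth.
  have m'0 : (\sum_(i < s) e i * m' i = 0)%N.
    apply/eqP; rewrite -(eqn_add2l (e j)) addn0 -[X in _ == X]de; apply/eqP.
    have -> : e j = (\sum_(i < s) e i * U_(j)%MM i)%N.
      rewrite (bigD1 j) //= mnm1E eqxx muln1 big1 ?addn0 // => i /negPf ij.
      by rewrite mnm1E eq_sym ij muln0.
    by rewrite -big_split /=; apply: eq_bigr => i _; rewrite [in RHS]mE mnmDE mulnDr.
  have m'h := dhomog_monomial m'; rewrite m'0 in m'h.
  exists ('X_[m'] \mPo g)@_0; rewrite gm {1}(dhomog0_const m'h).
  by rewrite mulrC mul_mpolyC subrr; exact: from_others0.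
have [c cP] := choice mono.
exists (\sum_(m <- msupp q) q@_m * c m).
rewrite -{1}(pihomog_dE pe) pE (comp_mpolyEX q g) linear_sum scaler_suml -sumrB.
apply: (big_ind from_others); [apply: from_others0|apply: from_othersD|] => m _.
by rewrite /= [pihomog _ _ _]linearZ /= -scalerA -scalerBr; exact: from_othersZ.
Qed.

Lemma generates_transfer (g' : s.-tuple {mpoly C[n]}) :
  (forall i, tnth g' i \in invariants rG D) ->
  (forall i, exists q : {mpoly C[s]}, tnth g i = q \mPo g') -> generates_invariants rG D g'.
Proof.
move=> g'D /choice[q qE]; split=> // p /g_gen.2[r ->].
exists (r \mPo [tuple q i | i < s]).
apply: (@mpoly_rmorph_eq _ _ _ (comp_mpoly g)
    (comp_mpoly g' \o comp_mpoly [tuple q i | i < s])) => [c|i] /=.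
  by rewrite !comp_mpolyC.
by rewrite !comp_mpolyXU -!tnth_nth tnth_mktuple qE.
Qed.

Lemma tnth_tuple_set u i : tnth (tuple_set g j u) i = if i == j then u else tnth g i.
Proof. exact: tnth_mktuple. Qed.

(** If g_j is a polynomial in the others, any of its nonzero isotypic components can take its place.
    Otherwise, g_j being the sum of its components, one of them is congruent to a nonzero multiple
    of g_j modulo the others, and g_j is recovered from it. *)
Lemma exchange : exists u, [/\ generates_invariants rG D (tuple_set g j u),
  u != 0, u \is (e j).-homog & exists k : X, semi_invariant act k u].
Proof.
have [chis [Uchis chisP]] := char_group_finite C (abelianization gT).
have gjD x : x \in D -> mx_act rG x (tnth g j) = tnth g j.
  by have /invariantsP := g_gen.1 j; apply.
have gjE := @sum_proj _ _ _ act chis (tnth g j) Uchis chisP gjD.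
have comp_inv (k : X) : proj act k (tnth g j) \in invariants rG D.
  by apply/invariantsP => x xD; exact: (semi_invariant_derived (semi_invariant_proj act k _) xD).
have comp_homog (k : X) : proj act k (tnth g j) \is (e j).-homog by exact: dhomog_proj.
have gen u : u \in invariants rG D -> (exists q : {mpoly C[s]}, tnth g j = q \mPo tuple_set g j u) ->
    generates_invariants rG D (tuple_set g j u).
  move=> uD gju; apply: generates_transfer => i.
    by rewrite tnth_tuple_set; case: eqP => // _; exact: g_gen.1.
  have [->//|ij] := eqVneq i j.
  by have [q qE] := from_others_generator ij; exists q.
have [[q qE]|nB] := pselect (from_others (tnth g j)).
  have [k k0] : exists k : X, proj act k (tnth g j) != 0.
    apply: contrapT => no; case/eqP: (g_neq0 j); rewrite gjE big1 // => k _.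
    by apply/eqP; apply: contrapT => /negP k0; apply: no; exists k.
  exists (proj act k (tnth g j)); split=> //; last by exists k; exact: semi_invariant_proj.
  by apply: gen => //; exists q.
have /choice[c cE] : forall k : X, exists c : C, from_others (proj act k (tnth g j) - c *: tnth g j).
  by move=> k; exact: homogeneous_modulo_others.
have [k ck0] : exists k : X, c k != 0.
  apply: contrapT => no; apply: nB; rewrite gjE.
  apply: (big_ind from_others); [apply: from_others0|apply: from_othersD|] => k _.
  have c0 : c k = 0 by apply/eqP; apply: contrapT => /negP k0; apply: no; exists k.
  by have := cE k; rewrite c0 scale0r subr0.
have [b bE] := cE k; set u := proj act k (tnth g j) in bE *.
have gju : tnth g j = (c k)^-1 *: (u - (u - c k *: tnth g j)).
  by rewrite opprB addrC subrK scalerA mulVf // scale1r.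
exists u; split=> //; last by exists k; exact: semi_invariant_proj.
- apply: gen; first exact: comp_inv.
  exists ((c k)^-1 *: ('X_j - b)).
  rewrite comp_mpolyZ comp_mpolyB comp_mpolyXU -tnth_nth tnth_tuple_set eqxx -bE.
  exact: gju.
- apply/negP => /eqP u0; apply: nB; rewrite gju; apply: from_othersZ.
  by rewrite u0 sub0r -scaleN1r; apply: from_othersZ; rewrite -u0; exists b.
- exact: comp_homog.
Qed.

End Exchange.

(** The entries are exchanged in turn. Each exchange changes one entry and keeps its degree, so the
    entries already treated stay eigenvectors and the degrees stay those of f. *)
Lemma exists_homogeneous_system (s : nat) (f : s.-tuple {mpoly C[n]}) :
  generates_invariants rG D f ->
  (forall i, tnth f i != 0 /\ exists d, tnth f i \is d.-homog) ->
  exists g chi, homogeneous_system rG f g chi.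
Proof.
move=> f_gen fP; pose e i := (msize (tnth f i)).-1.
have step k : (k <= s)%N -> exists g : s.-tuple {mpoly C[n]},
    [/\ generates_invariants rG D g, forall i, tnth g i != 0,
      forall i, tnth g i \is (e i).-homog &
      forall i : 'I_s, (i < k)%N -> exists k' : X, semi_invariant act k' (tnth g i)].
  elim: k => [|k IH] le_k.
    exists f; split=> // i; first by case: (fP i).
    by have [_ [d /dhomog_msize]] := fP i.
  have [g [g_gen g0 ge gk]] := IH (ltnW le_k).
  have [u [u_gen u0 ue uk]] := exchange (Ordinal le_k) g_gen g0 ge.
  exists (tuple_set g (Ordinal le_k) u); split=> // i; rewrite tnth_tuple_set.
  - by case: (i =P _).
  - by case: (i =P _) => // ->.
  - case: (i =P _) => // ik; rewrite ltnS leq_eqVlt => /predU1P[ik'|/gk//].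
    by case: ik; apply: val_inj.
have [g [g_gen g0 ge gk]] := step s (leqnn s).
have /choice[chi chiP] : forall i, exists k : X, semi_invariant act k (tnth g i).
  by move=> i; exact: gk.
exists g, chi; split=> // [i|i x]; first by exists i; exact: ge.
by have := chiP i x; rewrite /= mul_mpolyC.
Qed.

End HomogeneousSystem.

Lemma cox_ring_presentation (C : numClosedFieldType) (n : nat) (gT : finGroupType)
    (rG : mx_representation C [set: gT] n)
    (rG_faithful : mx_faithful rG) (rG_small : small rG)
    (s : nat) (g : s.-tuple {mpoly C[n]}) (chi : 'I_s -> char_group (abelianization gT) C)
    (cd : cox_datum (invariant_ring rG [set: gT])) :
  let Q := matrix_quotient rG_faithful rG_small in
  generates_invariants rG (derived_subgroup gT) g ->
  (forall i x, mx_act rG x (tnth g i) =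
     val (chi i) (coset (derived_subgroup gT) x) *: tnth g i) ->
  exists phi : {rmorphism presented_algebra g -> cox_ring cd},
    [/\ bijective phi,
        (forall z : C, phi (presented_class g z%:MP) =
                       cox_scalar cd (invariant_scalar rG [set: gT] z))
      & forall c t, presented_component chi (class_character Q c) t <->
                    cox_component c (phi t)].
Proof.
move=> Q g_gen g_eigen.
(* The images of [alpha] and of [cox_value] in the fraction field are both the ring of invariants of
   the derived subgroup. *)
pose alpha : {rmorphism presented_algebra g -> {fraction {mpoly C[n]}}} :=
  @tofrac {mpoly C[n]} \o presented_value (g := g).
have alpha_inj : injective alpha.
  by move=> t u /eqP; rewrite /= tofrac_eq => /eqP/presented_value_inj.
have [|t|phi phi_bij phiE] := rmorphism_factor alpha_inj (@cox_value_inj _ _ _ _ Q cd).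
- move=> t; apply: cox_value_surjective => x xD.
  exact: (presented_value_invariant g_eigen).
- have [p pD pE] := cox_value_integral Q t.
  have [z zE] := presented_value_surjective g_gen pD.
  by exists z; rewrite /= zE; exact: esym pE.
exists phi; split=> // [z|c t].
  apply: (@cox_value_inj _ _ _ _ Q cd); rewrite phiE cox_value_scalar /=.
  by rewrite presented_value_class comp_mpolyC.
have -> : presented_component chi (class_character Q c) t <->
    semi_invariant Q (class_character Q c) (presented_value t).
  exact: presented_componentE.
have E : cox_value Q (phi t) = tofrac (presented_value t) := phiE t.
rewrite -semi_invariant_tofrac -E.
split; first exact: cox_value_component.
exact: cox_component_value.
Qed.

Theorem mainTheorem1 (R : realType) (n : nat) (gT : finGroupType)
    (rG : mx_representation R[i] [set: gT] n)
    (rG_faithful : mx_faithful rG) (rG_small : small rG) :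
  let G := [set: gT] in
  let A := invariant_ring rG G in
  exists psi : {additive class_group A -> char_group (abelianization gT) R[i]},
    bijective psi /\
    (* The choices in the construction of the Cox ring can be made. *)
    inhabited (cox_datum A) /\
    forall (s : nat) (f : s.-tuple {mpoly R[i][n]}),
      generates_invariants rG [~: G, G]%g f ->
      (* The second step can be carried out on homogeneous generators. *)
      ((forall i, tnth f i != 0 /\ exists d, tnth f i \is d.-homog) ->
        exists g chi, homogeneous_system rG f g chi) /\
      forall g chi, homogeneous_system rG f g chi ->
        homogeneous_ideal g chi /\
        forall cd : cox_datum A,
          exists phi : {rmorphism presented_algebra g -> cox_ring cd},
            [/\ bijective phi,
                (forall z : R[i], phi (presented_class g z%:MP) =
                                  cox_scalar cd (invariant_scalar rG G z))
              & forall c t, presented_component chi (psi c) t <->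
                            cox_component c (phi t)].
Proof.
move=> G A; pose Q := matrix_quotient rG_faithful rG_small.
exists (class_character Q); split; first exact: class_character_bij.
split; first exact: (cox_datum_exists Q).
move=> s f f_gen; split; first exact: exists_homogeneous_system.
move=> g chi [g_gen _ _ g_eigen]; split; first exact: (homogeneous_elimination_ideal g_eigen).
by move=> cd; exact: cox_ring_presentation.
Qed.
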